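(* Let $R>0$, $\sigma>0$ and let $U$ be a solution of the initial value problem $$\partial_t^2U(x,t)+\Delta^2U(x,t)+\sigma\partial_tU(x,t)=0,\quad (x,t)\in B_R\times(0,+\infty),$$ $$U(x,0)=0,\quad \partial_tU(x,0)=f(x),\quad x\in B_R.$$ Let the observation time $T$ satisfy $4(2R+1)<T<5(2R+1)$. Then there exists a constant $C$ depending on the domain $B_R$ such that $$\begin{aligned}\|f\|^2_{L^2(B_R)}\le Ce^{C\sigma^2}\big(&\|\partial_t^2U\|^2_{L^2(\partial B_R\times(0,T))}+\|\partial_tU\|^2_{L^2(\partial B_R\times(0,T))}+\|\partial_t\nabla U\|^2_{L^2(\partial B_R\times(0,T))}\\&+\|\partial_t\Delta U\|^2_{L^2(\partial B_R\times(0,T))}+\|\Delta U\|^2_{L^2(\partial B_R\times(0,T))}+\|\nabla\Delta U\|^2_{L^2(\partial B_R\times(0,T))}\big).\end{aligned}$$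
   Context: $B_R=\{x\in\mathbb R^3:|x|<R\}$. The function $f$ is real-valued with compact support contained in $B_R$ and $f\in H^n(B_R)$ with $n\ge4$. No boundary condition is imposed on $\partial B_R$; $U$ is a (real-valued) solution regular enough up to $\partial B_R$ that the equation holds and all the boundary traces appearing in the estimate are defined. The constant $C$ does not depend on $\sigma$, $f$ or $U$. *)

(* Defs.v *)
From HB Require Import structures.
From mathcomp Require Import all_boot all_order all_algebra.
From mathcomp Require Import all_classical all_reals all_analysis.

Set Implicit Arguments.
Unset Strict Implicit.
Unset Printing Implicit Defensive.

Import Order.TTheory GRing.Theory Num.Theory.
Import numFieldTopology.Exports numFieldNormedType.Exports.

Local Open Scope classical_set_scope.
Local Open Scope ring_scope.

(* The product normed modules carry the sup norm, which induces the same
   topology and the same directional derivatives as the Euclidean norm; the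
   latter is [enorm]. *)
Notation space3 R := (R * R * R)%type (only parsing).
Notation spacetime R := (R * R * R * R)%type (only parsing).

Section Defs.
Context {R : realType}.
Implicit Types (r T : R).

Definition enorm (x : space3 R) : R :=
  Num.sqrt (x.1.1 ^+ 2 + x.1.2 ^+ 2 + x.2 ^+ 2).

Definition Ball r : set (space3 R) := [set x | enorm x < r].

Definition leb2 := (@lebesgue_measure R \x @lebesgue_measure R)%E.

HB.instance Definition _ := Measure.on leb2.

Let sigma_finite_leb2 : sigma_finite setT leb2.
Proof.
have /sigma_finiteP[F [TF ndF Foo]] := sigma_finiteT (@lebesgue_measure R).
exists (fun n => F n `*` F n).
  rewrite -setXTT TF predeqE => -[x y]; split.
    move=> [/= [n _ Fnx] [k _ Fky]]; exists (maxn n k) => //; split.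
    - by move: x Fnx; exact/subsetPset/ndF/leq_maxl.
    - by move: y Fky; exact/subsetPset/ndF/leq_maxr.
  by move=> [n _ []/= ? ?]; split; exists n.
move=> k; have [? ?] := Foo k.
split; first exact: measurableX.
by rewrite /leb2 product_measure1E// lte_mul_pinfty// ge0_fin_numE.
Qed.

HB.instance Definition _ :=
  Measure_isSigmaFinite.Build _ _ _ leb2 sigma_finite_leb2.

Definition leb3 := (leb2 \x @lebesgue_measure R)%E.

HB.instance Definition _ := Measure.on leb3.

Let sigma_finite_leb3 : sigma_finite setT leb3.
Proof.
have /sigma_finiteP[F [TF ndF Foo]] := sigma_finiteT leb2.
have /sigma_finiteP[G [TG ndG Goo]] := sigma_finiteT (@lebesgue_measure R).
exists (fun n => F n `*` G n).
  rewrite -setXTT TF TG predeqE => -[x y]; split.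
    move=> [/= [n _ Fnx] [k _ Gky]]; exists (maxn n k) => //; split.
    - by move: x Fnx; exact/subsetPset/ndF/leq_maxl.
    - by move: y Gky; exact/subsetPset/ndG/leq_maxr.
  by move=> [n _ []/= ? ?]; split; exists n.
move=> k; have [? ?] := Foo k; have [? ?] := Goo k.
split; first exact: measurableX.
by rewrite /leb3 product_measure1E// lte_mul_pinfty// ge0_fin_numE.
Qed.

HB.instance Definition _ :=
  Measure_isSigmaFinite.Build _ _ _ leb3 sigma_finite_leb3.

Definition L2 (D : set (space3 R)) (g : space3 R -> R) : Prop :=
  measurable_fun D g /\ (\int[leb3]_(x in D) (g x ^+ 2)%:E < +oo)%E.

Definition sqnormL2 (D : set (space3 R)) (g : space3 R -> R) : \bar R :=
  (\int[leb3]_(x in D) (g x ^+ 2)%:E)%E.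

Definition basis3 (i : 'I_3) : space3 R :=
  ((i == 0%N :> nat)%:R, (i == 1%N :> nat)%:R, (i == 2%N :> nat)%:R).

(* [pderivs [:: v1; ..; vk] h] is ['D_v1 (.. ('D_vk h))]. *)
Definition pderivs (V : normedModType R) (vs : seq V) (h : V -> R) : V -> R :=
  foldr (fun v (g : V -> R) => 'D_v g) h vs.

Definition supp (g : space3 R -> R) : set (space3 R) :=
  closure [set x | g x != 0].

Definition test_function (D : set (space3 R)) (phi : space3 R -> R) : Prop :=
  [/\ forall (s : seq 'I_3) (i : 'I_3) (x : space3 R),
        derivable (pderivs (map basis3 s) phi) x (basis3 i),
      forall s : seq 'I_3, continuous (pderivs (map basis3 s) phi),
      compact (supp phi) & supp phi `<=` D].

(* [f] and its weak derivatives of order at most [n] belong to L^2(D); the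
   derivatives are indexed by words in the coordinate directions, each
   multi-index being represented by all its orderings. *)
Definition sobolevH (n : nat) (D : set (space3 R)) (f : space3 R -> R) : Prop :=
  L2 D f /\
  forall s : seq 'I_3, (size s <= n)%N ->
    exists2 g : space3 R -> R, L2 D g &
      forall phi : space3 R -> R, test_function D phi ->
        \int[leb3]_(x in D) (f x * pderivs (map basis3 s) phi x) =
        (-1) ^+ size s * \int[leb3]_(x in D) (g x * phi x).

Definition cyl r : set (spacetime R) := [set p | Ball r p.1 /\ 0 < p.2].

Definition ccyl r : set (spacetime R) := [set p | enorm p.1 <= r /\ 0 <= p.2].

Definition dx (i : 'I_3) : spacetime R := (basis3 i, 0).

Definition dt : spacetime R := (0, 1).

Definition lap (h : spacetime R -> R) : spacetime R -> R :=
  fun p => \sum_(i < 3) 'D_(dx i) ('D_(dx i) h) p.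

(* Boundary value at [p], from inside the open cylinder: the value at [p] of the
   continuous extension of [h] to the closed cylinder, when there is one. It is
   used on the lateral boundary and at time 0. *)
Definition trace r (h : spacetime R -> R) (p : spacetime R) : R :=
  lim (h @ within (cyl r) (nbhs p)).

Definition dir (d : option 'I_3) : spacetime R :=
  if d is Some i then dx i else dt.

(* One time derivative counts as much as two space derivatives. *)
Definition weight (s : seq (option 'I_3)) : nat :=
  (\sum_(d <- s) if d is Some _ then 1 else 2)%N.

(* All the derivatives D_t^j D_x^alpha U with 2 j + |alpha| <= 4 (in any order of
   differentiation) exist in the open cylinder and extend continuously to the
   closed one. *)
Definition C42 r (U : spacetime R -> R) : Prop :=
  forall s : seq (option 'I_3), (weight s <= 4)%N ->
    (forall d s', s = d :: s' -> forall p, cyl r p ->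
       derivable (pderivs (map dir s') U) p (dir d)) /\
    exists2 g : spacetime R -> R, {within ccyl r, continuous g} &
      forall p, cyl r p -> g p = pderivs (map dir s) U p.

Definition sphere r (a : R * R) : space3 R :=
  (r * sin a.1 * cos a.2, r * sin a.1 * sin a.2, r * cos a.1).

(* Squared norm in L^2 of (sphere of radius r) x (0, T), in spherical
   coordinates (polar angle, azimuth), with surface element
   r^2 sin(polar angle). *)
Definition sqnormL2_bdry r T (g : spacetime R -> R) : \bar R :=
  (\int[leb3]_(q in `[0%R, pi] `*` `[0%R, (pi *+ 2)%R] `*` `]0%R, T[)
     (r ^+ 2 * sin q.1.1 * g (sphere r q.1, q.2) ^+ 2)%:E)%E.

End Defs.

(* Main.v *)
Require Import Defs.
From HB Require Import structures.
From mathcomp Require Import all_boot all_order all_algebra.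
From mathcomp Require Import ring lra.
From mathcomp Require Import all_classical all_reals all_analysis.
From mathcomp Require Import measurable_realfun lebesgue_integral_under.
Import Order.TTheory GRing.Theory Num.Theory.
Import numFieldTopology.Exports numFieldNormedType.Exports.
Local Open Scope classical_set_scope.
Local Open Scope ring_scope.
Set Implicit Arguments.
Unset Strict Implicit.
Unset Printing Implicit Defensive.

(** The pair [V = U_t], [W = lap U] solves [V_t = - lap W - sigma V],
    [W_t = lap V] with [V(0) = f] and [W(0) = 0], and the boundary data are the
    full Cauchy data of [(V, W)] on the lateral boundary. Take the weight
    [psi = exp (lam X^2)], with [X = x_3 + r + 1] between [1] and [M = 2 r + 1],
    and let [e], [H] be the integrals over the ball of [V^2 + W^2] and of
    [psi (V^2 + W^2)], and [rho] that of [psi_3 (V W_3 - W V_3)]. Up to boundary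
    terms, [e' <= 0], [H' >= 2 rho - 2 sigma H], and a Carleman identity for
    [- 2 psi_3 u_3 lap u - psi_33 u lap u] gives [rho' >= lam^3 H] as soon as
    [4 (1 + sigma) <= lam]. Since [rho(0) = 0], without boundary terms [H] would
    grow like [exp (2 k t)] with [k = lam^(3/2) / 2], whereas
    [H <= exp (lam M^2) e <= exp (lam M^2) e(0)]; for [lam] at least [4 M^2] and
    [T > 4 M] this is impossible, and the boundary terms must control [e(0)].
    Choosing [lam = 4 M^2 (1 + sqrt sigma)^2] makes all the constants at most
    [exp (C (1 + sigma^2))]. *)

(** * Continuity, measurability and integrals on the ball *)

(** The exponent of the weight has to be strictly convex in the third variable: for [exp (lam x_3)]
    the zero-order term left after completing the square in the Carleman identity cancels exactly,
    whereas for [exp (lam X^2)] it is [(4 lam^3 X^2 - 2 lam^2) psi u^2], which [X >= 1] keeps of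
    size [lam^3]. Boundary terms need only be bounded, so the divergence theorem serves as an
    inequality between the integral of [d_i F] over the ball and that of [|F|] over the sphere; the
    work there is to compare graph charts over the coordinate planes with the angles used by the
    boundary norms. Two limits of regularity shape the rest. Time counts twice in the order of the
    derivatives, so no time derivative of [V_3] or [W_3] is at hand, and [rho] is differentiated
    through difference quotients integrated by parts. Derivatives exist in the open cylinder only,
    with continuous extensions to the closed one; these are extended again to the whole space-time,
    so that all integrands are continuous everywhere. The upper bound on [T] keeps [exp (2 k T)]
    under control by [r] and [sigma] alone. *)

Section Continuity.
Context {R : realType} {T : topologicalType}.
Implicit Types f g : T -> R.

Lemma continuous_pair (U V : topologicalType) (f : T -> U) (g : T -> V) :
  continuous f -> continuous g -> continuous (fun x => (f x, g x)).
Proof. by move=> cf cg x; apply: (cvg_pair (cf x) (cg x)). Qed.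

Lemma continuous_fst_comp (U V : topologicalType) (f : T -> U * V) :
  continuous f -> continuous (fun x => (f x).1).
Proof. by move=> cf x; apply: (cvg_comp _ _ (cf x)); exact: cvg_fst. Qed.

Lemma continuous_snd_comp (U V : topologicalType) (f : T -> U * V) :
  continuous f -> continuous (fun x => (f x).2).
Proof. by move=> cf x; apply: (cvg_comp _ _ (cf x)); exact: cvg_snd. Qed.

Lemma continuous_add f g :
  continuous f -> continuous g -> continuous (fun x => f x + g x).
Proof. by move=> cf cg x; apply: cvgD; [exact: cf|exact: cg]. Qed.

Lemma continuous_sub f g :
  continuous f -> continuous g -> continuous (fun x => f x - g x).
Proof. by move=> cf cg x; apply: cvgB; [exact: cf|exact: cg]. Qed.

Lemma continuous_opp f : continuous f -> continuous (fun x => - f x).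
Proof. by move=> cf x; apply: cvgN; exact: cf. Qed.

Lemma continuous_mul f g :
  continuous f -> continuous g -> continuous (fun x => f x * g x).
Proof. by move=> cf cg x; apply: cvgM; [exact: cf|exact: cg]. Qed.

Lemma continuous_exp f n : continuous f -> continuous (fun x => f x ^+ n).
Proof.
move=> cf x; apply: (@continuous_comp _ _ _ f (fun z => z ^+ n)).
  exact: cf.
exact: exprn_continuous.
Qed.

Lemma continuous_norm f : continuous f -> continuous (fun x => `|f x|).
Proof. by move=> cf x; apply: cvg_norm; exact: cf. Qed.

Lemma continuous_sqrt f : continuous f -> continuous (fun x => Num.sqrt (f x)).
Proof.
move=> cf x; apply: (@continuous_comp _ _ _ f); [exact: cf|exact: sqrt_continuous].
Qed.

Lemma continuous_sin_comp f : continuous f -> continuous (fun x => sin (f x)).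
Proof.
move=> cf x; apply: (@continuous_comp _ _ _ f); [exact: cf|exact: continuous_sin].
Qed.

Lemma continuous_cos_comp f : continuous f -> continuous (fun x => cos (f x)).
Proof.
move=> cf x; apply: (@continuous_comp _ _ _ f); [exact: cf|exact: continuous_cos].
Qed.

Lemma continuous_expR_comp f : continuous f -> continuous (fun x => expR (f x)).
Proof.
move=> cf x; apply: (@continuous_comp _ _ _ f); [exact: cf|exact: continuous_expR].
Qed.

Lemma continuous_max f g :
  continuous f -> continuous g -> continuous (fun x => Num.max (f x) (g x)).
Proof. by move=> cf cg x; apply: continuous_max; [exact: cf|exact: cg]. Qed.

Lemma continuous_inv f :
  (forall x, f x != 0) -> continuous f -> continuous (fun x => (f x)^-1).
Proof. by move=> f0 cf x; apply: cvgV; [exact: f0|exact: cf]. Qed.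

Lemma continuous_compose (U V : topologicalType) (f : T -> U) (g : U -> V) :
  continuous g -> continuous f -> continuous (fun x => g (f x)).
Proof. by move=> cg cf x; apply: continuous_comp; [exact: cf|exact: cg]. Qed.

Lemma continuous_const (U : topologicalType) (c : U) :
  continuous (fun _ : T => c).
Proof. by move=> x; exact: cvg_cst. Qed.

Lemma continuous_id : continuous (fun x : T => x).
Proof. by move=> x; exact: cvg_id. Qed.
End Continuity.

Ltac cont := repeat lazymatch goal with
  | |- continuous (fun x => x) => exact: continuous_id
  | |- continuous (fun _ => ?c) => exact: continuous_const
  | |- continuous (fun x => @?f x + @?g x) =>
      apply: (@continuous_add _ _ f g)
  | |- continuous (fun x => - @?f x) => apply: (@continuous_opp _ _ f)
  | |- continuous (fun x => @?f x * @?g x) =>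
      apply: (@continuous_mul _ _ f g)
  | |- continuous (fun x => @?f x ^+ ?n) => apply: (@continuous_exp _ _ f n)
  | |- continuous (fun x => `|@?f x|) => apply: (@continuous_norm _ _ f)
  | |- continuous (fun x => Num.sqrt (@?f x)) =>
      apply: (@continuous_sqrt _ _ f)
  | |- continuous (fun x => sin (@?f x)) =>
      apply: (@continuous_sin_comp _ _ f)
  | |- continuous (fun x => cos (@?f x)) =>
      apply: (@continuous_cos_comp _ _ f)
  | |- continuous (fun x => expR (@?f x)) =>
      apply: (@continuous_expR_comp _ _ f)
  | |- continuous (fun x => Num.max (@?f x) (@?g x)) =>
      apply: (@continuous_max _ _ f g)
  | |- continuous (fun x => (@?f x, @?g x)) =>
      apply: (@continuous_pair _ _ _ f g)
  | |- continuous (fun x => (@?f x).1) =>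
      apply: (@continuous_fst_comp _ _ _ f)
  | |- continuous (fun x => (@?f x).2) =>
      apply: (@continuous_snd_comp _ _ _ f)
  | |- continuous (pair ?x) =>
      apply: (@continuous_pair _ _ _ (fun=> x) (fun y => y))
  | H : continuous ?g |- continuous ?g => exact: H
  | H : continuous ?g |- continuous (fun x => ?g (@?f x)) =>
      apply: (@continuous_compose _ _ _ f g H)
  end.

(** * Joint measurability of continuous functions *)

Section Measurability.
Context {R : realType}.
Local Notation mR := (measurableTypeR R).

(** The function is the pointwise limit of [h n], its value at [y] rounded down to the grid of step
    [1 / (n + 1)]: continuity in [y] gives the convergence, and the preimages under [h n] are
    countable unions of rectangles. Used one coordinate at a time, it makes continuous functions
    measurable for the product sigma-algebras on which [leb2] and [leb3] live. *)
Lemma measurable_caratheodory d (A : measurableType d) (f : A * mR -> R) :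
  (forall y, measurable_fun setT (fun x => f (x, y))) ->
  (forall x, continuous (fun y => f (x, y))) -> measurable_fun setT f.
Proof.
move=> mf cf.
pose q (n : nat) (y : R) : R := (Num.floor (y * n.+1%:R))%:~R / n.+1%:R.
pose h n (p : A * R) := f (p.1, q n p.2).
apply: (@measurable_fun_cvg _ _ _ _ h) => //; last first.
  move=> -[x y] _; rewrite /h /=.
  apply: (@cvg_comp _ _ _ (q ^~ y) (fun z => f (x, z)) _ (nbhs y)); last exact: cf.
  apply/cvgrPdist_le => e e0; near=> n.
  have n0 : (0 : R) < n.+1%:R by [].
  have /andP[fl fu] := Num.Theory.floor_itv (y * n.+1%:R).
  have -> : y - q n y = (y * n.+1%:R - (Num.floor (y * n.+1%:R))%:~R) / n.+1%:R.
    by rewrite mulrBl mulfK// gt_eqF.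
  rewrite ger0_norm; last by rewrite divr_ge0// subr_ge0.
  apply: (@le_trans _ _ (n.+1%:R^-1)).
    rewrite ler_pdivrMr// mulVf ?gt_eqF// lerBlDl ltW//.
    by rewrite intrD in fu.
  by apply: ltW; near: n; exact: (near_infty_natSinv_lt (PosNum e0)).
move=> n _ U mU; rewrite setTI.
have -> : h n @^-1` U = \bigcup_(k in [set: int])
   ([set x | U (f (x, k%:~R / n.+1%:R))] `*`
    [set y | k%:~R <= y * n.+1%:R < (k + 1)%:~R]).
  apply/seteqP; split => [[x y] /= Uxy|[x y] [k _ [/= Uxk /floor_def ky]]].
    exists (Num.floor (y * n.+1%:R)) => //; split => //=.
    exact: Num.Theory.floor_itv.
  by rewrite /h /q /= ky.
apply: countable_bigcupT_measurable => // k; apply: measurableX.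
  by rewrite -[X in measurable X]setTI; exact: mf.
rewrite (_ : [set _ | _] = `[k%:~R / n.+1%:R, (k + 1)%:~R / n.+1%:R[)%classic//.
by apply/seteqP; split => y /=; rewrite in_itv/= ler_pdivrMr// ltr_pdivlMr.
Unshelve. all: end_near. Qed.

Lemma continuous_measurable2 (f : R * R -> R) :
  continuous f -> measurable_fun [set: mR * mR] f.
Proof.
move=> cf; apply: measurable_caratheodory => [y|x].
  by apply: continuous_measurable_fun; apply: continuous_compose cf _; cont.
by apply: continuous_compose cf _; cont.
Qed.

Lemma continuous_measurable3 (f : space3 R -> R) :
  continuous f -> measurable_fun [set: mR * mR * mR] f.
Proof.
move=> cf; apply: measurable_caratheodory => [y|x].
  by apply: continuous_measurable2; apply: continuous_compose cf _; cont.
by apply: continuous_compose cf _; cont.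
Qed.
End Measurability.

(** * Bounds and integrability on the ball *)

Section BallMeasure.
Context {R : realType}.
Local Notation mR := (measurableTypeR R).
Local Notation mu := (@lebesgue_measure R).

Lemma continuous_bounded (T : topologicalType) (K : set T) (g : T -> R) :
  compact K -> continuous g ->
  exists2 M, 0 <= M & forall x, K x -> `|g x| <= M.
Proof.
move=> cK cg.
have /compact_bounded[M [Mr HM]] : compact (g @` K).
  by apply: continuous_compact => //; exact: continuous_subspaceT.
exists (`|M| + 1); first by rewrite addr_ge0.
move=> x Kx; apply: (HM (`|M| + 1)); last by exists x.
by rewrite (le_lt_trans (ler_norm _))// ltrDl.
Qed.

Lemma sqrD3_ge0 (x : space3 R) : 0 <= x.1.1 ^+ 2 + x.1.2 ^+ 2 + x.2 ^+ 2.
Proof. by rewrite !addr_ge0// sqr_ge0. Qed.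

Lemma enorm_continuous : continuous (@enorm R).
Proof. by rewrite /enorm; cont. Qed.

Lemma enorm_lt (r : R) (x : space3 R) : 0 < r ->
  (enorm x < r) = (x.1.1 ^+ 2 + x.1.2 ^+ 2 + x.2 ^+ 2 < r ^+ 2).
Proof.
move=> r0; rewrite /enorm -(ltr_sqr (sqrtr_ge0 _) (ltW r0)).
by rewrite sqr_sqrtr// sqrD3_ge0.
Qed.

Lemma enorm_le (r : R) (x : space3 R) : 0 <= r ->
  (enorm x <= r) = (x.1.1 ^+ 2 + x.1.2 ^+ 2 + x.2 ^+ 2 <= r ^+ 2).
Proof.
move=> r0; rewrite /enorm -(ler_sqr (sqrtr_ge0 _) r0).
by rewrite sqr_sqrtr// sqrD3_ge0.
Qed.

(** A compact box around the closed ball, on which bounds of continuous functions are taken. *)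
Definition cube (r : R) : set (space3 R) :=
  `[- r, r] `*` `[- r, r] `*` `[- r, r].

Lemma cube_compact r : compact (cube r).
Proof. by do 2 (apply: compact_setX; last exact: segment_compact);
  exact: segment_compact. Qed.

Lemma measurable_cube r : @measurable _ (mR * mR * mR)%type (cube r).
Proof. by do 2 (apply: measurableX => //). Qed.

Lemma leb3_cube r : (leb3 (cube r) < +oo)%E.
Proof.
rewrite /leb3 /cube product_measure1E//=; last exact: measurableX.
rewrite /leb2 product_measure1E//=.
rewrite lebesgue_measure_itv/=.
by case: ifPn => _; rewrite ?mule0 ?mul0e// -!EFinD -!EFinM ltry.
Qed.

Lemma sqr_le_norm (x r : R) : 0 <= r -> x ^+ 2 <= r ^+ 2 -> - r <= x <= r.
Proof.
by move=> r0; rewrite -ler_norml -(ler_sqr (normr_ge0 x) r0) real_normK// num_real.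
Qed.

Lemma closed_ball_cube r (x : space3 R) : 0 <= r -> enorm x <= r -> cube r x.
Proof.
move=> r0; rewrite enorm_le// => H.
have [h1 h2 h3] : [/\ 0 <= x.1.1 ^+ 2, 0 <= x.1.2 ^+ 2 & 0 <= x.2 ^+ 2].
  by rewrite !sqr_ge0.
by split; [split|] => /=; rewrite in_itv/=; apply: sqr_le_norm => //; lra.
Qed.

Lemma Ball_cube r (x : space3 R) : 0 < r -> Ball r x -> cube r x.
Proof. by move=> r0 /ltW; exact/closed_ball_cube/ltW. Qed.

Lemma measurable_Ball r : @measurable _ (mR * mR * mR)%type (Ball r).
Proof.
rewrite -[X in measurable X]setTI (_ : Ball r = @enorm R @^-1` `]-oo, r[).
  by apply: continuous_measurable3; [exact: enorm_continuous| |].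
by apply/seteqP; split => x /=; rewrite in_itv.
Qed.

Lemma leb3_Ball r : 0 < r -> (leb3 (@Ball R r) < +oo)%E.
Proof.
move=> r0; apply: le_lt_trans (leb3_cube r).
apply: le_measure; rewrite ?inE; [exact: measurable_Ball|exact: measurable_cube|].
by move=> x; exact: Ball_cube.
Qed.

Lemma bounded_integrable d (T : measurableType d)
    (nu : {measure set T -> \bar R}) (D : set T) (f : T -> R) M :
  measurable D -> (nu D < +oo)%E -> measurable_fun D f ->
  (forall x, D x -> `|f x| <= M) -> nu.-integrable D (EFin \o f).
Proof.
move=> mD Doo mf fM; apply: measurable_bounded_integrable => //.
exists M; split; first exact: num_real.
by move=> N MN x Dx; apply: (le_trans (fM x Dx)); exact: ltW.
Qed.

Lemma integrable_Ball r (g : space3 R -> R) : 0 < r -> continuous g ->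
  leb3.-integrable (Ball r) (EFin \o g).
Proof.
move=> r0 cg; have [M M0 HM] := continuous_bounded (@cube_compact r) cg.
apply: (bounded_integrable (M := M)).
- exact: measurable_Ball.
- exact: leb3_Ball.
- by apply: measurable_funS (continuous_measurable3 cg).
- by move=> x Bx; apply: HM; exact: Ball_cube.
Qed.

End BallMeasure.

(** * Permutations of the coordinates in integrals over the ball *)

Section Permutation.
Context {R : realType}.
Local Notation mR := (measurableTypeR R).
Local Notation mu := (@lebesgue_measure R).
Local Open Scope ereal_scope.

Lemma ge0_leb3_zyx (f : space3 R -> \bar R) : measurable_fun [set: mR * mR * mR] f ->
  (forall x, 0 <= f x) ->
  \int[leb3]_x f x = \int[mu]_z \int[mu]_y \int[mu]_x f (x, y, z).
Proof.
move=> mf f0; rewrite /leb3 fubini_tonelli2//; apply: eq_integral => z _.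
apply: (@fubini_tonelli2 _ _ _ _ _ mu mu (fun q => f (q, z))) => //.
exact: measurable_fun_pair1.
Qed.

Lemma ge0_leb3_xyz (f : space3 R -> \bar R) : measurable_fun [set: mR * mR * mR] f ->
  (forall x, 0 <= f x) ->
  \int[leb3]_x f x = \int[mu]_x \int[mu]_y \int[mu]_z f (x, y, z).
Proof.
move=> mf f0; rewrite /leb3 fubini_tonelli1//.
apply: (@fubini_tonelli1 _ _ _ _ _ mu mu) => //.
- exact: measurable_fun_fubini_tonelli_F.
- by move=> x; apply: integral_ge0.
Qed.

Definition swap13 (x : space3 R) : space3 R := (x.2, x.1.2, x.1.1).
Definition swap23 (x : space3 R) : space3 R := (x.1.1, x.2, x.1.2).

Lemma measurable_swap13 : measurable_fun [set: mR * mR * mR] (swap13 : _ -> mR * mR * mR).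
Proof.
apply: measurable_fun_pair; first apply: measurable_fun_pair => //.
- by apply: measurableT_comp => //.
- by apply: measurableT_comp => //.
Qed.

Lemma measurable_swap23 : measurable_fun [set: mR * mR * mR] (swap23 : _ -> mR * mR * mR).
Proof.
apply: measurable_fun_pair; first apply: measurable_fun_pair => //.
- by apply: measurableT_comp => //.
- by apply: measurableT_comp => //.
Qed.

(** The two orders of iterated integration in [ge0_leb3_xyz] and [ge0_leb3_zyx] give the same
    integral; renaming the bound variables in one of them is the exchange of the first and third
    coordinates. *)
Lemma ge0_integral_swap13 (f : space3 R -> \bar R) : measurable_fun [set: mR * mR * mR] f ->
  (forall x, 0 <= f x) -> \int[leb3]_x f (swap13 x) = \int[leb3]_x f x.
Proof.
move=> mf f0; have mfs : measurable_fun [set: mR * mR * mR] (f \o swap13).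
  by apply: measurableT_comp => //; exact: measurable_swap13.
have fs0 x : 0 <= (f \o swap13) x by exact: f0.
by apply: (etrans (ge0_leb3_xyz mfs fs0)); rewrite ge0_leb3_zyx.
Qed.

(** With the first variable outermost and fixed, this is Tonelli in the other two. *)
Lemma ge0_integral_swap23 (f : space3 R -> \bar R) : measurable_fun [set: mR * mR * mR] f ->
  (forall x, 0 <= f x) -> \int[leb3]_x f (swap23 x) = \int[leb3]_x f x.
Proof.
move=> mf f0; have mfs : measurable_fun [set: mR * mR * mR] (f \o swap23).
  by apply: measurableT_comp => //; exact: measurable_swap23.
have fs0 x : 0 <= (f \o swap23) x by exact: f0.
apply: (etrans (ge0_leb3_xyz mfs fs0)).
apply/esym; apply: (etrans (ge0_leb3_xyz mf f0)); apply/esym.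
apply: eq_integral => x _; rewrite /swap23/=.
apply: (@fubini_tonelli _ _ _ _ _ mu mu (fun q : R * R => f (x, q.2, q.1))).
  apply: measurableT_comp => //; apply: measurable_fun_pair => //.
  by apply: measurable_fun_pair.
by move=> q; exact: f0.
Qed.

(** The integrand is extended by zero outside the ball and split into positive and negative parts;
    the extension commutes with [s] because [s] preserves the norm. *)
Lemma Rintegral_swap (s : space3 R -> space3 R) (r : R) (g : space3 R -> R) :
  measurable_fun [set: mR * mR * mR] g -> measurable_fun [set: mR * mR * mR] (s : _ ->
    mR * mR * mR) ->
  (forall f, measurable_fun [set: mR * mR * mR] f -> (forall x, 0 <= f x) ->
    \int[leb3]_x f (s x) = \int[leb3]_x f x) ->
  (forall x, enorm (s x) = enorm x) ->
  (\int[leb3]_(x in Ball r) g (s x) = \int[leb3]_(x in Ball r) g x)%R.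
Proof.
move=> mg ms H es; rewrite /Rintegral; congr fine.
rewrite integral_mkcond [RHS]integral_mkcond.
set f := (fun x => (g x)%:E) \_ (Ball r).
have mf : measurable_fun [set: mR * mR * mR] f.
  apply/(measurable_restrictT _ _).1; first exact: measurable_Ball.
  by apply/measurable_EFinP; apply: measurable_funS mg.
have -> : ((fun x => (g (s x))%:E) \_ (Ball r)) = f \o s.
  apply/funext => x; rewrite /f/= /patch.
  by rewrite (_ : (s x \in Ball r) = (x \in Ball r))//; apply/idP/idP;
    rewrite !inE /Ball/= es.
rewrite integralE [RHS]integralE; congr (_ - _).
- have <- := H (funepos f) (measurable_funepos mf) (fun x => funepos_ge0 f x).
  by apply: eq_integral => x _; rewrite unlock.
- have <- := H (funeneg f) (measurable_funeneg mf) (fun x => funeneg_ge0 f x).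
  by apply: eq_integral => x _; rewrite unlock.
Qed.

Lemma enorm_swap13 x : enorm (swap13 x) = enorm x.
Proof. by rewrite /enorm/=; congr Num.sqrt; ring. Qed.

Lemma enorm_swap23 x : enorm (swap23 x) = enorm x.
Proof. by rewrite /enorm/=; congr Num.sqrt; ring. Qed.

End Permutation.

(** * The divergence theorem on the ball *)

Section Divergence.
Context {R : realType}.
Local Notation mR := (measurableTypeR R).
Local Notation mu := (@lebesgue_measure R).

Lemma is_derive_line (V : normedModType R) (f : V -> R) (x v : V) (s d : R) :
  is_derive (x + s *: v) v f d -> is_derive s 1 (fun u => f (x + u *: v)) d.
Proof.
have E : (fun h => h^-1 *: (((fun u => f (x + u *: v)) \o shift s) (h *: (1 : R))
            - f (x + s *: v))) =
         (fun h => h^-1 *: ((f \o shift (x + s *: v)) (h *: v) - f (x + s *: v))).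
  apply/funext => h /=; congr (_ *: (f _ - _)).
  by rewrite scaler1 scalerDl addrCA.
by move=> [df fE]; split; rewrite /derivable /derive E.
Qed.

(** The derivative is given in the open interval only, as on a chord of the open ball; continuity of
    [F] supplies the end values. *)
Lemma FTC_oo (f F : R -> R) (a b : R) : a < b -> continuous f -> continuous F ->
  (forall x, a < x < b -> is_derive x 1 F (f x)) ->
  (\int[mu]_(x in `]a, b[) (f x)%:E = (F b - F a)%:E)%E.
Proof.
move=> ab cf cF dF.
rewrite -(@integral_itv_bndoo _ _ _ _ true false); last first.
  apply/measurable_EFinP; apply: measurable_funS (continuous_measurable_fun cf) => //.
apply: continuous_FTC2 => //.
- exact: continuous_subspaceT.
- split.
  + by move=> x; rewrite in_itv/= => /dF[].
  + by apply: cvg_at_right_filter; exact: cF.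
  + by apply: cvg_at_left_filter; exact: cF.
- by move=> x; rewrite in_itv/= => /dF[dfx <-]; rewrite derive1E.
Qed.

Definition disc (r : R) : set (R * R) := [set q | q.1 ^+ 2 + q.2 ^+ 2 < r ^+ 2].

Definition cap (r : R) (q : R * R) : R := Num.sqrt (r ^+ 2 - q.1 ^+ 2 - q.2 ^+ 2).

Lemma cap_gt0 r q : disc r q -> 0 < cap r q.
Proof. by rewrite /disc /cap/= sqrtr_gt0 => H; lra. Qed.

Lemma cap_ge0 r q : 0 <= cap r q.
Proof. exact: sqrtr_ge0. Qed.

Lemma cap_sqr r q : disc r q -> cap r q ^+ 2 = r ^+ 2 - q.1 ^+ 2 - q.2 ^+ 2.
Proof. by rewrite /disc /cap/= => H; rewrite sqr_sqrtr//; lra. Qed.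

Lemma BallE r (q : R * R) (z : R) : 0 < r ->
  Ball r (q, z) <-> disc r q /\ - cap r q < z < cap r q.
Proof.
move=> r0; rewrite /Ball/= enorm_lt//= /disc/=; split.
  move=> H; have z0 := sqr_ge0 z; have D : disc r q by rewrite /disc/=; lra.
  split; first by lra.
  rewrite -ltr_norml -(ltr_sqr (normr_ge0 z) (cap_ge0 r q)).
  by rewrite real_normK ?num_real// cap_sqr//; lra.
move=> [D]; rewrite -ltr_norml -(ltr_sqr (normr_ge0 z) (cap_ge0 r q)).
by rewrite real_normK ?num_real// cap_sqr//; lra.
Qed.

(** The integral over the sphere of [F] times the third component of the outer normal, transported
    to the equatorial disc: there the normal component and the surface element combine to [+1] on
    the upper cap and [-1] on the lower one. *)
Definition bdry3 r (F : space3 R -> R) : R :=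
  \int[leb2]_(q in disc r) (F (q, cap r q) - F (q, - cap r q)).

Lemma measurable_disc r : @measurable _ (mR * mR)%type (disc r).
Proof.
rewrite -[X in measurable X]setTI.
rewrite (_ : disc r = (fun q => q.1 ^+ 2 + q.2 ^+ 2) @^-1` `]-oo, r ^+ 2[).
  by apply: continuous_measurable2 => //; cont.
by apply/seteqP; split => x /=; rewrite in_itv.
Qed.

Lemma basis3E2 : @basis3 R ord_max = (0, 0, 1).
Proof. by rewrite /basis3/=. Qed.

Lemma addscale3 (a b c u d e f : R) :
  (a, b, c) + u *: (d, e, f) = (a + u * d, b + u * e, c + u * f) :> space3 R.
Proof. by []. Qed.

(** Fubini, then the fundamental theorem of calculus on each vertical chord from [- cap r q] to
    [cap r q]. *)
Lemma integral_derive3 r (F G : space3 R -> R) : 0 < r ->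
  continuous F -> continuous G ->
  (forall x, Ball r x -> is_derive x (basis3 ord_max) F (G x)) ->
  \int[leb3]_(x in Ball r) G x = bdry3 r F.
Proof.
move=> r0 cF cG dF; rewrite /Rintegral /bdry3; congr fine.
rewrite integral_mkcond [RHS]integral_mkcond.
have iG := (@integrable_mkcond _ _ _ leb3 _ (EFin \o G) (@measurable_Ball _ r)).1
  (integrable_Ball r0 cG).
rewrite -(integral12_prod_meas1 iG).
apply: eq_integral => q _; rewrite /fubini_F /patch /=.
have [qd|qd] := boolP (q \in disc r); last first.
  rewrite (eq_integral (cst 0%E)) ?integral0// => z _.
  rewrite ifF//; apply/negbTE; apply: contra qd; rewrite !inE => /BallE.
  by move=> /(_ r0)[].
rewrite inE in qd.
have c0 := cap_gt0 qd.
transitivity (\int[mu]_(z in `](- cap r q)%R, (cap r q)%R[) (G (q, z))%:E)%E.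
  rewrite [RHS]integral_mkcond; apply: eq_integral => z _; rewrite /patch.
  congr (if _ then _ else _); apply/idP/idP; rewrite !inE => /=.
    by rewrite in_itv/= => /(BallE _ _ r0)[].
  by rewrite in_itv/= => zc; apply/BallE.
apply: (@FTC_oo (fun z => G (q, z)) (fun z => F (q, z))).
- by lra.
- by cont.
- by cont.
- move=> z zc; have := @is_derive_line _ F (q, 0) (basis3 ord_max) z (G (q, z)).
  have lineE u : (q, 0) + u *: basis3 ord_max = (q, u) :> space3 R.
    rewrite basis3E2; case: q {qd c0 zc} => x y.
    by rewrite addscale3 !mulr0 !addr0 mulr1 add0r.
  under eq_fun do rewrite lineE.
  by rewrite lineE; apply; apply: dF; apply/BallE.
Qed.

End Divergence.

(** * Calculus of directional derivatives *)

Section DirectionalDerivatives.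
Context {R : realType} {V : normedModType R}.
Implicit Types (f g : V -> R) (x v : V) (a b : R).

Lemma is_derive_ofline f x v a :
  is_derive (0 : R) (1 : R) (fun u : R => f (x + u *: v)) a -> is_derive x v f a.
Proof.
have E : (fun h => h^-1 *: ((f \o shift x) (h *: v) - f x)) =
    (fun h => h^-1 *: (((fun u => f (x + u *: v)) \o shift 0) (h *: (1 : R))
                       - f (x + 0 *: v))).
  apply/funext => h /=; congr (_ *: (f _ - f _)); last by rewrite scale0r addr0.
  by rewrite scaler1 addr0 addrC.
by move=> [df fE]; split; rewrite /derivable /derive E.
Qed.

Lemma is_derive_val f x v a b : is_derive x v f a -> a = b -> is_derive x v f b.
Proof. by move=> + <-. Qed.

Lemma is_derive_add f g x v a b : is_derive x v f a -> is_derive x v g b ->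
  is_derive x v (fun y => f y + g y) (a + b).
Proof. exact: is_deriveD. Qed.

Lemma is_derive_sub f g x v a b : is_derive x v f a -> is_derive x v g b ->
  is_derive x v (fun y => f y - g y) (a - b).
Proof. exact: is_deriveB. Qed.

Lemma is_derive_opp f x v a : is_derive x v f a ->
  is_derive x v (fun y => - f y) (- a).
Proof. exact: is_deriveN. Qed.

Lemma is_derive_mul f g x v a b : is_derive x v f a -> is_derive x v g b ->
  is_derive x v (fun y => f y * g y) (a * g x + f x * b).
Proof.
move=> df dg; apply: (is_derive_val (is_deriveM df dg)).
by rewrite addrC; congr (_ + _); exact: mulrC.
Qed.

Lemma is_derive_const x v a : is_derive x v (fun=> a) 0.
Proof. exact: is_derive_cst. Qed.

Lemma is_derive_chain f (phi : R -> R) x v a b : is_derive x v f a ->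
  is_derive (f x) (1 : R) phi b -> is_derive x v (fun y => phi (f y)) (b * a).
Proof.
move=> df dphi; apply: is_derive_ofline.
apply: (@is_derive1_comp _ phi (fun u : R => f (x + u *: v))).
  by rewrite scale0r addr0.
by apply: is_derive_line; rewrite scale0r addr0.
Qed.
End DirectionalDerivatives.

(** * Substitution in integrals of one variable *)

Section Substitution.
Context {R : realType}.
Local Notation mR := (measurableTypeR R).
Local Notation mu := (@lebesgue_measure R).

Lemma is_derive1_continuous_LR (F f : R -> R) (a b : R) : continuous F ->
  (forall x, a < x < b -> is_derive x 1 F (f x)) ->
  derivable_oo_LRcontinuous F a b.
Proof.
move=> cF dF; split.
- by move=> x; rewrite in_itv/= => /dF[].
- by apply: cvg_at_right_filter; exact: cF.
- by apply: cvg_at_left_filter; exact: cF.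
Qed.

Lemma derive1_cvg_at_right (F f : R -> R) (a b : R) : a < b -> continuous f ->
  (forall x, a < x < b -> is_derive x 1 F (f x)) ->
  (derive1 F) x @[x --> a^'+] --> f a.
Proof.
move=> ab cf dF; apply: (@cvg_trans _ (f x @[x --> a^'+])); last first.
  by apply: cvg_at_right_filter; exact: cf.
apply: near_eq_cvg; near=> x; rewrite derive1E.
have /dF[_ ->//] : a < x < b.
by apply/andP; split; near: x; [exact: nbhs_right_gt|exact: nbhs_right_lt].
Unshelve. all: end_near. Qed.

Lemma derive1_cvg_at_left (F f : R -> R) (a b : R) : a < b -> continuous f ->
  (forall x, a < x < b -> is_derive x 1 F (f x)) ->
  (derive1 F) x @[x --> b^'-] --> f b.
Proof.
move=> ab cf dF; apply: (@cvg_trans _ (f x @[x --> b^'-])); last first.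
  by apply: cvg_at_left_filter; exact: cf.
apply: near_eq_cvg; near=> x; rewrite derive1E.
have /dF[_ ->//] : a < x < b.
by apply/andP; split; near: x; [exact: nbhs_left_gt|exact: nbhs_left_lt].
Unshelve. all: end_near. Qed.

Lemma derive1_continuous_in (F f : R -> R) (a b : R) : continuous f ->
  (forall x, a < x < b -> is_derive x 1 F (f x)) ->
  {in `]a, b[, continuous (derive1 F)}.
Proof.
move=> cf dF x xab.
have dE y : y \in `]a, b[ -> (derive1 F) y = f y.
  by rewrite in_itv/= => /dF[_ <-]; rewrite derive1E.
rewrite /continuous_at dE//; apply: (@cvg_trans _ (f y @[y --> x])); last exact: cf.
apply: near_eq_cvg; near=> y; rewrite dE//.
by near: y; exact: near_in_itvoo.
Unshelve. all: end_near. Qed.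

Lemma integral_eq_oo (f g : R -> R) (a b : R) :
  measurable_fun `]a, b[ f -> measurable_fun `]a, b[ g ->
  (forall x, a < x < b -> f x = g x) ->
  (\int[mu]_(x in `[a, b]) (f x)%:E = \int[mu]_(x in `[a, b]) (g x)%:E)%E.
Proof.
move=> mf mg fg.
rewrite (@integral_itv_bndoo _ _ _ _ true false); last exact/measurable_EFinP.
rewrite (@integral_itv_bndoo _ _ _ _ true false); last exact/measurable_EFinP.
by apply: eq_integral => x; rewrite inE/= in_itv/= => /fg ->.
Qed.

Lemma measurable_continuous_itv (f : R -> R) (D : set mR) :
  continuous f -> measurable_fun D f.
Proof. by move=> cf; apply: measurable_funS (continuous_measurable_fun cf). Qed.

(** The derivative enters as a function [f] continuous on the whole line that equals it inside the
    interval; the continuity and the one-sided limits of [derive1 F] are read off from [f]. *)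
Lemma subst_increasing (F f G : R -> R) (a b : R) : a <= b ->
  continuous F -> continuous f ->
  (forall x, a < x < b -> is_derive x 1 F (f x)) ->
  (forall x, a < x < b -> 0 < f x) -> continuous G ->
  (\int[mu]_(x in `[F a, F b]) (G x)%:E =
   \int[mu]_(x in `[a, b]) (G (F x) * f x)%:E)%E.
Proof.
rewrite le_eqVlt => /predU1P[<-|ab] cF cf dF f0 cG.
  by rewrite !set_itv1 !integral_set1.
have dE y : y \in `]a, b[ -> (derive1 F) y = f y.
  by rewrite in_itv/= => /dF[_ <-]; rewrite derive1E.
rewrite (integration_by_substitution_increasing (a := a) (b := b)).
- apply: integral_eq_oo.
  + apply: measurable_funM.
      apply: measurable_continuous_itv; exact: continuous_compose cG cF.
    apply: (eq_measurable_fun f); last exact: measurable_continuous_itv.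
    by move=> x /set_mem xab; rewrite dE.
  + by apply: measurable_continuous_itv; cont.
  + by move=> x xab; rewrite !fctE dE// in_itv.
- exact: ltW.
- apply: gtr0_derive1_lt_cc.
  + by move=> x; rewrite in_itv/= => /dF[].
  + by move=> x xab; rewrite dE// f0// -[_ && _]/(x \in `]a, b[).
  + exact: continuous_subspaceT.
- exact: derive1_continuous_in cf dF.
- by apply: (cvgP (f a)); exact: derive1_cvg_at_right cf dF.
- by apply: (cvgP (f b)); exact: derive1_cvg_at_left cf dF.
- exact: is_derive1_continuous_LR cF dF.
- exact: continuous_subspaceT.
Qed.

Lemma subst_decreasing (F f G : R -> R) (a b : R) : a <= b ->
  continuous F -> continuous f ->
  (forall x, a < x < b -> is_derive x 1 F (- f x)) ->
  (forall x, a < x < b -> 0 < f x) -> continuous G ->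
  (\int[mu]_(x in `[F b, F a]) (G x)%:E =
   \int[mu]_(x in `[a, b]) (G (F x) * f x)%:E)%E.
Proof.
rewrite le_eqVlt => /predU1P[<-|ab] cF cf dF f0 cG.
  by rewrite !set_itv1 !integral_set1.
have cNf : continuous (fun x => - f x) by cont.
have dE y : y \in `]a, b[ -> (derive1 F) y = - f y.
  by rewrite in_itv/= => /dF[_ <-]; rewrite derive1E.
rewrite (integration_by_substitution_decreasing (a := a) (b := b)).
- apply: integral_eq_oo.
  + apply: measurable_funM.
      apply: measurable_continuous_itv; exact: continuous_compose cG cF.
    apply: (eq_measurable_fun f); last exact: measurable_continuous_itv.
    by move=> x /set_mem xab; rewrite !fctE dE// opprK.
  + by apply: measurable_continuous_itv; cont.
  + by move=> x xab; rewrite !fctE dE ?opprK// in_itv.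
- exact: ltW.
- apply: ltr0_derive1_lt_cc.
  + by move=> x; rewrite in_itv/= => /dF[].
  + by move=> x xab; rewrite dE// oppr_lt0 f0// -[_ && _]/(x \in `]a, b[).
  + exact: continuous_subspaceT.
- exact: derive1_continuous_in cNf dF.
- by apply: (cvgP (- f a)); exact: derive1_cvg_at_right cNf dF.
- by apply: (cvgP (- f b)); exact: derive1_cvg_at_left cNf dF.
- exact: is_derive1_continuous_LR cF dF.
- exact: continuous_subspaceT.
Qed.

Lemma subst_reflect (G : R -> R) (c a b : R) : a <= b -> continuous G ->
  (\int[mu]_(x in `[(c - b)%R, (c - a)%R]) (G x)%:E =
   \int[mu]_(x in `[a, b]) (G (c - x)%R)%:E)%E.
Proof.
move=> ab cG.
have dF x : a < x < b -> is_derive x 1 (fun x => c - x) (- 1).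
  by move=> _; rewrite -[X in is_derive _ _ _ X]add0r; apply: is_deriveB.
apply: (etrans (@subst_decreasing (fun x => c - x) (fun=> 1) G a b ab _ _ dF _ cG)).
- by cont.
- by cont.
- by [].
- by apply: eq_integral => x _; rewrite mulr1.
Qed.

Lemma subst_translate (G : R -> R) (c a b : R) : a <= b -> continuous G ->
  (\int[mu]_(x in `[(c + a)%R, (c + b)%R]) (G x)%:E =
   \int[mu]_(x in `[a, b]) (G (c + x)%R)%:E)%E.
Proof.
move=> ab cG.
have dF x : a < x < b -> is_derive x 1 (fun x => c + x) 1.
  by move=> _; rewrite -[X in is_derive _ _ _ X]add0r; apply: is_deriveD.
apply: (etrans (@subst_increasing (fun x => c + x) (fun=> 1) G a b ab _ _ dF _ cG)).
- by cont.
- by cont.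
- by [].
- by apply: eq_integral => x _; rewrite mulr1.
Qed.

Lemma ge0_integral_itv_split (G : R -> R) (a b c : R) : a <= b -> b <= c ->
  continuous G -> (forall x, 0 <= G x) ->
  (\int[mu]_(x in `[a, c]) (G x)%:E =
   \int[mu]_(x in `[a, b]) (G x)%:E + \int[mu]_(x in `[b, c]) (G x)%:E)%E.
Proof.
move=> ab bc cG G0.
have mG (D : set mR) : measurable_fun D (EFin \o G).
  by apply/measurable_EFinP; exact: measurable_continuous_itv.
rewrite [X in (_ = _ + X)%E](@integral_itv_bndoo _ _ _ _ true false); last exact: mG.
rewrite -[X in (_ = _ + X)%E](@integral_itv_bndoo _ _ _ _ false false); last exact: mG.
rewrite -ge0_integral_setU//=.
- by rewrite -itv_bndbnd_setU.
- by move=> x _; rewrite lee_fin.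
- apply/disj_setPS => x [/=]; rewrite !in_itv/= => /andP[_ xb] /andP[bx _].
  by move: (lt_le_trans bx xb); rewrite ltxx.
Qed.

End Substitution.

(** * Plane regions, and two graph charts of an octant of the sphere *)

Section Octant.
Context {R : realType}.
Local Notation mR := (measurableTypeR R).
Local Notation mu := (@lebesgue_measure R).

Lemma ge0_integral_region (D : set (R * R)) (k : R * R -> R) (I : set R)
    (J : R -> set R) :
  (forall x y, D (x, y) <-> I x /\ J x y) ->
  (\int[mu]_(x in I) \int[mu]_(y in J x) (k (x, y))%:E =
   \int[mu]_x \int[mu]_y ((EFin \o k) \_ D) (x, y))%E.
Proof.
move=> DIJ; rewrite integral_mkcond; apply: eq_integral => x _.
rewrite /patch; case: ifPn => [/set_mem Ix|/negP Ix].
  rewrite integral_mkcond; apply: eq_integral => y _; rewrite /patch.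
  congr (if _ then _ else _); apply/idP/idP; rewrite !inE.
    by move=> Jxy; apply/DIJ.
  by case/DIJ.
rewrite integral0_eq// => y _; rewrite ifF//; apply/negP => /set_mem /DIJ[Ix' _].
by apply: Ix; rewrite inE.
Qed.

(** The region is described by its sections in both directions; extension by zero outside [D]
    reduces the exchange to Tonelli on the plane. *)
Lemma tonelli_region (D : set (R * R)) (k : R * R -> R) (I I' : set R)
    (J J' : R -> set R) :
  @measurable _ (mR * mR)%type D -> continuous k ->
  (forall q, D q -> 0 <= k q) ->
  (forall x y, D (x, y) <-> I x /\ J x y) ->
  (forall x y, D (x, y) <-> I' y /\ J' y x) ->
  (\int[mu]_(x in I) \int[mu]_(y in J x) (k (x, y))%:E =
   \int[mu]_(y in I') \int[mu]_(x in J' y) (k (x, y))%:E)%E.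
Proof.
move=> mD ck k0 DIJ DIJ'; rewrite (ge0_integral_region k DIJ).
have D' x y : [set q | D (q.2, q.1)] (x, y) <-> I' x /\ J' x y by exact: DIJ'.
rewrite (ge0_integral_region (fun q => k (q.2, q.1)) D').
have mk : measurable_fun [set: mR * mR] k := continuous_measurable2 ck.
have mEk : measurable_fun [set: mR * mR] (EFin \o k) by apply/measurable_EFinP.
have mEkD : measurable_fun (D : set (mR * mR)) (EFin \o k).
  by apply: measurable_funS mEk.
apply: (@fubini_tonelli _ _ _ _ _ mu mu ((EFin \o k) \_ D)).
  exact: ((measurable_restrictT _ mD).1 mEkD).
by move=> q; apply: erestrict_ge0 => x Dx; rewrite lee_fin k0.
Qed.

Lemma measurable_region (D : set (R * R)) (k : R * R -> R) :
  @measurable _ (mR * mR)%type D -> continuous k ->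
  measurable_fun (D : set (mR * mR)) (EFin \o k).
Proof.
move=> mD ck; have mk : measurable_fun [set: mR * mR] k := continuous_measurable2 ck.
have mEk : measurable_fun [set: mR * mR] (EFin \o k) by apply/measurable_EFinP.
by apply: measurable_funS mEk.
Qed.

Lemma region_leb2 (D : set (R * R)) (k : R * R -> R) (I : set R)
    (J : R -> set R) :
  @measurable _ (mR * mR)%type D -> continuous k ->
  (forall q, D q -> 0 <= k q) -> (forall x y, D (x, y) <-> I x /\ J x y) ->
  (\int[mu]_(x in I) \int[mu]_(y in J x) (k (x, y))%:E =
   \int[leb2]_(q in D) (k q)%:E)%E.
Proof.
move=> mD ck k0 DIJ; rewrite (ge0_integral_region k DIJ) [RHS]integral_mkcond.
apply/esym; apply: (@fubini_tonelli1 _ _ _ _ _ mu mu ((EFin \o k) \_ D)).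
  exact: ((measurable_restrictT _ mD).1 (measurable_region mD ck)).
by move=> q; apply: erestrict_ge0 => x Dx; rewrite lee_fin k0.
Qed.

(** Both iterated integrals are [leb2] integrals over [D] and [D'], which are monotone in the
    integrand and in the domain. *)
Lemma le_region (D D' : set (R * R)) (k k' : R * R -> R) (I I' : set R)
    (J J' : R -> set R) :
  @measurable _ (mR * mR)%type D -> @measurable _ (mR * mR)%type D' ->
  continuous k -> continuous k' -> D `<=` D' ->
  (forall q, D q -> 0 <= k q <= k' q) -> (forall q, D' q -> 0 <= k' q) ->
  (forall x y, D (x, y) <-> I x /\ J x y) ->
  (forall x y, D' (x, y) <-> I' x /\ J' x y) ->
  (\int[mu]_(x in I) \int[mu]_(y in J x) (k (x, y))%:E <=
   \int[mu]_(x in I') \int[mu]_(y in J' x) (k' (x, y))%:E)%E.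
Proof.
move=> mD mD' ck ck' DD' kk' k'0 DIJ DIJ'.
rewrite (region_leb2 mD ck _ DIJ); last by move=> q /kk' /andP[].
rewrite (region_leb2 mD' ck' k'0 DIJ').
have mk' := measurable_region mD' ck'.
apply: (@le_trans _ _ (\int[leb2]_(q in D) (k' q)%:E)%E).
  apply: ge0_le_integral => //.
  - by move=> q /kk' /andP[k0 _]; rewrite lee_fin.
  - exact: measurable_region.
  - exact: measurable_region.
  - by move=> q /kk' /andP[_ k0]; rewrite lee_fin.
by apply: ge0_subset_integral => // q /k'0; rewrite lee_fin.
Qed.

Lemma pihalf_gt0 : 0 < pi / 2 :> R.
Proof. by rewrite divr_gt0// pi_gt0. Qed.

Lemma cos_pihalf_gt0 (x : R) : 0 < x < pi / 2 -> 0 < cos x.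
Proof.
move=> /andP[x0 xp]; apply: cos_gt0_pihalf; rewrite xp andbT.
by apply: lt_trans x0; rewrite oppr_lt0 pihalf_gt0.
Qed.

Lemma sin_ge0_quarter (x : R) : 0 <= x <= pi / 2 -> 0 <= sin x.
Proof.
move=> /andP[x0 xp]; apply: sin_ge0_pi; rewrite x0/=; apply: (le_trans xp).
have := pi_gt0 R; lra.
Qed.

Lemma cos_ge0_quarter (x : R) : 0 <= x <= pi / 2 -> 0 <= cos x.
Proof.
move=> /andP[x0 xp]; apply: cos_ge0_pihalf; rewrite xp andbT.
by apply: le_trans x0; rewrite oppr_le0 ltW// pihalf_gt0.
Qed.

Lemma subst_sin (G : R -> R) (c A : R) : 0 < c -> 0 <= A <= pi / 2 ->
  continuous G ->
  (\int[mu]_(x in `[0%R, (c * sin A)%R]) (G x)%:E =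
   \int[mu]_(x in `[0%R, A]) (G (c * sin x) * (c * cos x))%:E)%E.
Proof.
move=> c0 /andP[A0 Ap] cG.
have dF x : 0 < x < A -> is_derive x 1 (fun x => c * sin x) (c * cos x).
  move=> _; apply: (is_derive_val (is_derive_mul (is_derive_const x 1 c)
    (is_derive_sin x))).
  by rewrite mul0r add0r.
have f0 x : 0 < x < A -> 0 < c * cos x.
  move=> /andP[x0 xA]; rewrite mulr_gt0//.
  by rewrite cos_pihalf_gt0// x0 (lt_le_trans xA).
have cF : continuous (fun x : R => c * sin x) by cont.
have cf : continuous (fun x : R => c * cos x) by cont.
have := @subst_increasing _ (fun x => c * sin x) (fun x => c * cos x) G 0 A A0
  cF cf dF f0 cG.
by rewrite sin0 mulr0.
Qed.

Lemma subst_cos (G : R -> R) (c : R) : 0 < c -> continuous G ->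
  (\int[mu]_(x in `[0%R, c]) (G x)%:E =
   \int[mu]_(x in `[0%R, (pi / 2)%R]) (G (c * cos x) * (c * sin x))%:E)%E.
Proof.
move=> c0 cG.
have dF x : 0 < x < pi / 2 -> is_derive x 1 (fun x => c * cos x) (- (c * sin x)).
  move=> _; apply: (is_derive_val (is_derive_mul (is_derive_const x 1 c)
    (is_derive_cos x))).
  by rewrite mul0r add0r mulrN.
have f0 x : 0 < x < pi / 2 -> 0 < c * sin x.
  by move=> xp; rewrite mulr_gt0// sin_gt0_pihalf.
have cF : continuous (fun x : R => c * cos x) by cont.
have cf : continuous (fun x : R => c * sin x) by cont.
have := @subst_decreasing _ (fun x => c * cos x) (fun x => c * sin x) G 0 (pi/2)
  (ltW pihalf_gt0) cF cf dF f0 cG.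
by rewrite cos_pihalf mulr0 cos0 mulr1.
Qed.

(** In height [z] and azimuth [t] the area element of the sphere is [r dz dt]: the parallel has
    radius [c] and the meridian arc above [dz] has length [(r / c) dz]. The factor [c] cancels, so
    nothing is singular at the pole. *)
Definition oct_integrand (r : R) (h : space3 R -> R) (q : R * R) : R :=
  let c := Num.sqrt (r ^+ 2 - q.1 ^+ 2) in
  r * h (c * cos q.2, c * sin q.2, q.1).

(* Archimedes' parametrization of the octant of the sphere by height and azimuth. *)
Definition oct r h : \bar R :=
  (\int[mu]_(z in `[0%R, r]) \int[mu]_(t in `[0%R, (pi / 2)%R])
     (oct_integrand r h (z, t))%:E)%E.

Lemma oct_integrand_continuous r h : continuous h ->
  continuous (oct_integrand r h).
Proof. by move=> ch; rewrite /oct_integrand; cont. Qed.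

Lemma sqrt_cos (c x : R) : 0 <= c -> 0 <= x <= pi / 2 ->
  Num.sqrt (c ^+ 2 - (c * sin x) ^+ 2) = c * cos x.
Proof.
move=> c0 xp; rewrite exprMn -{1}[c ^+ 2]mulr1 -mulrBr -cos2sin2 -exprMn.
by rewrite sqrtr_sqr ger0_norm// mulr_ge0// cos_ge0_quarter.
Qed.

Lemma sqrt_sin (c x : R) : 0 <= c -> 0 <= x <= pi / 2 ->
  Num.sqrt (c ^+ 2 - (c * cos x) ^+ 2) = c * sin x.
Proof.
move=> c0 xp; rewrite exprMn -{1}[c ^+ 2]mulr1 -mulrBr -sin2cos2 -exprMn.
by rewrite sqrtr_sqr ger0_norm// mulr_ge0// sin_ge0_quarter.
Qed.

(** Projecting the sphere on a coordinate plane multiplies the area element by a cosine, which is a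
    coordinate divided by [r]; the weight [w] will be that coordinate, at most [r]. *)
Lemma le_oct (r : R) (h : space3 R -> R) (w : R * R -> R) : 0 < r -> continuous h ->
  (forall x, 0 <= h x) -> continuous w ->
  (forall z t, 0 <= z <= r -> 0 <= t <= pi / 2 -> 0 <= w (z, t) <= r) ->
  (\int[mu]_(z in `[0%R, r]) \int[mu]_(t in `[0%R, (pi / 2)%R])
     (let c := Num.sqrt (r ^+ 2 - z ^+ 2) in
      h (c * cos t, c * sin t, z) * w (z, t))%:E <= oct r h)%E.
Proof.
move=> r0 ch h0 cw wr.
pose k (q : R * R) := let c := Num.sqrt (r ^+ 2 - q.1 ^+ 2) in
      h (c * cos q.2, c * sin q.2, q.1) * w q.
pose D : set (R * R) := `[0, r] `*` `[0, pi / 2].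
have mD : @measurable _ (mR * mR)%type D by apply: measurableX.
have DE x y : D (x, y) <-> `[0, r]%classic x /\ `[0, pi / 2]%classic y by [].
apply: (@le_region D D k (oct_integrand r h) _ _ (fun=> `[0, pi / 2]%classic)
  (fun=> `[0, pi / 2]%classic)) => //.
- by rewrite /k; cont.
- exact: oct_integrand_continuous.
- move=> [z t] [/=]; rewrite !in_itv/= => zr tp.
  have /andP[w0 wr'] := wr _ _ zr tp; rewrite /k /oct_integrand/= mulr_ge0//=.
  by rewrite mulrC ler_wpM2r.
- by move=> [z t] _; rewrite /oct_integrand/= mulr_ge0// ltW.
Qed.

(** At fixed height, with [c] the radius of the parallel, [y = c sin t] gives [dy = c cos t dt]; the
    density [c cos t] is the first coordinate of the point and is at most [r]. *)
Lemma oct_chart1 (r : R) (h : space3 R -> R) : 0 < r -> continuous h ->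
  (forall x, 0 <= h x) ->
  (\int[mu]_(z in `[0%R, r]) \int[mu]_(y in `[0%R, (Num.sqrt (r ^+ 2 - z ^+ 2))%R])
     (h (cap r (y, z), y, z))%:E <= oct r h)%E.
Proof.
move=> r0 ch h0.
apply: le_trans (@le_oct r h (fun q => Num.sqrt (r ^+ 2 - q.1 ^+ 2) * cos q.2)
  r0 ch h0 _ _); last 2 first.
- by cont.
- move=> z t /andP[z0 zr] tp; rewrite mulr_ge0 ?sqrtr_ge0 ?cos_ge0_quarter//=.
  rewrite -[X in _ <= X]mulr1 ler_pM ?sqrtr_ge0 ?cos_ge0_quarter ?cos_le1//.
  rewrite -[X in _ <= X]gtr0_norm// -sqrtr_sqr.
  by rewrite ler_wsqrtr// lerBlDr lerDl sqr_ge0.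
rewrite le_eqVlt; apply/orP; left; apply/eqP.
apply: eq_integral => z; rewrite inE/= in_itv/= => /andP[z0 zr].
set c := Num.sqrt _.
have c0 : 0 <= c := sqrtr_ge0 _.
have cE : c ^+ 2 = r ^+ 2 - z ^+ 2.
  by rewrite sqr_sqrtr// subr_ge0 ler_sqr ?nnegrE// ltW.
(* At the pole the parallel is a point and both inner integrals vanish. *)
have [c1|c1] := ltP 0 c; last first.
  have {}c0 : c = 0 by apply/eqP; rewrite eq_le c0 c1.
  rewrite c0 set_itv1 integral_set1 integral0_eq// => t _.
  by rewrite !mul0r mulr0.
have := @subst_sin (fun y => h (cap r (y, z), y, z)) c (pi / 2) c1.
rewrite sin_pihalf mulr1 => ->.
- apply: eq_integral => t; rewrite inE/= in_itv/= => tp.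
  congr (h _ * _)%:E; congr (_, _, _); rewrite /cap/= -(sqrt_cos c0 tp) cE.
  by congr Num.sqrt; ring.
- by rewrite lexx andbT ltW// pihalf_gt0.
- by rewrite /cap; cont.
Qed.

(** Here [x = c cos t], and the density [c sin t] is the second coordinate of the point. *)
Lemma oct_chart2 (r : R) (h : space3 R -> R) : 0 < r -> continuous h ->
  (forall x, 0 <= h x) ->
  (\int[mu]_(z in `[0%R, r]) \int[mu]_(x in `[0%R, (Num.sqrt (r ^+ 2 - z ^+ 2))%R])
     (h (x, cap r (x, z), z))%:E <= oct r h)%E.
Proof.
move=> r0 ch h0.
apply: le_trans (@le_oct r h (fun q => Num.sqrt (r ^+ 2 - q.1 ^+ 2) * sin q.2)
  r0 ch h0 _ _); last 2 first.
- by cont.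
- move=> z t /andP[z0 zr] tp; rewrite mulr_ge0 ?sqrtr_ge0 ?sin_ge0_quarter//=.
  rewrite -[X in _ <= X]mulr1 ler_pM ?sqrtr_ge0 ?sin_ge0_quarter ?sin_le1//.
  rewrite -[X in _ <= X]gtr0_norm// -sqrtr_sqr.
  by rewrite ler_wsqrtr// lerBlDr lerDl sqr_ge0.
rewrite le_eqVlt; apply/orP; left; apply/eqP.
apply: eq_integral => z; rewrite inE/= in_itv/= => /andP[z0 zr].
set c := Num.sqrt _.
have c0 : 0 <= c := sqrtr_ge0 _.
have cE : c ^+ 2 = r ^+ 2 - z ^+ 2.
  by rewrite sqr_sqrtr// subr_ge0 ler_sqr ?nnegrE// ltW.
have [c1|c1] := ltP 0 c; last first.
  have {}c0 : c = 0 by apply/eqP; rewrite eq_le c0 c1.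
  rewrite c0 set_itv1 integral_set1 integral0_eq// => t _.
  by rewrite !mul0r mulr0.
rewrite (@subst_cos (fun x => h (x, cap r (x, z), z)) c c1).
- apply: eq_integral => t; rewrite inE/= in_itv/= => tp.
  congr (h _ * _)%:E; congr (_, _, _); rewrite /cap/= -(sqrt_sin c0 tp) cE.
  by congr Num.sqrt; ring.
- by rewrite /cap; cont.
Qed.

End Octant.

(** * The graph chart of the octant over the horizontal plane *)

Section PolarChart.
Context {R : realType}.
Local Notation mR := (measurableTypeR R).
Local Notation mu := (@lebesgue_measure R).

Lemma measurable_inner (D : set (R * R)) (k : R * R -> R) (I : set mR)
    (J : R -> set R) : measurable I ->
  @measurable _ (mR * mR)%type D -> continuous k ->
  (forall q, D q -> 0 <= k q) -> (forall x y, D (x, y) <-> I x /\ J x y) ->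
  measurable_fun I (fun x : mR => (\int[mu]_(y in J x) (k (x, y))%:E)%E).
Proof.
move=> mI mD ck k0 DIJ.
apply: (eq_measurable_fun
  (fun x : mR => (\int[mu]_y ((EFin \o k) \_ D) (x, y))%E)).
  move=> x /set_mem Ix; rewrite [RHS]integral_mkcond; apply: eq_integral => y _.
  rewrite /patch; congr (if _ then _ else _); apply/idP/idP; rewrite !inE.
    by case/DIJ.
  by move=> Jxy; apply/DIJ.
apply: measurable_funS (@measurableT _ mR) _ _ => //.
apply: (@measurable_fun_fubini_tonelli_F _ _ _ _ _ mu ((EFin \o k) \_ D)).
  exact: ((measurable_restrictT _ mD).1 (measurable_region mD ck)).
by move=> q; apply: erestrict_ge0 => x Dx; rewrite lee_fin k0.
Qed.

Lemma quarter_discE (c y z : R) : 0 <= c ->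
  (0 <= y <= c /\ 0 <= z <= Num.sqrt (c ^+ 2 - y ^+ 2)) <->
  [/\ 0 <= y, 0 <= z & y ^+ 2 + z ^+ 2 <= c ^+ 2].
Proof.
move=> c0; split=> [[/andP[y0 yc] /andP[z0 zs]]|[y0 z0 H]].
  split=> //; have yc2 : y ^+ 2 <= c ^+ 2 by rewrite ler_sqr ?nnegrE.
  move: zs; rewrite -ler_sqr ?nnegrE ?sqrtr_ge0// sqr_sqrtr ?subr_ge0//; lra.
have zz := sqr_ge0 z; have yy := sqr_ge0 y.
rewrite y0 z0/=; split; first by rewrite -ler_sqr ?nnegrE//; lra.
by rewrite -ler_sqr ?nnegrE ?sqrtr_ge0// sqr_sqrtr; lra.
Qed.

Lemma measurable_quarter_disc (a c : R) :
  @measurable _ (mR * mR)%type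
    [set q : R * R | [/\ 0 <= q.1, a <= q.2 & q.1 ^+ 2 + q.2 ^+ 2 <= c]].
Proof.
pose f1 (q : R * R) := q.1; pose f2 (q : R * R) := q.2.
pose f3 (q : R * R) := q.1 ^+ 2 + q.2 ^+ 2.
have m1 : measurable_fun [set: mR * mR] f1 by apply: continuous_measurable2; rewrite
  /f1; cont.
have m2 : measurable_fun [set: mR * mR] f2 by apply: continuous_measurable2; rewrite
  /f2; cont.
have m3 : measurable_fun [set: mR * mR] f3 by apply: continuous_measurable2; rewrite
  /f3; cont.
rewrite (_ : [set _ | _] = (f1 @^-1` `[0, +oo[) `&` (f2 @^-1` `[a, +oo[) `&`
  (f3 @^-1` `]-oo, c])).
  apply: measurableI; first apply: measurableI.
  - by rewrite -[X in measurable X]setTI; exact: m1.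
  - by rewrite -[X in measurable X]setTI; exact: m2.
  - by rewrite -[X in measurable X]setTI; exact: m3.
apply/seteqP; split => q /=; rewrite !in_itv/= ?andbT.
  by case.
by move=> [[]].
Qed.

(** The vertical projection takes two substitutions. At fixed [y], trading [x] for the height [z]
    gives [dx = (z / x) dz]; after exchanging [y] and [z], [y = c sin t] gives [dy = x dt]. The
    product is [z dz dt], and [z <= r]. The quotient [z / x] is singular at [x = 0], hence the
    truncation [x >= d]; [rho] is the largest [y] for which [x] can reach [d]. *)
Lemma polar_trunc (r d rho : R) (h : space3 R -> R) : 0 < d -> d < r ->
  continuous h -> (forall x, 0 <= h x) ->
  rho = Num.sqrt (r ^+ 2 - d ^+ 2) ->
  (\int[mu]_(y in `[0%R, rho]) \int[mu]_(x in `[d, (Num.sqrt (r ^+ 2 - y ^+ 2))%R])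
     (h (x, y, cap r (x, y)))%:E <= oct r h)%E.
Proof.
move=> d0 dr ch h0 rhodef.
have r0 : 0 < r := lt_trans d0 dr.
have dr2 : d ^+ 2 < r ^+ 2 by rewrite ltr_sqr ?nnegrE ?ltW.
have d2 : 0 < d ^+ 2 by rewrite exprn_gt0.
have rho0 : 0 <= rho by rewrite rhodef sqrtr_ge0.
have rhoE : rho ^+ 2 = r ^+ 2 - d ^+ 2 by rewrite rhodef sqr_sqrtr//; lra.
have rhor : rho <= r by rewrite -ler_sqr ?nnegrE ?(ltW r0)// rhoE; lra.
(* The first coordinate as a function of [(y, z)], kept above [d] so that its inverse is continuous
   everywhere; on the quarter disc of radius [rho] the maximum changes nothing. *)
pose X (q : R * R) := Num.sqrt (Num.max (r ^+ 2 - q.1 ^+ 2 - q.2 ^+ 2) (d ^+ 2)).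
have Xgt0 q : 0 < X q by rewrite sqrtr_gt0 lt_max d2 orbT.
have cX : continuous X by rewrite /X; cont.
have cXV : continuous (fun q => (X q)^-1).
  by apply: continuous_inv => // q; rewrite gt_eqF.
have XE q : q.1 ^+ 2 + q.2 ^+ 2 <= rho ^+ 2 ->
    X q = Num.sqrt (r ^+ 2 - q.1 ^+ 2 - q.2 ^+ 2).
  by move=> H; rewrite /X; congr Num.sqrt; apply/max_idPl; lra.
pose K (q : R * R) := h (X q, q.1, q.2) * (q.2 * (X q)^-1).
have cK : continuous K by rewrite /K; cont.
have step1 y : 0 <= y <= rho ->
    (\int[mu]_(x in `[d, (Num.sqrt (r ^+ 2 - y ^+ 2))%R])
      (h (x, y, cap r (x, y)))%:E =
     \int[mu]_(z in `[0%R, (Num.sqrt (rho ^+ 2 - y ^+ 2))%R]) (K (y, z))%:E)%E.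
  move=> /andP[y0 yrho].
  have y2 : y ^+ 2 <= rho ^+ 2 by rewrite ler_sqr ?nnegrE.
  pose b := Num.sqrt (rho ^+ 2 - y ^+ 2).
  have b0 : 0 <= b := sqrtr_ge0 _.
  have bE : b ^+ 2 = rho ^+ 2 - y ^+ 2 by rewrite sqr_sqrtr// subr_ge0.
  pose F (z : R) := Num.sqrt (r ^+ 2 - y ^+ 2 - z ^+ 2).
  pose f (z : R) := z * (X (y, z))^-1.
  have zb z : 0 <= z <= b -> y ^+ 2 + z ^+ 2 <= rho ^+ 2.
    by move=> /andP[z0 zb]; have : z ^+ 2 <= b ^+ 2 by [rewrite ler_sqr ?nnegrE]; lra.
  have F0 : F 0 = Num.sqrt (r ^+ 2 - y ^+ 2) by rewrite /F expr0n/= subr0.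
  have Fb : F b = d.
    rewrite /F bE rhoE (_ : _ - _ = d ^+ 2); last by ring.
    by rewrite sqrtr_sqr gtr0_norm.
  have cF : continuous F by rewrite /F; cont.
  have cf : continuous f.
    rewrite /f; apply: continuous_mul; first exact: continuous_id.
    by apply: (@continuous_compose _ _ _ _ _ cXV); cont.
  have FX z : 0 <= z <= b -> F z = X (y, z) by move=> /zb H; rewrite XE.
  have dF z : 0 < z < b -> is_derive z 1 F (- f z).
    move=> /andP[z0 zb'].
    have zbb : 0 <= z <= b by rewrite !ltW.
    have u0 : 0 < r ^+ 2 - y ^+ 2 - z ^+ 2 by have := zb _ zbb; lra.
    have du : is_derive z 1 (fun z : R => r ^+ 2 - y ^+ 2 - z ^+ 2) (- (2 * z)).
      have dz := is_derive_id z (1 : R).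
      apply: (is_derive_val (is_derive_sub (is_derive_const z 1 (r ^+ 2 - y ^+ 2))
         (is_derive_mul dz dz))).
      by rewrite mul1r mulr1; ring.
    apply: (is_derive_val (is_derive_chain du (is_derive1_sqrt u0))).
    rewrite -/(F z) FX// /f; field.
    by rewrite gt_eqF//= gt_eqF.
  have f0 z : 0 < z < b -> 0 < f z.
    by move=> /andP[z0 _]; rewrite /f mulr_gt0// invr_gt0.
  have ck : continuous (fun x => h (x, y, cap r (x, y))) by rewrite /cap; cont.
  have := @subst_decreasing _ F f (fun x => h (x, y, cap r (x, y))) 0 b b0 cF cf dF f0 ck.
  rewrite F0 Fb => ->; apply: eq_integral => z; rewrite inE/= in_itv/= => zbb.
  rewrite /K /f/= -FX//; congr (h (_, _, _) * _)%:E.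
  have u0 : 0 < r ^+ 2 - y ^+ 2 - z ^+ 2 by have := zb _ zbb; lra.
  rewrite /cap/= /F sqr_sqrtr ?ltW// (_ : _ - _ - _ = z ^+ 2); last by ring.
  by rewrite sqrtr_sqr ger0_norm//; case/andP: zbb.
have -> : (\int[mu]_(y in `[0%R, rho]) \int[mu]_(x in `[d, (Num.sqrt (r ^+ 2 - y ^+ 2))%R])
     (h (x, y, cap r (x, y)))%:E =
  \int[mu]_(y in `[0%R, rho]) \int[mu]_(z in `[0%R, (Num.sqrt (rho ^+ 2 - y ^+ 2))%R])
     (K (y, z))%:E)%E.
  by apply: eq_integral => y; rewrite inE/= in_itv/= => /step1.
pose D := [set q : R * R | [/\ 0 <= q.1, 0 <= q.2 & q.1 ^+ 2 + q.2 ^+ 2 <= rho ^+ 2]].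
have mD : @measurable _ (mR * mR)%type D := measurable_quarter_disc 0 (rho ^+ 2).
have K0 q : D q -> 0 <= K q.
  by move=> [_ q0 _]; rewrite /K mulr_ge0// mulr_ge0// invr_ge0 ltW.
have DE x y : D (x, y) <-> `[0, rho]%classic x /\
    `[0, Num.sqrt (rho ^+ 2 - x ^+ 2)]%classic y.
  by rewrite /= !in_itv/=; split=> /(quarter_discE _ _ rho0).
have DE' x y : D (x, y) <-> `[0, rho]%classic y /\
    `[0, Num.sqrt (rho ^+ 2 - y ^+ 2)]%classic x.
  rewrite /= !in_itv/=; split=> [[a b c]|/(quarter_discE _ _ rho0)[a b c]].
    by apply/(quarter_discE _ _ rho0); split=> //; rewrite addrC.
  by split=> //; rewrite addrC.
rewrite (@tonelli_region _ D K _ _ _ _ mD cK K0 DE DE').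
pose k (q : R * R) := let c := Num.sqrt (r ^+ 2 - q.1 ^+ 2) in
  h (c * cos q.2, c * sin q.2, q.1) * q.1.
have ck : continuous k by rewrite /k; cont.
(* The range of [y] fills only the angles up to [A], where [sin A = m / c]; positivity allows the
   whole right angle. *)
have step2 z : 0 <= z <= rho ->
   (\int[mu]_(y in `[0%R, (Num.sqrt (rho ^+ 2 - z ^+ 2))%R]) (K (y, z))%:E <=
    \int[mu]_(t in `[0%R, (pi / 2)%R]) (k (z, t))%:E)%E.
  move=> /andP[z0 zrho].
  have z2 : z ^+ 2 <= rho ^+ 2 by rewrite ler_sqr ?nnegrE.
  pose c := Num.sqrt (r ^+ 2 - z ^+ 2); pose m := Num.sqrt (rho ^+ 2 - z ^+ 2).
  have cE : c ^+ 2 = r ^+ 2 - z ^+ 2 by rewrite sqr_sqrtr//; lra.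
  have mE : m ^+ 2 = rho ^+ 2 - z ^+ 2 by rewrite sqr_sqrtr//; lra.
  have c0 : 0 < c by rewrite sqrtr_gt0; lra.
  have m0 : 0 <= m := sqrtr_ge0 _.
  have mc : m <= c by rewrite -ler_sqr ?nnegrE ?(ltW c0)// mE cE; lra.
  have mc01 : 0 <= m / c <= 1 by rewrite divr_ge0 ?(ltW c0)//= ler_pdivrMr// mul1r.
  have mcN : -1 <= m / c <= 1.
    by case/andP: mc01 => a ->; rewrite andbT (le_trans _ a)// lerN10.
  pose A := asin (m / c).
  have sA : sin A = m / c by rewrite asinK// in_itv.
  have A0 : 0 <= A <= pi / 2.
    rewrite asin_lepi2// andbT leNgt; apply/negP => A0.
    have : sin A < 0.
      rewrite -[A]opprK sinN oppr_lt0; apply: sin_gt0_pi.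
      have := asin_geNpi2 mcN; rewrite -/A => ?; have := pi_gt0 R => ?.
      by apply/andP; split; lra.
    by rewrite sA; case/andP: mc01 => /le_lt_trans H _ /H; rewrite ltxx.
  have cKz : continuous (fun y => K (y, z)) by cont.
  have := subst_sin c0 A0 cKz.
  rewrite sA mulrC divfK ?gt_eqF// => ->.
  have Ain t : 0 <= t <= A -> 0 <= t <= pi / 2.
    by move=> /andP[-> tA]/=; case/andP: A0 => _; exact: le_trans.
  have kE t : 0 <= t <= A -> K (c * sin t, z) * (c * cos t) = k (z, t).
    move=> tA; have tp := Ain _ tA; have s0 := sin_ge0_quarter tp.
    have sm : c * sin t <= m.
      rewrite -(@ler_pM2r _ (c^-1)) ?invr_gt0// mulrAC divff ?gt_eqF// mul1r -sA.
      have pi0 := pihalf_gt0 (R := R).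
      rewrite leNgt ltr_sin ?in_itv/=.
      + by rewrite -leNgt; case/andP: tA.
      + by case/andP: A0 => A0 ->; rewrite andbT; apply: le_trans A0; lra.
      + by case/andP: tp => t0 ->; rewrite andbT; apply: le_trans t0; lra.
    have sm2 : (c * sin t) ^+ 2 <= m ^+ 2.
      by rewrite ler_sqr ?nnegrE// mulr_ge0// ltW.
    have XEt : X (c * sin t, z) = c * cos t.
      rewrite XE/=; last by lra.
      by rewrite -(sqrt_cos (ltW c0) tp) cE; congr Num.sqrt; ring.
    have ct0 : 0 < c * cos t by rewrite -XEt.
    by rewrite /K/= XEt /k/= -/c -mulrA mulfVK// gt_eqF.
  have -> : (\int[mu]_(t in `[0%R, A]) (K (c * sin t, z) * (c * cos t))%:E =
     \int[mu]_(t in `[0%R, A]) (k (z, t))%:E)%E.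
    by apply: eq_integral => t; rewrite inE/= in_itv/= => /kE ->.
  apply: ge0_subset_integral => //.
  - have ckz : continuous (fun t => k (z, t)) by cont.
    by apply/measurable_EFinP; exact: measurable_continuous_itv.
  - by move=> t _; rewrite lee_fin /k mulr_ge0.
apply: (@le_trans _ _ (\int[mu]_(z in `[0%R, rho])
    \int[mu]_(t in `[0%R, (pi / 2)%R]) (k (z, t))%:E)%E).
  apply: ge0_le_integral => //.
  - move=> z; rewrite /= in_itv/= => /andP[z0 _]; apply: integral_ge0 => y.
    rewrite /= in_itv/= => /andP[y0 _]; rewrite lee_fin /K/=.
    by rewrite mulr_ge0// mulr_ge0// invr_ge0 ltW.
  - pose D1 := [set q : R * R | D (q.2, q.1)].
    have D1E x y : D1 (x, y) <-> `[0, rho]%classic x /\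
       `[0, Num.sqrt (rho ^+ 2 - x ^+ 2)]%classic y by exact: DE'.
    have := @measurable_inner D1 (fun q => K (q.2, q.1)) `[0, rho]%classic _ _ _ _ _ D1E.
    apply => //.
    + rewrite (_ : D1 = D)//; apply/seteqP; split=> q [a b c]; split => //=;
      by rewrite addrC.
    + by cont.
    + by move=> q; apply: K0.
  - pose D1 : set (R * R) := `[0, rho] `*` `[0, pi / 2].
    have mD1 : @measurable _ (mR * mR)%type D1 by apply: measurableX.
    have D1E x y : D1 (x, y) <-> `[0, rho]%classic x /\ `[0, pi / 2]%classic y by [].
    apply: (@measurable_inner D1 k `[0, rho]%classic (fun=> `[0, pi / 2]%classic)) => //.
    by move=> [z t] [/=]; rewrite in_itv/= => /andP[z0 _] _; rewrite /k mulr_ge0.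
pose D1 : set (R * R) := `[0, rho] `*` `[0, pi / 2].
pose D2 : set (R * R) := `[0, r] `*` `[0, pi / 2].
have mD1 : @measurable _ (mR * mR)%type D1 by apply: measurableX.
have mD2 : @measurable _ (mR * mR)%type D2 by apply: measurableX.
apply: (@le_region _ D1 D2 k (oct_integrand r h) _ _ (fun=> `[0, pi / 2]%classic)
  (fun=> `[0, pi / 2]%classic)) => //.
- exact: oct_integrand_continuous.
- move=> [z t] [/=]; rewrite !in_itv/= => /andP[z0 zr] tp; split => //=.
  by rewrite in_itv/= z0 (le_trans zr).
- move=> [z t] [/=]; rewrite !in_itv/= => /andP[z0 zr] tp.
  rewrite /k /oct_integrand/= mulr_ge0//= mulrC ler_wpM2r//.
  exact: le_trans zr rhor.
- by move=> [z t] _; rewrite /oct_integrand/= mulr_ge0// ltW.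
Qed.

(** Removes the truncation of [polar_trunc]: the strip [0 <= x < d] contributes at most
    [d * (M + 1) * r], with [M] a bound of [h] on [cube r]. *)
Lemma oct_chart3 (r : R) (h : space3 R -> R) : 0 < r ->
  continuous h -> (forall x, 0 <= h x) ->
  (\int[mu]_(y in `[0%R, r]) \int[mu]_(x in `[0%R, (Num.sqrt (r ^+ 2 - y ^+ 2))%R])
     (h (x, y, cap r (x, y)))%:E <= oct r h)%E.
Proof.
move=> r0 ch h0; have [M M0 HM] := continuous_bounded (@cube_compact _ r) ch.
apply/lee_addgt0Pr => e e0.
(* The first entry keeps [d] below [r], the second makes the strip contribute at most [e]; [M + 1]
   is a denominator that cannot vanish. *)
pose d := Num.min (r / 2) (e / (M + 1) / r).
have M1 : 0 < M + 1 by lra.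
have d0 : 0 < d by rewrite lt_min !divr_gt0.
have dr : d < r by rewrite gt_min; apply/orP; left; lra.
have dM : d * (M + 1) * r <= e.
  by rewrite -ler_pdivlMr// -ler_pdivlMr// mulrAC ge_min lexx orbT.
pose rho := Num.sqrt (r ^+ 2 - d ^+ 2).
have dr2 : d ^+ 2 < r ^+ 2 by rewrite ltr_sqr ?nnegrE ?ltW.
have rho0 : 0 <= rho := sqrtr_ge0 _.
have rhoE : rho ^+ 2 = r ^+ 2 - d ^+ 2 by rewrite sqr_sqrtr//; lra.
have rhor : rho <= r.
  by rewrite -ler_sqr ?nnegrE ?(ltW r0)// rhoE; have := sqr_ge0 d; lra.
have ptr := polar_trunc d0 dr ch h0 (erefl rho).
pose k (q : R * R) := h (q.2, q.1, cap r (q.2, q.1)).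
have ck : continuous k by rewrite /k /cap; cont.
pose E a := [set q : R * R | [/\ 0 <= q.1, a <= q.2 & q.1 ^+ 2 + q.2 ^+ 2 <= r ^+ 2]].
have mE a : @measurable _ (mR * mR)%type (E a) := measurable_quarter_disc a (r ^+ 2).
have EE a x y : 0 <= a -> E a (x, y) <-> `[0, r]%classic x /\
    `[a, Num.sqrt (r ^+ 2 - x ^+ 2)]%classic y.
  move=> a0; rewrite /= !in_itv/=; split=> [[x0 y0 H]|[xr /andP[ay yr]]].
    have [|xr /andP[_ ys]] := (quarter_discE x y (ltW r0)).2.
      by split=> //; exact: le_trans y0.
    by rewrite xr y0 ys.
  have [|x0 _ H] := (quarter_discE x y (ltW r0)).1; last by [].
  by rewrite xr (le_trans a0 ay) yr.
pose I1 (y : mR) : \bar R := (\int[mu]_(x in `[0%R, (Num.sqrt (r ^+ 2 - y ^+ 2))%R]) (k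
  (y, x))%:E)%E.
pose I2 (y : mR) : \bar R := (\int[mu]_(x in `[d, (Num.sqrt (r ^+ 2 - y ^+ 2))%R]) (k
  (y, x))%:E)%E.
have k0 q : 0 <= k q by exact: h0.
have mI1 : measurable_fun (`[0, r] : set mR) I1.
  by apply: (@measurable_inner (E 0) k) => // x y; exact: EE.
have mI2 : measurable_fun (`[0, r] : set mR) I2.
  by apply: (@measurable_inner (E d) k) => // x y; apply: EE; exact: ltW.
have I20 y : (0 <= I2 y)%E by apply: integral_ge0 => x _; rewrite lee_fin.
have I12 y : 0 <= y <= r -> (I1 y <= (d * (M + 1))%:E + I2 y)%E.
  move=> /andP[y0 yr].
  have mk (A : set mR) : measurable_fun A (fun x => (k (y, x))%:E).
    have cky : continuous (fun x => k (y, x)) by cont.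
    by apply/measurable_EFinP; exact: measurable_continuous_itv.
  have y2 : y ^+ 2 <= r ^+ 2 by rewrite ler_sqr ?nnegrE// ltW.
  set s := Num.sqrt (r ^+ 2 - y ^+ 2).
  have s0 : 0 <= s := sqrtr_ge0 _.
  have sE : s ^+ 2 = r ^+ 2 - y ^+ 2 by rewrite sqr_sqrtr// subr_ge0.
  pose A := (`[0, s] `&` `[0, d[)%classic : set mR.
  have mA : measurable A by apply: measurableI.
  apply: (@le_trans _ _ (\int[mu]_(x in A `|` `[d, s]) (k (y, x))%:E)%E).
    apply: ge0_subset_integral => //.
    - exact: measurableU.
    - by move=> x _; rewrite lee_fin.
    - move=> x; rewrite /A /= !in_itv/= => /andP[x0 xs]; rewrite x0 xs/= andbT.
      by have [xd|xd] := ltP x d; [left|right].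
  apply: (@le_trans _ _ (\int[mu]_(x in A) (k (y, x))%:E + I2 y)%E).
    rewrite ge0_integral_setU//.
    - by move=> x _; rewrite lee_fin.
    - apply/disj_setPS => x [[/= _]]; rewrite !in_itv/= => /andP[_ xd] /andP[dx _].
      by move: (lt_le_trans xd dx); rewrite ltxx.
  rewrite leeD2r//.
  apply: (@le_trans _ _ (\int[mu]_(x in A) (M + 1)%:E)%E).
    apply: ge0_le_integral => //.
    - by move=> x _; rewrite lee_fin.
    - move=> x [/=]; rewrite !in_itv/= => /andP[x0 xs] _; rewrite lee_fin.
      apply: (@le_trans _ _ M); last by lra.
      apply: le_trans (HM (x, y, cap r (x, y)) _); first by rewrite ger0_norm.
      apply: closed_ball_cube; rewrite ?(ltW r0)// enorm_le ?(ltW r0)//=.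
      have x2 : x ^+ 2 <= s ^+ 2 by rewrite ler_sqr ?nnegrE.
      by rewrite /cap/= sqr_sqrtr; lra.
  rewrite integral_cst// mulrC EFinM lee_wpmul2l ?lee_fin ?(ltW M1)//.
  have mAd : (mu A <= mu (`[0%R, d[%classic : set mR))%E.
    by apply: le_measure; rewrite ?inE//; exact: subIsetr.
  by move: mAd; rewrite lebesgue_measure_itv/= lte_fin d0 -EFinD subr0.
apply: (@le_trans _ _ (\int[mu]_(y in `[0%R, r]) ((d * (M + 1))%:E + I2 y))%E).
  apply: ge0_le_integral => //.
  - by move=> y _; apply: integral_ge0 => x _; rewrite lee_fin.
  - by apply: emeasurable_funD.
rewrite ge0_integralD//; last first.
  by move=> y _; rewrite lee_fin mulr_ge0// ltW.
have -> : (\int[mu]_(y in `[0%R, r]) (d * (M + 1))%:E = (d * (M + 1) * r)%:E)%E.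
  transitivity ((d * (M + 1))%:E * mu (`[0%R, r]%classic : set mR))%E.
    exact: integral_cst.
  by rewrite lebesgue_measure_itv/= lte_fin r0 -EFinD subr0 -EFinM.
rewrite addeC; apply: leeD; last by rewrite lee_fin.
(* For [y] above [rho] the section from [d] to [Num.sqrt (r ^+ 2 - y ^+ 2)] is empty, so [I2] has
   the same integral over [[0, r]] and over [[0, rho]]. *)
apply: le_trans ptr; rewrite le_eqVlt; apply/orP; left; apply/eqP.
rewrite integral_mkcond [RHS]integral_mkcond; apply: eq_integral => y _.
rewrite /patch !mem_setE !in_itv/=.
have [y0|y0] := leP 0 y => //=.
have [yrho|yrho] := leP y rho; first by rewrite (le_trans yrho).
case: ifPn => // yr; rewrite /I2 set_itv_ge ?integral_set0// bnd_simp -ltNge.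
rewrite -ltr_sqr ?nnegrE ?sqrtr_ge0 ?(ltW d0)// sqr_sqrtr; last first.
  by rewrite subr_ge0 ler_sqr ?nnegrE// ltW.
by have : rho ^+ 2 < y ^+ 2 by [rewrite ltr_sqr ?nnegrE]; lra.
Qed.

End PolarChart.

(** * Reduction of sphere integrals to one octant *)

Section SphereIntegral.
Context {R : realType}.
Local Notation mR := (measurableTypeR R).
Local Notation mu := (@lebesgue_measure R).
Implicit Types (r : R) (h : space3 R -> R).

Lemma fold_even (m : R -> R) (c : R) : 0 <= c -> continuous m ->
  (forall x, 0 <= m x) ->
  (\int[mu]_(x in `[(- c)%R, c]) (m x)%:E =
   \int[mu]_(x in `[0%R, c]) (m x + m (- x))%:E)%E.
Proof.
move=> c0 cm m0; rewrite (@ge0_integral_itv_split _ m (- c) 0 c)//; last first.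
  by rewrite oppr_le0.
have := @subst_reflect _ m 0 0 c c0 cm; rewrite subr0 sub0r => ->.
have mm (f : R -> R) : continuous f ->
    measurable_fun (`[0, c]%classic : set mR) (EFin \o f).
  by move=> cf; apply/measurable_EFinP; exact: measurable_continuous_itv.
have cm' : continuous (fun x => m (0 - x)) by cont.
rewrite -ge0_integralD//.
- apply: eq_integral => x _; rewrite sub0r addeC -EFinD//.
- by move=> x _; rewrite lee_fin.
- exact: (mm _ cm').
- by move=> x _; rewrite lee_fin.
- exact: mm.
Qed.

Lemma fold_pi (m : R -> R) : continuous m -> (forall x, 0 <= m x) ->
  (\int[mu]_(x in `[0%R, pi]) (m x)%:E =
   \int[mu]_(x in `[0%R, (pi / 2)%R]) (m x + m (pi - x))%:E)%E.
Proof.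
move=> cm m0; have p0 := pihalf_gt0 (R := R).
rewrite (@ge0_integral_itv_split _ m 0 (pi / 2) pi)//; last 2 first.
- exact: ltW.
- lra.
have := @subst_reflect _ m pi 0 (pi / 2) (ltW p0) cm; rewrite subr0.
rewrite (_ : pi - pi / 2 = pi / 2); last by field.
move=> ->.
have mm (f : R -> R) : continuous f ->
    measurable_fun (`[0, pi / 2]%classic : set mR) (EFin \o f).
  by move=> cf; apply/measurable_EFinP; exact: measurable_continuous_itv.
have cm' : continuous (fun x => m (pi - x)) by cont.
rewrite -ge0_integralD//.
- by move=> x _; rewrite lee_fin.
- exact: mm.
- by move=> x _; rewrite lee_fin.
- exact: (mm _ cm').
Qed.

Lemma fold_2pi (m : R -> R) : continuous m -> (forall x, 0 <= m x) ->
  (\int[mu]_(x in `[0%R, (pi *+ 2)%R]) (m x)%:E =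
   \int[mu]_(x in `[0%R, (pi / 2)%R])
     (m x + m (pi + x) + (m (pi - x) + m (pi + (pi - x))))%:E)%E.
Proof.
move=> cm m0; have p0 := pi_gt0 R.
have cm' : continuous (fun x => m (pi + x)) by cont.
rewrite (@ge0_integral_itv_split _ m 0 pi (pi *+ 2))//; last 2 first.
- exact: ltW.
- by rewrite mulr2n lerDl ltW.
have := @subst_translate _ m pi 0 pi (ltW p0) cm; rewrite addr0 -mulr2n => ->.
have mm (f : R -> R) : continuous f ->
    measurable_fun (`[0, pi]%classic : set mR) (EFin \o f).
  by move=> cf; apply/measurable_EFinP; exact: measurable_continuous_itv.
rewrite -ge0_integralD//; last 4 first.
- by move=> x _; rewrite lee_fin.
- exact: mm.
- by move=> x _; rewrite lee_fin.
- exact: (mm _ cm').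
apply: (@fold_pi (fun x => m x + m (pi + x))); first by cont.
by move=> x; rewrite addr_ge0.
Qed.

(** Folding: an integral over a whole disc, or over the sphere for [sym3], becomes the integral of
    this sum over sign changes on a quarter disc or an octant. *)
Definition sym2 (g : R * R -> R) (q : R * R) : R :=
  g q + g (- q.1, q.2) + (g (q.1, - q.2) + g (- q.1, - q.2)).

Definition sym3 h (x : space3 R) : R :=
  sym2 (fun q => h (q, x.2) + h (q, - x.2)) x.1.

Lemma sym2_continuous g : continuous g -> continuous (sym2 g).
Proof. by move=> cg; rewrite /sym2; cont. Qed.

Lemma sym3_continuous h : continuous h -> continuous (sym3 h).
Proof. by move=> ch; rewrite /sym3 /sym2; cont. Qed.

Lemma sym3_ge0 h : (forall x, 0 <= h x) -> forall x, 0 <= sym3 h x.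
Proof. by move=> h0 x; rewrite /sym3 /sym2 !addr_ge0. Qed.

Definition closed_disc r : set (R * R) := [set q | q.1 ^+ 2 + q.2 ^+ 2 <= r ^+ 2].

Lemma measurable_closed_disc r : @measurable _ (mR * mR)%type (closed_disc r).
Proof.
rewrite -[X in measurable X]setTI.
rewrite (_ : closed_disc r = (fun q => q.1 ^+ 2 + q.2 ^+ 2) @^-1` `]-oo, r ^+ 2]).
  by apply: continuous_measurable2 => //; cont.
by apply/seteqP; split => x /=; rewrite in_itv.
Qed.

Lemma half_disc_sectionE (c y z : R) : 0 <= c ->
  (- c <= y <= c /\ - Num.sqrt (c ^+ 2 - y ^+ 2) <= z <= Num.sqrt (c ^+ 2 - y ^+ 2)) <->
  y ^+ 2 + z ^+ 2 <= c ^+ 2.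
Proof.
move=> c0; have zz := sqr_ge0 z; have yy := sqr_ge0 y.
have ny : (- c <= y <= c) = (y ^+ 2 <= c ^+ 2).
  by rewrite -ler_norml -(ler_sqr (normr_ge0 y) c0) real_normK// num_real.
rewrite ny; split=> [[y2]|H].
  rewrite -ler_norml -(ler_sqr (normr_ge0 z) (sqrtr_ge0 _)) real_normK ?num_real//.
  by rewrite sqr_sqrtr ?subr_ge0//; lra.
have y2 : y ^+ 2 <= c ^+ 2 by lra.
split=> //; rewrite -ler_norml -(ler_sqr (normr_ge0 z) (sqrtr_ge0 _)).
by rewrite real_normK ?num_real// sqr_sqrtr ?subr_ge0//; lra.
Qed.

(** The sections of the disc are symmetric intervals: folding in [y] leaves a half disc, exchanging
    the order makes its sections in [x] symmetric, and folding in [x] leaves the quarter. *)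
Lemma integral_closed_disc r (g : R * R -> R) : 0 < r -> continuous g ->
  (forall q, 0 <= g q) ->
  (\int[leb2]_(q in closed_disc r) (g q)%:E =
   \int[mu]_(x in `[0%R, r]) \int[mu]_(y in `[0%R, (Num.sqrt (r ^+ 2 - x ^+ 2))%R])
     (sym2 g (x, y))%:E)%E.
Proof.
move=> r0 cg g0.
pose c (x : R) := Num.sqrt (r ^+ 2 - x ^+ 2).
have DE x y : closed_disc r (x, y) <->
    `[- r, r]%classic x /\ `[- c x, c x]%classic y.
  rewrite /closed_disc/= !in_itv/=; symmetry; exact: half_disc_sectionE (ltW r0).
have mD := measurable_closed_disc r.
rewrite -(region_leb2 mD cg (fun q _ => g0 q) DE).
pose g1 (q : R * R) := g q + g (q.1, - q.2).
have cg1 : continuous g1 by rewrite /g1; cont.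
have g10 q : 0 <= g1 q by rewrite addr_ge0.
have -> : (\int[mu]_(x in `[(- r)%R, r]) \int[mu]_(y in `[(- c x)%R, c x]) (g (x, y))%:E =
   \int[mu]_(x in `[(- r)%R, r]) \int[mu]_(y in `[0%R, c x]) (g1 (x, y))%:E)%E.
  apply: eq_integral => x _; apply: (@fold_even (fun y => g (x, y))) => //.
  - exact: sqrtr_ge0.
  - by cont.
pose H := [set q : R * R | 0 <= q.2] `&` closed_disc r.
have mH : @measurable _ (mR * mR)%type H.
  apply: measurableI => //; rewrite -[X in measurable X]setTI.
  rewrite (_ : [set _ | _] = (fun q : R * R => q.2) @^-1` `[0, +oo[).
    by apply: continuous_measurable2 => //; cont.
  by apply/seteqP; split => q /=; rewrite in_itv/= andbT.
have HE x y : H (x, y) <-> `[- r, r]%classic x /\ `[0, c x]%classic y.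
  rewrite /H/=; split=> [[y0 /DE[xr]]|[xr]].
    by rewrite /= !in_itv/= y0 => /andP[].
  rewrite /= in_itv/= => /andP[y0 yc]; split=> //; apply/DE; split=> //=.
  by rewrite in_itv/= yc (le_trans _ y0)// oppr_le0 sqrtr_ge0.
have HE' x y : H (x, y) <-> `[0, r]%classic y /\ `[- c y, c y]%classic x.
  rewrite /H /closed_disc/= !in_itv/= addrC; split=> [[y0 /(half_disc_sectionE _ _ (ltW
    r0))[yr ->]]|[/andP[y0 yr] xc]].
    by split=> //; rewrite y0; case/andP: yr.
  split=> //; apply/(half_disc_sectionE _ _ (ltW r0)); split=> //.
  by rewrite yr (le_trans _ y0)// oppr_le0 ltW.
rewrite (@tonelli_region _ H g1 _ _ _ _ mH cg1 (fun q _ => g10 q) HE HE').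
pose g2 (q : R * R) := g1 (q.1, q.2) + g1 (- q.1, q.2).
have cg2 : continuous g2 by rewrite /g2; cont.
have g20 q : 0 <= g2 q by rewrite addr_ge0.
have -> : (\int[mu]_(y in `[0%R, r]) \int[mu]_(x in `[(- c y)%R, c y]) (g1 (x, y))%:E =
   \int[mu]_(y in `[0%R, r]) \int[mu]_(x in `[0%R, c y]) (g2 (x, y))%:E)%E.
  apply: eq_integral => y _; apply: (@fold_even (fun x => g1 (x, y))) => //.
  - exact: sqrtr_ge0.
  - by cont.
pose Q := [set q : R * R | [/\ 0 <= q.1, 0 <= q.2 & q.1 ^+ 2 + q.2 ^+ 2 <= r ^+ 2]].
have mQ : @measurable _ (mR * mR)%type Q := measurable_quarter_disc 0 (r ^+ 2).
have QE x y : Q (x, y) <-> `[0, r]%classic x /\ `[0, c x]%classic y.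
  by rewrite /= !in_itv/=; split=> /(quarter_discE _ _ (ltW r0)).
have QE' x y : Q (x, y) <-> `[0, r]%classic y /\ `[0, c y]%classic x.
  rewrite /= !in_itv/=; split=> [[a b d]|/(quarter_discE _ _ (ltW r0))[a b d]].
    by apply/(quarter_discE _ _ (ltW r0)); split=> //; rewrite addrC.
  by split=> //; rewrite addrC.
rewrite -(@tonelli_region _ Q g2 _ _ _ _ mQ cg2 (fun q _ => g20 q) QE QE').
apply: eq_integral => x _; apply: eq_integral => y _; congr (_%:E).
by rewrite /g2 /g1 /sym2/=; ring.
Qed.

(** The second variable is outermost, the order in which [oct_chart2] and [oct_chart3] are
    stated. *)
Lemma integral_closed_disc_swap r (g : R * R -> R) : 0 < r -> continuous g ->
  (forall q, 0 <= g q) ->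
  (\int[leb2]_(q in closed_disc r) (g q)%:E =
   \int[mu]_(y in `[0%R, r]) \int[mu]_(x in `[0%R, (Num.sqrt (r ^+ 2 - y ^+ 2))%R])
     (sym2 g (x, y))%:E)%E.
Proof.
move=> r0 cg g0; apply: (etrans (integral_closed_disc r0 cg g0)).
pose Q := [set q : R * R | [/\ 0 <= q.1, 0 <= q.2 & q.1 ^+ 2 + q.2 ^+ 2 <= r ^+ 2]].
have mQ : @measurable _ (mR * mR)%type Q := measurable_quarter_disc 0 (r ^+ 2).
pose c (x : R) := Num.sqrt (r ^+ 2 - x ^+ 2).
have QE x y : Q (x, y) <-> `[0, r]%classic x /\ `[0, c x]%classic y.
  by rewrite /= !in_itv/=; split=> /(quarter_discE _ _ (ltW r0)).
have QE' x y : Q (x, y) <-> `[0, r]%classic y /\ `[0, c y]%classic x.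
  rewrite /= !in_itv/=; split=> [[a b d]|/(quarter_discE _ _ (ltW r0))[a b d]].
    by apply/(quarter_discE _ _ (ltW r0)); split=> //; rewrite addrC.
  by split=> //; rewrite addrC.
apply: (@tonelli_region _ Q (sym2 g) _ _ _ _ mQ _ _ QE QE').
  exact: sym2_continuous.
by move=> q _; rewrite /sym2 !addr_ge0.
Qed.

Definition angles : set (R * R) := `[0, pi] `*` `[0, pi *+ 2].

Definition sphere_density r h (a : R * R) : R :=
  r ^+ 2 * sin a.1 * h (sphere r a).

Lemma sphere_density_continuous r h : continuous h ->
  continuous (sphere_density r h).
Proof. by move=> ch; rewrite /sphere_density /sphere; cont. Qed.

(** Folding the azimuth from a full turn, and the polar angle from a half turn, to a right angle
    yields the eight sign changes of [sym3]; then [z = r cos theta] turns [r dz dt] into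
    [r^2 sin theta dtheta dt], the density of the boundary norms. *)
Lemma oct_sym3 r h : 0 < r -> continuous h -> (forall x, 0 <= h x) ->
  (oct r (sym3 h) = \int[leb2]_(a in angles) (sphere_density r h a)%:E)%E.
Proof.
move=> r0 ch h0.
(* With [|sin|] in place of [sin] the density is nonnegative for all angles, as the folding lemmas
   require; the two agree on [angles]. *)
pose k (a : R * R) : R := r ^+ 2 * `|sin a.1| * h (sphere r a).
have ck : continuous k by rewrite /k /sphere; cont.
have k0 a : 0 <= k a by rewrite /k; do 2 apply: mulr_ge0 => //; exact: sqr_ge0.
have mA : @measurable _ (mR * mR)%type angles by apply: measurableX.
have -> : (\int[leb2]_(a in angles) (sphere_density r h a)%:E =
    \int[leb2]_(a in angles) (k a)%:E)%E.
  apply: eq_integral => a; rewrite inE => -[/=]; rewrite in_itv/= => ap _.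
  by rewrite /sphere_density /k ger0_norm// sin_ge0_pi.
have AE x y : angles (x, y) <-> `[0, pi]%classic x /\ `[0, pi *+ 2]%classic y by [].
rewrite -(@region_leb2 _ angles k _ _ mA ck (fun q _ => k0 q) AE).
pose k4 (a : R * R) : R := k a + k (a.1, pi + a.2) +
  (k (a.1, pi - a.2) + k (a.1, pi + (pi - a.2))).
have ck4 : continuous k4 by rewrite /k4; cont.
have k40 a : 0 <= k4 a by rewrite !addr_ge0.
have -> : (\int[mu]_(x in `[0%R, pi]) \int[mu]_(y in `[0%R, (pi *+ 2)%R]) (k (x, y))%:E =
  \int[mu]_(x in `[0%R, pi]) \int[mu]_(y in `[0%R, (pi / 2)%R]) (k4 (x, y))%:E)%E.
  by apply: eq_integral => x _; apply: (@fold_2pi (fun y => k (x, y))) => //; cont.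
pose B : set (R * R) := `[0, pi] `*` `[0, pi / 2].
have mB : @measurable _ (mR * mR)%type B by apply: measurableX.
have BE x y : B (x, y) <-> `[0, pi]%classic x /\ `[0, pi / 2]%classic y by [].
have BE' x y : B (x, y) <-> `[0, pi / 2]%classic y /\ `[0, pi]%classic x.
  by split=> -[].
rewrite (@tonelli_region _ B k4 _ _ _ _ mB ck4 (fun q _ => k40 q) BE BE').
pose C : set (R * R) := `[0, r] `*` `[0, pi / 2].
have mC : @measurable _ (mR * mR)%type C by apply: measurableX.
have CE x y : C (x, y) <-> `[0, r]%classic x /\ `[0, pi / 2]%classic y by [].
have CE' x y : C (x, y) <-> `[0, pi / 2]%classic y /\ `[0, r]%classic x.
  by split=> -[].
have cs := sym3_continuous ch; have s0 := sym3_ge0 h0.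
have co := @oct_integrand_continuous _ r (sym3 h) cs.
have o0 q : 0 <= oct_integrand r (sym3 h) q by rewrite /oct_integrand mulr_ge0// ltW.
rewrite /oct (@tonelli_region _ C (oct_integrand r (sym3 h)) _ _ _ _ mC co
  (fun q _ => o0 q) CE CE').
apply: eq_integral => t _.
have ck4t : continuous (fun x => k4 (x, t)) by cont.
rewrite (fold_pi ck4t (fun x => k40 (x, t))).
have cot : continuous (fun x => oct_integrand r (sym3 h) (x, t)) by cont.
rewrite (subst_cos r0 cot); apply: eq_integral => a; rewrite inE/= in_itv/= => ap.
congr (_%:E); rewrite /oct_integrand/= (sqrt_sin (ltW r0) ap).
have sa := sin_ge0_quarter ap.
have spD b : sin (pi + b) = - sin b :> R by rewrite addrC sinDpi.
have cpD b : cos (pi + b) = - cos b :> R by rewrite addrC cosDpi.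
rewrite /k4 /k /sphere/= !(spD, cpD, sinN, cosN, opprK) (ger0_norm sa).
rewrite /sym3 /sym2/= ?(mulrN, mulNr, opprK).
by ring.
Qed.

Definition sphere_int r h : R := \int[leb2]_(a in angles) sphere_density r h a.

Lemma measurable_angles : @measurable _ (mR * mR)%type angles.
Proof. exact: measurableX. Qed.

Lemma leb2_angles : (leb2 angles < +oo)%E.
Proof.
rewrite /leb2 /angles product_measure1E//=.
rewrite !lebesgue_measure_itv/=.
by do 2 case: ifPn => _; rewrite ?mule0 ?mul0e// -?EFinD -?EFinM ltry.
Qed.

Lemma angles_compact : compact angles.
Proof. by apply: compact_setX; exact: segment_compact. Qed.

Lemma integrable_angles (g : R * R -> R) : continuous g ->
  leb2.-integrable angles (EFin \o g).
Proof.
move=> cg; have [M M0 HM] := continuous_bounded angles_compact cg.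
apply: (bounded_integrable (M := M)) => //.
- exact: measurable_angles.
- exact: leb2_angles.
- by apply: measurable_funS (continuous_measurable2 cg).
Qed.

Lemma sphere_intE r h : continuous h ->
  ((sphere_int r h)%:E = \int[leb2]_(a in angles) (sphere_density r h a)%:E)%E.
Proof.
move=> ch; rewrite /sphere_int /Rintegral fineK//.
apply: integrable_fin_num; first exact: measurable_angles.
by apply: integrable_angles; exact: sphere_density_continuous.
Qed.

End SphereIntegral.

(** * The divergence theorem as an inequality *)

Section BoundaryBounds.
Context {R : realType}.
Local Notation mR := (measurableTypeR R).
Local Notation mu := (@lebesgue_measure R).
Implicit Types (r : R) (F G : space3 R -> R).

Lemma leb2_closed_disc r : 0 < r -> (leb2 (closed_disc r) < +oo)%E.
Proof.
move=> r0; pose sq : set (R * R) := `[- r, r] `*` `[- r, r].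
have msq : @measurable _ (mR * mR)%type sq by apply: measurableX.
apply: (@le_lt_trans _ _ (leb2 sq)).
  apply: le_measure; rewrite ?inE//; first exact: measurable_closed_disc.
  move=> [x y] /(half_disc_sectionE _ _ (ltW r0))[xr yr].
  split; rewrite /= in_itv//=; apply: sqr_le_norm; first exact: ltW.
  have : x ^+ 2 + y ^+ 2 <= r ^+ 2 by apply/(half_disc_sectionE _ _ (ltW r0)).
  by have := sqr_ge0 x; lra.
rewrite /leb2 /sq product_measure1E//= lebesgue_measure_itv/=.
by case: ifPn => _; rewrite ?mule0// -!EFinD -!EFinM ltry.
Qed.

Lemma disc_subset r : disc r `<=` closed_disc r.
Proof. by move=> q /ltW. Qed.

Lemma leb2_disc r : 0 < r -> (leb2 (disc r) < +oo)%E.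
Proof.
move=> r0; apply: le_lt_trans (leb2_closed_disc r0).
apply: le_measure; rewrite ?inE; [exact: measurable_disc|
  exact: measurable_closed_disc|exact: disc_subset].
Qed.

Lemma integrable_disc r (g : R * R -> R) : 0 < r -> continuous g ->
  leb2.-integrable (disc r) (EFin \o g).
Proof.
move=> r0 cg; pose sq : set (R * R) := `[- r, r] `*` `[- r, r].
have csq : compact sq by apply: compact_setX; exact: segment_compact.
have [M M0 HM] := continuous_bounded csq cg.
apply: (bounded_integrable (M := M)) => //.
- exact: measurable_disc.
- exact: leb2_disc.
- by apply: measurable_funS (continuous_measurable2 cg).
- move=> [x y] /ltW/= H; apply: HM.
  have x2 := sqr_ge0 x; have y2 := sqr_ge0 y.
  by split; rewrite /= in_itv//=; apply: sqr_le_norm; rewrite ?(ltW r0)//; lra.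
Qed.

Lemma bdry3_le r F g : 0 < r -> continuous F -> continuous g ->
  (forall q, `|F (q, cap r q) - F (q, - cap r q)| <= g q) ->
  ((`|bdry3 r F|)%:E <= \int[leb2]_(q in closed_disc r) (g q)%:E)%E.
Proof.
move=> r0 cF cg Fg; rewrite /bdry3.
have mD := measurable_disc r.
pose k (q : R * R) := F (q, cap r q) - F (q, - cap r q).
have ck : continuous k by rewrite /k /cap; cont.
have ik := integrable_disc r0 ck.
have inorm : leb2.-integrable (disc r) (EFin \o (fun q => `|k q|)).
  by apply: integrable_disc => //; cont.
have g0 q : 0 <= g q by apply: le_trans (Fg q).
have mg (D : set (R * R)) : @measurable _ (mR * mR)%type D ->
    measurable_fun (D : set (mR * mR)) (EFin \o g).
  by move=> mD'; exact: measurable_region.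
apply: (@le_trans _ _ (\int[leb2]_(q in disc r) (`|k q|)%:E)%E).
  have := @le_normr_Rintegral _ _ _ leb2 (disc r) k mD ik.
  rewrite -lee_fin => /le_trans; apply; rewrite /Rintegral fineK//.
  exact: integrable_fin_num inorm.
apply: (@le_trans _ _ (\int[leb2]_(q in disc r) (g q)%:E)%E).
  apply: ge0_le_integral => //.
  - by move/integrableP: inorm => [].
  - exact: mg.
  - by move=> q _; rewrite lee_fin; exact: Fg.
apply: ge0_subset_integral => //.
- exact: measurable_closed_disc.
- by apply: mg; exact: measurable_closed_disc.
- by move=> q _; rewrite lee_fin.
- exact: disc_subset.
Qed.

Lemma cap_even r (x y : R) : cap r (- x, y) = cap r (x, y).
Proof. by rewrite /cap/= sqrrN. Qed.

Lemma cap_even2 r (x y : R) : cap r (x, - y) = cap r (x, y).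
Proof. by rewrite /cap/= sqrrN. Qed.

Lemma cap_sym r (x y : R) : cap r (x, y) = cap r (y, x).
Proof. by rewrite /cap/= addrAC. Qed.

(** The values of [|F|] on the two caps, folded on the quarter disc, add up to [sym3] on the octant;
    [oct_chart3] expresses that the third component of the normal is at most one. *)
Lemma bdry3_sphere r F : 0 < r -> continuous F ->
  `|bdry3 r F| <= sphere_int r (fun x => `|F x|).
Proof.
move=> r0 cF; pose h x := `|F x|.
have ch : continuous h by rewrite /h; cont.
have h0 x : 0 <= h x by exact: normr_ge0.
rewrite -lee_fin sphere_intE// -oct_sym3//.
pose g q := h (q, cap r q) + h (q, - cap r q).
have cg : continuous g by rewrite /g /cap; cont.
have g0 q : 0 <= g q by rewrite addr_ge0.
apply: (@le_trans _ _ (\int[leb2]_(q in closed_disc r) (g q)%:E)%E).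
  by apply: bdry3_le => // q; exact: ler_normB.
rewrite (integral_closed_disc_swap r0 cg g0).
apply: le_trans (oct_chart3 r0 (sym3_continuous ch) (sym3_ge0 h0)).
rewrite le_eqVlt; apply/orP; left; apply/eqP.
apply: eq_integral => y _; apply: eq_integral => x _; congr (_%:E).
by rewrite /sym3 /sym2 /g/= !(cap_even, cap_even2).
Qed.

(** Composition with [swap13] makes the first axis vertical, so that the relevant graph chart is
    [oct_chart1]. *)
Lemma bdry3_swap13_sphere r F : 0 < r -> continuous F ->
  `|bdry3 r (F \o swap13)| <= sphere_int r (fun x => `|F x|).
Proof.
move=> r0 cF; pose h x := `|F x|.
have ch : continuous h by rewrite /h; cont.
have h0 x : 0 <= h x by exact: normr_ge0.
rewrite -lee_fin sphere_intE// -oct_sym3//.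
pose g q := h (swap13 (q, cap r q)) + h (swap13 (q, - cap r q)).
have cg : continuous g by rewrite /g /swap13 /cap/=; cont.
have g0 q : 0 <= g q by rewrite addr_ge0.
apply: (@le_trans _ _ (\int[leb2]_(q in closed_disc r) (g q)%:E)%E).
  apply: bdry3_le => //; last by move=> q; exact: ler_normB.
  by rewrite /swap13 /comp; cont.
rewrite (integral_closed_disc r0 cg g0).
apply: le_trans (oct_chart1 r0 (sym3_continuous ch) (sym3_ge0 h0)).
rewrite le_eqVlt; apply/orP; left; apply/eqP.
apply: eq_integral => y _; apply: eq_integral => x _; congr (_%:E).
rewrite /sym3 /sym2 /g /swap13/= !(cap_even, cap_even2) (cap_sym r x y).
by ring.
Qed.

Lemma bdry3_swap23_sphere r F : 0 < r -> continuous F ->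
  `|bdry3 r (F \o swap23)| <= sphere_int r (fun x => `|F x|).
Proof.
move=> r0 cF; pose h x := `|F x|.
have ch : continuous h by rewrite /h; cont.
have h0 x : 0 <= h x by exact: normr_ge0.
rewrite -lee_fin sphere_intE// -oct_sym3//.
pose g q := h (swap23 (q, cap r q)) + h (swap23 (q, - cap r q)).
have cg : continuous g by rewrite /g /swap23 /cap/=; cont.
have g0 q : 0 <= g q by rewrite addr_ge0.
apply: (@le_trans _ _ (\int[leb2]_(q in closed_disc r) (g q)%:E)%E).
  apply: bdry3_le => //; last by move=> q; exact: ler_normB.
  by rewrite /swap23 /comp; cont.
rewrite (integral_closed_disc_swap r0 cg g0).
apply: le_trans (oct_chart2 r0 (sym3_continuous ch) (sym3_ge0 h0)).
rewrite le_eqVlt; apply/orP; left; apply/eqP.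
apply: eq_integral => y _; apply: eq_integral => x _; congr (_%:E).
rewrite /sym3 /sym2 /g /swap23/= !(cap_even, cap_even2).
by ring.
Qed.

Lemma is_derive_lin_comp (s : space3 R -> space3 R) F (x v w : space3 R) (a : R) :
  (forall u : R, s (x + u *: v) = s x + u *: w) ->
  is_derive (s x) w F a -> is_derive x v (F \o s) a.
Proof.
move=> sv dF; apply: is_derive_ofline.
under eq_fun do rewrite /= sv.
by apply: is_derive_line; rewrite scale0r addr0.
Qed.

(** For the third axis, [integral_derive3] followed by [bdry3_sphere]. The other axes are made
    vertical by an exchange of coordinates, which leaves the integral over the ball unchanged and
    the boundary term under the same bound. *)
Lemma integral_derive_le r F G (i : 'I_3) : 0 < r ->
  continuous F -> continuous G ->
  (forall x, Ball r x -> is_derive x (basis3 i) F (G x)) ->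
  `|\int[leb3]_(x in Ball r) G x| <= sphere_int r (fun x => `|F x|).
Proof.
move=> r0 cF cG dF.
have mG := continuous_measurable3 cG.
have Bs (s : space3 R -> space3 R) x : (forall x, enorm (s x) = enorm x) ->
    Ball r x -> Ball r (s x) by rewrite /Ball/= => ->.
have s0 u a b c : swap13 ((a, b, c) + u *: basis3 ord_max) =
    swap13 (a, b, c) + u *: basis3 ord0 :> space3 R.
  by rewrite basis3E2 /swap13 /basis3/= !addscale3/=.
have s1 u a b c : swap23 ((a, b, c) + u *: basis3 ord_max) =
    swap23 (a, b, c) + u *: basis3 (Ordinal (isT : (1 < 3)%N)) :> space3 R.
  by rewrite basis3E2 /swap23 /basis3/= !addscale3/=.
case: i dF => [[|[|[|//]]] i3] dF.
- rewrite -(Rintegral_swap (s := swap13) r mG (@measurable_swap13 R)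
    (@ge0_integral_swap13 R) (@enorm_swap13 R)).
  have cF' : continuous (F \o swap13) by rewrite /swap13 /comp; cont.
  have cG' : continuous (G \o swap13) by rewrite /swap13 /comp; cont.
  have dF' x : Ball r x ->
      is_derive x (basis3 ord_max) (F \o swap13) ((G \o swap13) x).
    case: x => -[a b] c Bx; apply: (is_derive_lin_comp (fun u => s0 u a b c)).
    rewrite (_ : ord0 = Ordinal i3); last exact: val_inj.
    by apply: dF; apply: Bs Bx; exact: enorm_swap13.
  have -> := integral_derive3 r0 cF' cG' dF'.
  exact: bdry3_swap13_sphere.
- rewrite -(Rintegral_swap (s := swap23) r mG (@measurable_swap23 R)
    (@ge0_integral_swap23 R) (@enorm_swap23 R)).
  have cF' : continuous (F \o swap23) by rewrite /swap23 /comp; cont.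
  have cG' : continuous (G \o swap23) by rewrite /swap23 /comp; cont.
  have dF' x : Ball r x ->
      is_derive x (basis3 ord_max) (F \o swap23) ((G \o swap23) x).
    case: x => -[a b] c Bx; apply: (is_derive_lin_comp (fun u => s1 u a b c)).
    rewrite (_ : Ordinal _ = Ordinal i3); last exact: val_inj.
    by apply: dF; apply: Bs Bx; exact: enorm_swap23.
  have -> := integral_derive3 r0 cF' cG' dF'.
  exact: bdry3_swap23_sphere.
- have dF' x : Ball r x -> is_derive x (basis3 ord_max) F (G x).
    rewrite (_ : ord_max = Ordinal i3); last exact: val_inj.
    exact: dF.
  have -> := integral_derive3 r0 cF cG dF'.
  exact: bdry3_sphere.
Qed.

End BoundaryBounds.

(** * Time derivatives of integrals over the ball *)

Section TimeDependence.
Context {R : realType}.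
Local Notation mR := (measurableTypeR R).
Implicit Types (r t : R) (f g : spacetime R -> R).

(** Dominated convergence, a constant being integrable on a set of finite measure. *)
Lemma continuous_param d (Y : measurableType d)
    (nu : {measure set Y -> \bar R}) (B : set Y) (f : R -> Y -> R) (u v M : R) :
  measurable B -> (nu B < +oo)%E ->
  (forall t, u < t < v -> measurable_fun B (f t)) ->
  (forall y t, B y -> u < t < v -> {for t, continuous (fun s => f s y)}) ->
  (forall y t, B y -> u < t < v -> `|f t y| <= M) ->
  forall t, u < t < v -> {for t, continuous (fun s => \int[nu]_(y in B) f s y)}.
Proof.
move=> mB Boo mf cf fM t tuv.
apply: (@continuity_under_integral _ _ _ nu f B mB u v _ _ (fun=> M)).
- move=> s; rewrite /= in_itv/= => suv; apply: (bounded_integrable (M := M)) => //.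
  + exact: mf.
  + by move=> y By; exact: fM.
- by apply: aeW => y By s; rewrite inE/= in_itv/= => suv; exact: cf.
- apply: (bounded_integrable (M := `|M|)) => //.
- move=> s; rewrite /= in_itv/= => suv; apply: aeW => y By; exact: fM.
- by rewrite inE/= in_itv.
Qed.

(** The derivative is a separate function [f'] and the relation is asserted in the open cylinder
    only: both functions will be continuous on the whole space-time, while nothing is known of
    derivatives on the boundary or at time zero. *)
Definition td r f f' := forall p : spacetime R, cyl r p -> is_derive p dt f (f' p).

Definition sd r (i : 'I_3) f f' :=
  forall p : spacetime R, cyl r p -> is_derive p (dx i) f (f' p).

Lemma sd_slice r i f f' t : sd r i f f' -> 0 < t -> forall x, Ball r x ->
  is_derive x (basis3 i) (fun x => f (x, t)) (f' (x, t)).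
Proof.
move=> sf t0 x Bx; apply: is_derive_ofline.
have E u : (x + u *: basis3 i, t) = (x, t) + u *: dx i :> spacetime R.
  by apply/eqP; rewrite xpair_eqE eqxx/= scaler0 addr0.
under eq_fun do rewrite E.
by apply: is_derive_line; rewrite scale0r addr0; apply: sf.
Qed.

Lemma td_slice r f f' t : td r f f' -> 0 < t -> forall x, Ball r x ->
  is_derive t (1 : R) (fun s => f (x, s)) (f' (x, t)).
Proof.
move=> tf t0 x Bx.
have E s : (x, s) = (x, 0) + s *: dt :> spacetime R.
  transitivity ((x + s *: (0 : space3 R), 0 + s * 1) : spacetime R) => //.
  by rewrite scaler0 addr0 add0r mulr1.
under eq_fun do rewrite E.
by apply: is_derive_line; rewrite -E; apply: tf.
Qed.

Lemma enorm_scale (s : R) (x : space3 R) : 0 <= s -> enorm (s *: x) = s * enorm x.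
Proof.
move=> s0; case: x => -[a b] c; rewrite /enorm/=.
rewrite (_ : _ + _ + _ = s ^+ 2 * (a ^+ 2 + b ^+ 2 + c ^+ 2)).
  by rewrite sqrtrM ?sqr_ge0// sqrtr_sqr ger0_norm.
by rewrite /GRing.scale/=; ring.
Qed.

(** A point of the closed ball is the limit of its multiples by [s < 1], which lie in the open
    ball. *)
Lemma Ball_closed_near r (phi psi : space3 R -> R) (x : space3 R) : 0 < r ->
  continuous phi -> continuous psi -> enorm x <= r ->
  (\forall y \near x, Ball r y -> phi y <= psi y) -> phi x <= psi x.
Proof.
move=> r0 cphi cpsi xr H.
pose sx (s : R) : space3 R := (s * x.1.1, s * x.1.2, s * x.2).
have csx : continuous sx by rewrite /sx; cont.
have sx1 : sx 1 = x by rewrite /sx !mul1r; case: x {xr sx csx H} => -[].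
have c0 : sx s @[s --> (1 : R)^'-] --> sx 1.
  by apply: cvg_at_left_filter; apply: csx.
have c1 : phi (sx s) @[s --> (1 : R)^'-] --> phi (sx 1).
  by apply: cvg_at_left_filter; apply: (continuous_compose cphi csx).
have c2 : psi (sx s) @[s --> (1 : R)^'-] --> psi (sx 1).
  by apply: cvg_at_left_filter; apply: (continuous_compose cpsi csx).
rewrite -sx1 in H *.
apply: (ler_cvg_to c1 c2); near=> s.
suff Bs : Ball r (sx s) by move: Bs; near: s; exact: (c0 _ H).
rewrite /Ball/=.
have s0 : 0 < s by near: s; apply: nbhs_left_gt.
have s1 : s < 1 by near: s; apply: nbhs_left_lt.
have := enorm_scale x (ltW s0); rewrite (_ : s *: x = sx s); last first.
  by rewrite /sx; case: (x) => -[].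
move=> ->; apply: (@le_lt_trans _ _ (s * r)); first by rewrite ler_pM2l.
by rewrite gtr_pMl.
Unshelve. all: end_near. Qed.

Lemma Ball_closed_le r (phi psi : space3 R -> R) : 0 < r ->
  continuous phi -> continuous psi ->
  (forall x, Ball r x -> phi x <= psi x) ->
  forall x, enorm x <= r -> phi x <= psi x.
Proof.
move=> r0 cphi cpsi H x xr; apply: (Ball_closed_near r0 cphi cpsi xr).
by near=> y; exact: H.
Unshelve. all: end_near. Qed.

(** A difference quotient in time, completed at [h = 0] by the derivative so that it is continuous
    there. *)
Definition dq f f' t (h : R) (x : space3 R) : R :=
  if h == 0 then f' (x, t) else h^-1 * (f (x, t + h) - f (x, t)).

Lemma dq_continuous f f' t h : continuous f -> continuous f' ->
  continuous (dq f f' t h).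
Proof. by move=> cf cf'; rewrite /dq; case: eqP => _; cont. Qed.

Lemma dq_MVT r f f' t h x : continuous f -> td r f f' -> Ball r x ->
  0 < t -> `|h| < t / 2 ->
  exists2 c, `|c| <= `|h| & dq f f' t h x = f' (x, t + c).
Proof.
move=> cf tf Bx t0 ht; rewrite /dq; case: eqP => [h0|/eqP h0].
  by exists 0; rewrite ?normr0 ?addr0.
have [hn1 hn2] : - (t / 2) < h /\ h < t / 2 by move: ht; rewrite ltr_norml => /andP.
have cfx : continuous (fun s => f (x, s)) by cont.
have df (s : R) : 0 < s -> is_derive s (1 : R) (fun s => f (x, s)) (f' (x, s)).
  by move=> s0; exact: td_slice tf s0 x Bx.
have [hp|hp|h00] := ltgtP h 0; last by rewrite h00 eqxx in h0.
- have [|s||c] := @MVT _ (fun s => f (x, s)) (fun s => f' (x, s)) (t + h) t; first by lra.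
  + by rewrite in_itv/= => /andP[s1 s2]; apply: df; lra.
  + exact: continuous_subspaceT.
  rewrite in_itv/= => /andP[c1 c2] E; exists (c - t).
    by rewrite ltr0_norm ?ltr0_norm//; lra.
  rewrite [t + (c - t)]addrC subrK -[f (x, t + h) - _]opprB E.
  by field.
- have [|s||c] := @MVT _ (fun s => f (x, s)) (fun s => f' (x, s)) t (t + h); first by lra.
  + by rewrite in_itv/= => /andP[s1 s2]; apply: df; lra.
  + exact: continuous_subspaceT.
  rewrite in_itv/= => /andP[c1 c2] E; exists (c - t).
    by rewrite gtr0_norm ?gtr0_norm//; lra.
  rewrite [t + (c - t)]addrC subrK E.
  by field.
Qed.

(** Contains the points [(x, t + c)] with [|c| < t / 2] where the mean value theorem evaluates
    [f']. *)
Definition tube r t : set (spacetime R) := cube r `*` `[t / 2, 2 * t].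

Lemma tube_compact r t : compact (tube r t).
Proof. by apply: compact_setX; [exact: cube_compact|exact: segment_compact]. Qed.

(** The mean value theorem applies in the open ball only and the bound passes to the sphere by
    continuity in [x]. Points of the sphere matter because [cross_derive] contains fluxes of
    difference quotients. *)
Lemma dq_bounded r f f' t : 0 < r -> 0 < t -> continuous f -> continuous f' ->
  td r f f' ->
  exists2 M, 0 <= M & forall h x, enorm x <= r -> `|h| < t / 2 ->
    `|dq f f' t h x| <= M.
Proof.
move=> r0 t0 cf cf' tf.
have [M M0 HM] := continuous_bounded (@tube_compact r t) cf'.
exists M => // h x xr ht.
have cd := @dq_continuous f f' t h cf cf'.
apply: (@Ball_closed_le r (fun x => `|dq f f' t h x|) (fun=> M)) => //.
- by cont.
- by cont.
- move=> {xr}x Bx; have [c ch ->] := dq_MVT cf tf Bx t0 ht.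
  apply: HM; split; first exact: Ball_cube.
  have := le_lt_trans ch ht; rewrite ltr_norml => /andP[c1 c2].
  by rewrite /= in_itv/=; apply/andP; split; lra.
Qed.

(** On the sphere the estimate is a limit of estimates at inner points near [x]; the neighbourhoods
    taken from the continuity of [f'] at [(x, t)] do not depend on [h]. *)
Lemma dq_cvg0 r f f' t x : 0 < r -> 0 < t -> continuous f -> continuous f' ->
  td r f f' -> enorm x <= r -> {for 0, continuous (fun h => dq f f' t h x)}.
Proof.
move=> r0 t0 cf cf' tf xr; apply/cvgrPdist_le => e e0.
have /cvgrPdist_le/(_ _ e0) := cf' (x, t).
move=> -[[A B]/= [nA nB] AB].
have /nbhs_ballP[d /= d0 dB] := nB.
rewrite [dq _ _ _ 0 _]/dq eqxx.
have d2 : 0 < Num.min (t / 2) d by rewrite lt_min d0 divr_gt0.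
near=> h.
have hd : `|h| < Num.min (t / 2) d.
  near: h; have := @nbhs0_lt R R _ d2; apply: filterS => h; exact: id.
have [ht hd'] : `|h| < t / 2 /\ `|h| < d by move: hd; rewrite lt_min => /andP.
have cd := @dq_continuous f f' t h cf cf'.
apply: (@Ball_closed_near r (fun y => `|f' (x, t) - dq f f' t h y|) (fun=> e)) => //.
- by cont.
- by cont.
- apply: filterS nA => y Ay By; have [c ch ->] := dq_MVT cf tf By t0 ht.
  apply: (AB (y, t + c)); split => //=; apply: dB.
  rewrite /ball/= opprD addrA subrr sub0r normrN.
  exact: le_lt_trans ch hd'.
Unshelve. all: end_near. Qed.

Lemma dq_continuous_h r f f' t h x : 0 < r -> 0 < t -> continuous f ->
  continuous f' -> td r f f' -> enorm x <= r ->
  {for h, continuous (fun h => dq f f' t h x)}.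
Proof.
move=> r0 t0 cf cf' tf xr; have [->|h0] := eqVneq h 0; first exact: dq_cvg0 tf xr.
pose g (h : R) := h^-1 * (f (x, t + h) - f (x, t)).
have gh : {for h, continuous g}.
  apply: cvgM; first by apply: cvgV => //; exact: cvg_id.
  have cg : continuous (fun h => f (x, t + h) - f (x, t)) by cont.
  exact: cg.
have E : dq f f' t h x = g h by rewrite /dq (negbTE h0).
rewrite /prop_for /continuous_at E; apply: cvg_trans gh.
apply: near_eq_cvg; near=> y; rewrite /dq ifF//; apply/negbTE.
by near: y; exact: (cvgr_neq0 h).
Unshelve. all: end_near. Qed.

End TimeDependence.

(** * Differentiation of integrals in time *)

Section DerivativesOfIntegrals.
Context {R : realType}.
Local Notation mR := (measurableTypeR R).
Variables (r : R) (r0 : 0 < r).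
Implicit Types (t : R) (f g : spacetime R -> R).

Definition ball_int (g : space3 R -> R) : R := \int[leb3]_(x in Ball r) g x.

Lemma ball_intD (g1 g2 : space3 R -> R) : continuous g1 -> continuous g2 ->
  ball_int (fun x => g1 x + g2 x) = ball_int g1 + ball_int g2.
Proof.
move=> c1 c2; apply: RintegralD; [exact: measurable_Ball|..].
  exact: integrable_Ball.
exact: integrable_Ball.
Qed.

Lemma ball_intZ (c : R) (g : space3 R -> R) : continuous g ->
  ball_int (fun x => c * g x) = c * ball_int g.
Proof.
by move=> cg; apply: RintegralZl; [exact: measurable_Ball|exact: integrable_Ball].
Qed.

Lemma ball_intB (g1 g2 : space3 R -> R) : continuous g1 -> continuous g2 ->
  ball_int (fun x => g1 x - g2 x) = ball_int g1 - ball_int g2.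
Proof.
move=> c1 c2; apply: RintegralB; [exact: measurable_Ball|..].
  exact: integrable_Ball.
exact: integrable_Ball.
Qed.

Lemma le_ball_int (g1 g2 : space3 R -> R) : continuous g1 -> continuous g2 ->
  (forall x, Ball r x -> g1 x <= g2 x) -> ball_int g1 <= ball_int g2.
Proof.
move=> c1 c2 H; apply: le_Rintegral => //.
- exact: measurable_Ball.
- exact: integrable_Ball.
- exact: integrable_Ball.
Qed.

Lemma eq_ball_int (g1 g2 : space3 R -> R) :
  (forall x, Ball r x -> g1 x = g2 x) -> ball_int g1 = ball_int g2.
Proof. by move=> H; apply: eq_Rintegral => x; rewrite inE => /H. Qed.

Lemma measurable_fun_Ball (g : space3 R -> R) : continuous g ->
  measurable_fun (Ball r : set (mR * mR * mR)) g.
Proof. by move=> cg; apply: measurable_funS (continuous_measurable3 cg). Qed.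

Lemma slab_bounded f t : continuous f ->
  exists M, forall x s, cube r x -> t - 1 < s < t + 1 -> `|f (x, s)| <= M.
Proof.
move=> cf; have ck : compact (cube r `*` `[t - 1, t + 1]).
  by apply: compact_setX; [exact: cube_compact|exact: segment_compact].
have [M M0 HM] := continuous_bounded ck cf.
exists M => x s xc /andP[s1 s2]; apply: HM; split => //=.
by rewrite in_itv/= !ltW.
Qed.

Lemma ball_int_continuous f : continuous f ->
  continuous (fun t => ball_int (fun x => f (x, t))).
Proof.
move=> cf t; have [M HM] := slab_bounded t cf.
apply: (@continuous_param _ _ _ leb3 (Ball r) (fun s x => f (x, s)) (t - 1) (t + 1) M).
- exact: measurable_Ball.
- exact: leb3_Ball.
- by move=> s _; apply: measurable_fun_Ball; cont.
- move=> x s _ _; have cfx : continuous (fun s => f (x, s)) by cont.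
  exact: cfx.
- by move=> x s Bx; apply: HM; exact: Ball_cube.
- by rewrite ltrBlDr !ltrDl ltr01.
Qed.

Lemma sphere_norm (a : R * R) : enorm (sphere r a) = r.
Proof.
rewrite /enorm/= (_ : _ + _ + _ = r ^+ 2 * (sin a.1 ^+ 2 *
  (cos a.2 ^+ 2 + sin a.2 ^+ 2) + cos a.1 ^+ 2)); last by ring.
by rewrite cos2Dsin2 mulr1 addrC cos2Dsin2 mulr1 sqrtr_sqr gtr0_norm.
Qed.

Lemma sphere_int_continuous f : continuous f ->
  continuous (fun t => sphere_int r (fun x => f (x, t))).
Proof.
move=> cf t; have [M HM] := slab_bounded t cf.
apply: (@continuous_param _ _ _ leb2 angles
  (fun s a => sphere_density r (fun x => f (x, s)) a) (t - 1) (t + 1) (r ^+ 2 * M)).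
- exact: measurable_angles.
- exact: leb2_angles.
- move=> s _; apply: measurable_funS (continuous_measurable2 _) => //.
  by apply: sphere_density_continuous; cont.
- move=> a s _ _; rewrite /sphere_density.
  have cfx : continuous (fun s => r ^+ 2 * sin a.1 * f (sphere r a, s)) by cont.
  exact: cfx.
- move=> a s _ st; rewrite /sphere_density -mulrA normrM ger0_norm ?sqr_ge0//.
  rewrite ler_wpM2l ?sqr_ge0// normrM.
  apply: (@le_trans _ _ `|f (sphere r a, s)|).
    by rewrite ler_piMl// ler_norml sin_geN1 sin_le1.
  by apply: HM => //; apply: closed_ball_cube; rewrite ?(ltW r0)// sphere_norm.
- by rewrite ltrBlDr !ltrDl ltr01.
Qed.

Lemma is_derive_quotient (K Phi : R -> R) (t d : R) : 0 < d ->
  (forall h, h != 0 -> `|h| < d -> h^-1 * (K (t + h) - K t) = Phi h) ->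
  {for 0, continuous Phi} -> is_derive t (1 : R) K (Phi 0).
Proof.
move=> d0 KP cP.
have E : h^-1 *: ((K \o shift t) (h *: (1 : R)) - K t) @[h --> 0^'] --> Phi 0.
  have cP' : Phi h @[h --> 0^'] --> Phi 0.
    by apply: cvg_within_filter; exact: cP.
  apply: cvg_trans cP'; apply: near_eq_cvg; near=> h.
  rewrite /= scaler1 [h + t]addrC -KP//.
    by near: h; exact: nbhs_dnbhs_neq.
  near: h; apply: dnbhs0_lt; exact: d0.
by split; [apply/cvg_ex; exists (Phi 0)|apply: cvg_lim].
Unshelve. all: end_near. Qed.

Lemma td_le_half (t h : R) : 0 < t -> `|h| < t / 2 -> 0 < t + h.
Proof. by move=> t0; rewrite ltr_norml => /andP[h1 _]; lra. Qed.

Lemma near0_continuous d (Y : measurableType d) (nu : {measure set Y -> \bar R})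
    (B : set Y) (F : R -> Y -> R) (e M : R) : 0 < e ->
  measurable B -> (nu B < +oo)%E ->
  (forall h, measurable_fun B (F h)) ->
  (forall y h, B y -> `|h| < e -> {for h, continuous (fun s => F s y)}) ->
  (forall y h, B y -> `|h| < e -> `|F h y| <= M) ->
  {for 0, continuous (fun h => \int[nu]_(y in B) F h y)}.
Proof.
move=> e0 mB Boo mF cF FM.
apply: (@continuous_param _ _ _ nu B F (- e) e M) => //.
- by move=> y h By he; apply: cF => //; rewrite ltr_norml.
- by move=> y h By he; apply: FM => //; rewrite ltr_norml.
- by rewrite oppr_lt0 e0.
Qed.

(** Dominated convergence for [dq f f' t], which is bounded and is continuous in [h] up to
    [h = 0]. *)
Lemma ball_int_derive f f' t : continuous f -> continuous f' -> td r f f' -> 0 < t ->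
  is_derive t (1 : R) (fun t => ball_int (fun x => f (x, t)))
    (ball_int (fun x => f' (x, t))).
Proof.
move=> cf cf' tf t0; have t2 : 0 < t / 2 by rewrite divr_gt0.
pose Phi h := ball_int (dq f f' t h).
have -> : ball_int (fun x => f' (x, t)) = Phi 0.
  by rewrite /Phi /dq eqxx.
have cs s : continuous (fun x => f (x, s)) by cont.
apply: (@is_derive_quotient _ Phi _ _ t2).
  move=> h h0 ht; rewrite -ball_intB// -ball_intZ; last by cont.
  by apply: eq_ball_int => x Bx; rewrite /dq (negbTE h0).
have [M M0 HM] := dq_bounded r0 t0 cf cf' tf.
apply: (@near0_continuous _ _ leb3 (Ball r) (dq f f' t) (t / 2) M) => //.
- exact: measurable_Ball.
- exact: leb3_Ball.
- by move=> h; apply: measurable_fun_Ball; exact: dq_continuous.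
- by move=> x h /ltW xr ht; exact: dq_continuous_h tf xr.
- by move=> x h /ltW xr ht; exact: HM.
Qed.

Lemma bdry3_continuous_dq (c : space3 R -> R) f f' t : continuous c ->
  continuous f -> continuous f' -> td r f f' -> 0 < t ->
  {for 0, continuous (fun h => bdry3 r (fun x => c x * dq f f' t h x))}.
Proof.
move=> cc cf cf' tf t0; have t2 : 0 < t / 2 by rewrite divr_gt0.
have [M M0 HM] := dq_bounded r0 t0 cf cf' tf.
have [N N0 HN] := continuous_bounded (@cube_compact _ r) cc.
have cap_norm q (s : R) : disc r q -> s = cap r q \/ s = - cap r q ->
    enorm (q, s) <= r.
  move=> qd sE; rewrite enorm_le ?(ltW r0)//=.
  have -> : s ^+ 2 = cap r q ^+ 2 by case: sE => ->; rewrite ?sqrrN.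
  by rewrite cap_sqr//; lra.
have FM q s h : disc r q -> s = cap r q \/ s = - cap r q -> `|h| < t / 2 ->
    `|c (q, s) * dq f f' t h (q, s)| <= N * M.
  move=> qd sE ht; rewrite normrM ler_pM//; last by apply: HM => //; exact: cap_norm.
  by apply: HN; apply: closed_ball_cube; [exact: ltW|exact: cap_norm].
have Fc q s h : disc r q -> s = cap r q \/ s = - cap r q ->
    {for h, continuous (fun h => c (q, s) * dq f f' t h (q, s))}.
  move=> qd sE; apply: cvgM; first exact: cvg_cst.
  by apply: (dq_continuous_h r0 t0 cf cf' tf); exact: cap_norm.
apply: (@near0_continuous _ _ leb2 (disc r)
  (fun h q => c (q, cap r q) * dq f f' t h (q, cap r q) -
              c (q, - cap r q) * dq f f' t h (q, - cap r q)) (t / 2) (N * M + N * M)) => //.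
- exact: measurable_disc.
- exact: leb2_disc.
- move=> h; have cd := @dq_continuous _ f f' t h cf cf'.
  apply: measurable_funS (continuous_measurable2 _) => //.
  by rewrite /cap; cont.
- move=> q h qd ht; apply: cvgB; apply: Fc => //; by [left|right].
- move=> q h qd ht; apply: (le_trans (ler_normB _ _)).
  by apply: lerD; apply: FM => //; by [left|right].
Qed.

(* [b3] need not be differentiable in time: integrating by parts in space moves
   the difference quotient of [b3] onto [b], at the price of a boundary term. *)
Lemma cross_derive (p p3 a a' a3 b b' b3 : spacetime R -> R) t :
  continuous p -> continuous p3 -> continuous a -> continuous a' ->
  continuous a3 -> continuous b -> continuous b' -> continuous b3 ->
  (forall x s s', p (x, s) = p (x, s')) ->
  sd r ord_max p p3 -> td r a a' -> sd r ord_max a a3 ->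
  td r b b' -> sd r ord_max b b3 -> 0 < t ->
  is_derive t (1 : R) (fun t => ball_int (fun x => p (x, t) * a (x, t) * b3 (x, t)))
    (ball_int (fun x => p (x, t) * a' (x, t) * b3 (x, t))
     + bdry3 r (fun x => p (x, t) * a (x, t) * b' (x, t))
     - ball_int (fun x => (p3 (x, t) * a (x, t) + p (x, t) * a3 (x, t)) * b' (x, t))).
Proof.
move=> cp cp3 ca ca' ca3 cb cb' cb3 pt sp ta sa tb sb t0.
have t2 : 0 < t / 2 by rewrite divr_gt0.
pose q3 x := p3 (x, t) * a (x, t) + p (x, t) * a3 (x, t).
have cq3 : continuous q3 by rewrite /q3; cont.
pose da h x := dq a a' t h x; pose db h x := dq b b' t h x.
have cda h : continuous (da h) by exact: dq_continuous.
have cdb h : continuous (db h) by exact: dq_continuous.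
(* The quotient of [p a b3] is [p da b3(t + h)] plus [p a] times the quotient of [b3]. Since [b3] is
   [d_3 b], the latter equals [d_3 (p a db) - q3 db], which gives the flux [Phi2] and the integral
   [Phi3]; only difference quotients of [a] and [b] are left when [h] tends to zero. *)
pose Phi1 h := ball_int (fun x => p (x, t) * da h x * b3 (x, t + h)).
pose Phi2 h := bdry3 r (fun x => (p (x, t) * a (x, t)) * db h x).
pose Phi3 h := ball_int (fun x => q3 x * db h x).
pose Phi h := Phi1 h + Phi2 h - Phi3 h.
have -> : ball_int (fun x => p (x, t) * a' (x, t) * b3 (x, t))
     + bdry3 r (fun x => p (x, t) * a (x, t) * b' (x, t))
     - ball_int (fun x => (p3 (x, t) * a (x, t) + p (x, t) * a3 (x, t)) * b' (x, t))
   = Phi 0.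
  by rewrite /Phi /Phi1 /Phi2 /Phi3 /da /db /dq eqxx addr0.
apply: (@is_derive_quotient _ Phi _ _ t2).
  move=> h h0 ht; have th0 := td_le_half t0 ht.
  pose G x := q3 x * db h x + p (x, t) * a (x, t) * (h^-1 * (b3 (x, t + h) - b3 (x, t))).
  have cG : continuous G by rewrite /G; cont.
  pose F x := p (x, t) * a (x, t) * db h x.
  have cF : continuous F by rewrite /F; cont.
  have dF x : Ball r x -> is_derive x (basis3 ord_max) F (G x).
    move=> Bx; have dp := sd_slice sp t0 Bx; have dA := sd_slice sa t0 Bx.
    have db1 := sd_slice sb t0 Bx; have db2 := sd_slice sb th0 Bx.
    have ddb : is_derive x (basis3 ord_max) (db h) (h^-1 * (b3 (x, t + h) - b3 (x, t))).
      rewrite /db /dq (negbTE h0).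
      apply: (is_derive_val (is_derive_mul (is_derive_const x (basis3 ord_max) h^-1)
        (is_derive_sub db2 db1))).
      by rewrite mul0r add0r.
    exact: (is_derive_val (is_derive_mul (is_derive_mul dp dA) ddb)).
  have P2 := integral_derive3 r0 cF cG dF.
  rewrite /Phi /Phi2 -/F -P2 -/(ball_int G).
  have -> : ball_int G = Phi3 h + ball_int (fun x => p (x, t) * a (x, t) *
      (h^-1 * (b3 (x, t + h) - b3 (x, t)))).
    by rewrite /G ball_intD//; cont.
  rewrite addrA addrAC addrK /Phi1.
  rewrite -ball_intD; [|by cont|by cont].
  rewrite -ball_intB; [|by cont|by cont].
  rewrite -ball_intZ; last by cont.
  apply: eq_ball_int => x Bx; rewrite /da /dq (negbTE h0) (pt x (t + h) t).
  by ring.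
have [Ma Ma0 HMa] := dq_bounded r0 t0 ca ca' ta.
have [Mb Mb0 HMb] := dq_bounded r0 t0 cb cb' tb.
have cP1 : {for 0, continuous Phi1}.
  have cpt : continuous (fun x => p (x, t)) by cont.
  have [Mp Mp0 HMp] := continuous_bounded (@cube_compact _ r) cpt.
  have [M3 M30 HM3] := continuous_bounded (@tube_compact _ r t) cb3.
  apply: (@near0_continuous _ _ leb3 (Ball r)
    (fun h x => p (x, t) * da h x * b3 (x, t + h)) (t / 2) (Mp * Ma * M3)) => //.
  - exact: measurable_Ball.
  - exact: leb3_Ball.
  - by move=> h; apply: measurable_fun_Ball; cont.
  - move=> x h /ltW xr ht; apply: cvgM; first apply: cvgM.
    + exact: cvg_cst.
    + exact: (dq_continuous_h r0 t0 ca ca' ta xr).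
    + have cb3x : continuous (fun h => b3 (x, t + h)) by cont.
      exact: cb3x.
  - move=> x h Bx ht; rewrite !normrM ler_pM// ?mulr_ge0// ?ler_pM//.
    + by apply: HMp; exact: Ball_cube.
    + by apply: HMa => //; exact: ltW.
    + apply: HM3; split; first exact: Ball_cube.
      move: ht; rewrite ltr_norml => /andP[h1 h2].
      by rewrite /= in_itv/=; apply/andP; split; lra.
have cP2 : {for 0, continuous Phi2}.
  by apply: (bdry3_continuous_dq _ cb cb' tb t0); cont.
have cP3 : {for 0, continuous Phi3}.
  have [Mq Mq0 HMq] := continuous_bounded (@cube_compact _ r) cq3.
  apply: (@near0_continuous _ _ leb3 (Ball r)
    (fun h x => q3 x * db h x) (t / 2) (Mq * Mb)) => //.
  - exact: measurable_Ball.
  - exact: leb3_Ball.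
  - by move=> h; apply: measurable_fun_Ball; cont.
  - move=> x h /ltW xr ht; apply: cvgM; first exact: cvg_cst.
    exact: (dq_continuous_h r0 t0 cb cb' tb xr).
  - move=> x h Bx ht; rewrite !normrM ler_pM//.
    + by apply: HMq; exact: Ball_cube.
    + by apply: HMb => //; exact: ltW.
by apply: cvgB => //; apply: cvgD.
Qed.

End DerivativesOfIntegrals.

(** * The system of differential inequalities *)

Section DifferentialInequalities.
Context {R : realType}.
Local Notation mu := (@lebesgue_measure R).

Lemma ge0_derive_nondecreasing (g g' : R -> R) (T : R) :
  {within `[0, T], continuous g} ->
  (forall t, 0 < t < T -> is_derive t (1 : R) g (g' t)) ->
  (forall t, 0 < t < T -> 0 <= g' t) ->
  forall t, 0 <= t <= T -> g 0 <= g t.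
Proof.
move=> cg dg g0 t /andP[t0 tT].
have T0 : 0 <= T := le_trans t0 tT.
apply: (@ger0_derive1_le_cc _ g 0 T) => //.
- by move=> x; rewrite in_itv/= => /dg[].
- by move=> x; rewrite in_itv/= => xT; rewrite derive1E; have [_ ->] := dg x xT; exact: g0.
- by rewrite in_itv/= lexx.
- by rewrite in_itv/= t0.
Qed.

Definition primitive (b : R -> R) (t : R) : R := \int[mu]_(s in `[0, t]) b s.

Lemma primitive_continuous (b : R -> R) (T : R) : 0 <= T -> continuous b ->
  {within `[0, T], continuous (primitive b)}.
Proof.
move=> T0 cb; apply: parameterized_integral_continuous => //.
apply: continuous_compact_integrable; first exact: segment_compact.
exact: continuous_subspaceT.
Qed.

Lemma primitive_derive (b : R -> R) (t : R) : continuous b -> 0 < t ->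
  is_derive t (1 : R) (primitive b) (b t).
Proof.
move=> cb t0.
have ib : mu.-integrable `[0, t + 1] (EFin \o b).
  apply: continuous_compact_integrable; first exact: segment_compact.
  exact: continuous_subspaceT.
have [||db dE] := @continuous_FTC1_closed _ b 0 t (t + 1) _ ib t0.
- by rewrite ltrDl.
- exact: cb.
- split; first exact: db.
  by rewrite -derive1E; exact: dE.
Qed.

Lemma primitive0 (b : R -> R) : primitive b 0 = 0.
Proof. by rewrite /primitive set_itv1 Rintegral_set1. Qed.

Lemma primitive_le (b : R -> R) (t T : R) : continuous b -> (forall s, 0 <= b s) ->
  0 <= t <= T -> 0 <= primitive b t <= primitive b T.
Proof.
move=> cb b0 /andP[t0 tT]; have T0 := le_trans t0 tT.
have H s : 0 <= s -> 0 <= primitive b s.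
  by move=> s0; apply: Rintegral_ge0 => x _.
rewrite H//=.
have tT' : t \in `[0, T] by rewrite in_itv/= t0.
apply: (@ger0_derive1_le_cc _ (primitive b) 0 T) => //.
- by move=> x; rewrite in_itv/= => /andP[x0 _]; have [] := primitive_derive cb x0.
- move=> x; rewrite in_itv/= => /andP[x0 _]; rewrite derive1E.
  by have [_ ->] := primitive_derive cb x0.
- exact: primitive_continuous.
- by rewrite in_itv/= T0 lexx.
Qed.

Lemma is_derive_expRM (c t : R) :
  is_derive t (1 : R) (fun t => expR (c * t)) (c * expR (c * t)).
Proof.
have d : is_derive t (1 : R) (fun t => c * t) c.
  apply: (is_derive_val (is_derive_mul (is_derive_const t (1 : R) c) (is_derive_id t (1
    : R)))).
  by rewrite mul0r add0r mulr1.
by apply: (is_derive_val (is_derive_chain d (is_derive_expR (c * t)))); rewrite mulrC.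
Qed.

Lemma within_continuous_total (f : R -> R) (A : set R) : continuous f ->
  {within A, continuous f}.
Proof. by move=> cf; exact: continuous_subspaceT. Qed.

(** The combination [y = rho + k H] decouples the system: the condition on [lam3] is what gives
    [y' >= 2 k y] up to boundary terms. Then [H' >= 2 y - 2 (k + sg) H], and integration over
    [[0, T]] is compared with [H <= Z e]. Here [Z] and [c0] play the part of the upper and lower
    bounds of the weight. *)
Lemma observability_ode (T sg K Z k c0 lam3 : R) (e e' H H' rho rho' b : R -> R) :
  0 < T -> 0 <= sg -> 0 <= K -> 1 <= Z -> 1 <= k -> 1 <= c0 ->
  2 * k ^+ 2 + 2 * k * sg <= lam3 ->
  continuous e -> continuous H -> continuous rho -> continuous b ->
  (forall t, 0 <= b t) -> (forall t, 0 <= H t) ->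
  (forall t : R, 0 <= t -> H t <= Z * e t) -> c0 * e 0 <= H 0 -> rho 0 = 0 ->
  (forall t : R, 0 < t -> is_derive t (1 : R) e (e' t)) ->
  (forall t : R, 0 < t -> is_derive t (1 : R) H (H' t)) ->
  (forall t : R, 0 < t -> is_derive t (1 : R) rho (rho' t)) ->
  (forall t : R, 0 < t -> e' t <= K * b t) ->
  (forall t : R, 0 < t -> 2 * rho t - 2 * sg * H t - K * b t <= H' t) ->
  (forall t : R, 0 < t -> lam3 * H t - K * b t <= rho' t) ->
  2 * Z * (1 + 2 * (k + sg) * T) <= (expR (2 * k * T) - 1) * c0 ->
  e 0 <= 2 * expR (2 * k * T) * (K * primitive b T).
Proof.
move=> T0 sg0 K0 Z1 k1 c01 klam ce cH crho cb b0 H0 He eH rho0 de dH drho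
  be bH brho EZ.
pose IB := primitive b; pose B := IB T.
have cIB := primitive_continuous (ltW T0) cb.
have IB0 : IB 0 = 0 := primitive0 b.
have IBle t : 0 <= t <= T -> 0 <= IB t <= B by exact: primitive_le.
have T0T : 0 <= T <= T by rewrite lexx ltW.
have B0 : 0 <= B by have /andP[] := IBle T T0T.
have KB0 : 0 <= K * B by rewrite mulr_ge0.
have k0 : 0 < k by lra.
have dIB (t : R) : 0 < t -> is_derive t (1 : R) IB (b t) by exact: primitive_derive.
have cKIB (c : R) : {within `[0, T], continuous (fun t => c * IB t)}.
  by move=> x; apply: cvgM; [exact: cvg_cst|exact: cIB].
have dKIB (c t : R) : 0 < t -> is_derive t (1 : R) (fun t => c * IB t) (c * b t).
  move=> t0; apply: (is_derive_val (is_derive_mul (is_derive_const t (1 : R) c) (dIB _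
    t0))).
  by rewrite mul0r add0r.
have eB t : 0 <= t <= T -> e t <= e 0 + K * B.
  move=> tT; have /andP[t0 tT'] := tT.
  have := @ge0_derive_nondecreasing (fun t => K * IB t - e t) (fun t => K * b t - e' t) T.
  move=> /(_ _ _ _ t tT); rewrite IB0 mulr0 sub0r => G.
  have : - e 0 <= K * IB t - e t.
    apply: G.
    - move=> x; apply: cvgB; first exact: cKIB.
      exact: (within_continuous_total ce).
    - by move=> s /andP[s0 _]; apply: is_derive_sub; [exact: dKIB|exact: de].
    - by move=> s /andP[s0 _]; rewrite subr_ge0; exact: be.
  have /andP[_ IBB] := IBle t tT.
  by have := ler_wpM2l K0 IBB; lra.
(* Bounds [H] on all of [[0, T]], since the energy can grow through boundary terms only. *)
pose Hm := Z * (e 0 + K * B).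
have HHm t : 0 <= t <= T -> H t <= Hm.
  move=> tT; have /andP[t0 _] := tT; apply: (le_trans (He t t0)).
  by rewrite ler_pM2l ?eB//; lra.
pose y t := rho t + k * H t.
(* The initial value of [y] less the total boundary loss: [K b] from [rho'] and [k K b] from
   [k H']. *)
pose A := k * H 0 - (1 + k) * (K * B).
have yA t : 0 <= t <= T -> expR (2 * k * t) * A <= y t.
  move=> tT; have /andP[t0 tT'] := tT.
  pose g t := expR (- (2 * k) * t) * y t + (1 + k) * K * IB t.
  pose g' t := (- (2 * k) * expR (- (2 * k) * t)) * y t +
    expR (- (2 * k) * t) * (rho' t + k * H' t) + (1 + k) * K * b t.
  have cy : continuous y by rewrite /y; cont.
  have G : g 0 <= g t.
    apply: (@ge0_derive_nondecreasing g g' T _ _ _ t tT).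
    - move=> x; apply: cvgD; last exact: cKIB.
      have ce1 : continuous (fun t => expR (- (2 * k) * t) * y t) by cont.
      exact: (within_continuous_total ce1).
    - move=> s /andP[s0 _]; apply: is_derive_add; last exact: dKIB.
      apply: is_derive_mul; first exact: is_derive_expRM.
      apply: is_derive_add; first exact: drho.
      apply: (is_derive_val (is_derive_mul (is_derive_const s (1 : R) k) (dH _ s0))).
      by rewrite mul0r add0r.
    - move=> s /andP[s0 _].
      have E0 := expR_gt0 (- (2 * k) * s).
      (* The integrating factor is at most one, so it may be dropped from the boundary terms. *)
      have E1 : expR (- (2 * k) * s) <= 1.
        by rewrite -expR0 ler_expR mulNr oppr_le0 !mulr_ge0// ltW.
      rewrite /g'; set E := expR _ in E0 E1 *.
      have y1 : 2 * k * y s - (1 + k) * (K * b s) <= rho' s + k * H' s.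
        have h1 := brho s s0; have h2 := ler_wpM2l (ltW k0) (bH s s0).
        have h3 : (2 * k ^+ 2 + 2 * k * sg) * H s <= lam3 * H s by rewrite ler_wpM2r.
        rewrite /y; lra.
      have h4 := ler_wpM2l (ltW E0) y1.
      have h5 : 0 <= (1 + k) * K * b s * (1 - E) by rewrite !mulr_ge0//; lra.
      lra.
  have g0E : g 0 = k * H 0.
    by rewrite /g mulr0 expR0 IB0 mulr0 addr0 mul1r /y rho0 add0r.
  have EE : expR (2 * k * t) * expR (- (2 * k) * t) = 1.
    by rewrite -expRD mulNr subrr expR0.
  have h1 : expR (2 * k * t) * (k * H 0) <= y t + expR (2 * k * t) * ((1 + k) * K * IB t).
    move: G; rewrite g0E /g => G.
    have := ler_wpM2l (ltW (expR_gt0 (2 * k * t))) G.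
    by rewrite mulrDr [X in _ <= X + _ -> _]mulrA EE mul1r.
  have h2 : expR (2 * k * t) * ((1 + k) * K * IB t) <= expR (2 * k * t) * ((1 + k) * K * B).
    apply: ler_wpM2l; first exact/ltW/expR_gt0.
    by apply: ler_wpM2l; [rewrite mulr_ge0//; lra|have /andP[] := IBle t tT].
  rewrite /A mulrBr; lra.
pose q := 1 + 2 * (k + sg) * T.
(* The inequality for [H'] is multiplied by [k] so that [2 k exp (2 k t)] integrates to
   [exp (2 k T) - 1]; in the term [2 (k + sg) H] the bound [Hm] replaces [H]. *)
have key : A * (expR (2 * k * T) - 1) <= k * (Hm * q + K * B).
  pose g t := k * H t + (- A * expR (2 * k * t) + (k * (2 * (k + sg) * Hm) * t + k * K
    * IB t)).
  pose g' t := k * H' t + (- A * ((2 * k) * expR (2 * k * t)) + (k * (2 * (k + sg) *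
    Hm) + k * K * b t)).
  have G : g 0 <= g T.
    apply: (@ge0_derive_nondecreasing g g' T _ _ _ T T0T).
    - move=> x; apply: cvgD.
        have c1 : continuous (fun t => k * H t) by cont.
        exact: (within_continuous_total c1).
      apply: cvgD.
        have c1 : continuous (fun t => - A * expR (2 * k * t)) by cont.
        exact: (within_continuous_total c1).
      apply: cvgD; last exact: cKIB.
      have c1 : continuous (fun t => k * (2 * (k + sg) * Hm) * t) by cont.
      exact: (within_continuous_total c1).
    - move=> s /andP[s0 _]; apply: is_derive_add.
        apply: (is_derive_val (is_derive_mul (is_derive_const s (1 : R) k) (dH _ s0))).
        by rewrite mul0r add0r.
      apply: is_derive_add.
        apply: (is_derive_val (is_derive_mul (is_derive_const s (1 : R) (- A))
          (is_derive_expRM (2 * k) s))).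
        by rewrite mul0r add0r.
      apply: is_derive_add; last exact: dKIB.
      apply: (is_derive_val (is_derive_mul (is_derive_const s (1 : R) (k * (2 * (k +
        sg) * Hm)))
        (is_derive_id s (1 : R)))).
      by rewrite mul0r add0r mulr1.
    - move=> s /andP[s0 sT]; have sT' : 0 <= s <= T by rewrite !ltW.
      have h1 := bH s s0; have h2 := yA s sT'; have h3 := HHm s sT'.
      have h4 : 2 * y s - 2 * (k + sg) * Hm - K * b s <= H' s.
        have : 2 * (k + sg) * H s <= 2 * (k + sg) * Hm.
          by apply: ler_wpM2l => //; lra.
        rewrite /y; lra.
      have h5 : 2 * (expR (2 * k * s) * A) - 2 * (k + sg) * Hm - K * b s <= H' s by lra.
      have := ler_wpM2l (ltW k0) h5; rewrite /g'; lra.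
  move: G; rewrite /g mulr0 expR0 IB0 !mulr0 !addr0 mulr1 => G.
  have h1 : k * H T <= k * Hm by rewrite ler_pM2l// HHm.
  have h2 : 0 <= k * H 0 by rewrite mulr_ge0// ltW.
  rewrite /q; rewrite -/B in G; lra.
have E1 : 1 <= expR (2 * k * T).
  by rewrite -expR0 ler_expR !mulr_ge0// ltW.
set E := expR (2 * k * T) in EZ key E1 *.
have q1 : 1 <= q by rewrite lerDl !mulr_ge0//; lra.
have Zq1 : 1 <= Z * q by rewrite -[X in X <= _]mulr1 ler_pM.
have e00 : 0 <= e 0.
  have := le_trans (H0 0) (He 0 (lexx 0)); rewrite pmulr_rge0//; lra.
have A1 : k * (c0 * e 0 - 2 * (K * B)) <= A.
  have h1 : k * (c0 * e 0) <= k * H 0 by rewrite ler_pM2l.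
  have h2 : (1 + k) * (K * B) <= 2 * k * (K * B) by rewrite ler_wpM2r//; lra.
  rewrite /A; lra.
have A2 : (c0 * e 0 - 2 * (K * B)) * (E - 1) <= Hm * q + K * B.
  rewrite -(ler_pM2l k0); apply: le_trans key; rewrite [X in X <= _]mulrA.
  by rewrite ler_wpM2r//; lra.
(* By [EZ], half of the left side of [A2] absorbs the term [Z e(0) q] contained in [Hm q]. *)
have h1 : e 0 * (2 * Z * q) <= e 0 * ((E - 1) * c0) by rewrite ler_wpM2l.
have h2 : e 0 * (Z * q) <= K * B * (2 * (E - 1) + Z * q + 1) by move: A2; rewrite /Hm; lra.
have h3 : 2 * (E - 1) + Z * q + 1 <= 2 * E * (Z * q).
  have : 0 <= (2 * E - 1) * (Z * q - 1) by rewrite mulr_ge0//; lra.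
  lra.
have h4 : e 0 * (Z * q) <= K * B * (2 * E * (Z * q)).
  by apply: (le_trans h2); rewrite ler_wpM2l.
rewrite -(@ler_pM2r _ (Z * q)); last by lra.
by apply: (le_trans h4); rewrite le_eqVlt; apply/orP; left; apply/eqP; rewrite /B /IB; ring.
Qed.

End DifferentialInequalities.

(** * Weighted energy estimates *)

(* A non-class copy of [is_derive], so that derivatives can be computed by
   unification without triggering instance resolution. *)
Definition hasD {R : realType} {V : normedModType R} (x v : V) (f : V -> R) (a : R) :=
  is_derive x v f a.

Section HasD.
Context {R : realType} {V : normedModType R}.
Implicit Types (f g : V -> R) (x v : V) (a b : R).

Lemma hasD_add f g x v a b : hasD x v f a -> hasD x v g b ->
  hasD x v (fun y => f y + g y) (a + b).
Proof. exact: is_derive_add. Qed.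

Lemma hasD_opp f x v a : hasD x v f a -> hasD x v (fun y => - f y) (- a).
Proof. exact: is_derive_opp. Qed.

Lemma hasD_mul f g x v a b : hasD x v f a -> hasD x v g b ->
  hasD x v (fun y => f y * g y) (a * g x + f x * b).
Proof. exact: is_derive_mul. Qed.

Lemma hasD_const x v a : hasD x v (fun=> a) 0.
Proof. exact: is_derive_const. Qed.

Lemma hasD_val f x v a b : hasD x v f a -> a = b -> is_derive x v f b.
Proof. exact: is_derive_val. Qed.
End HasD.

Ltac isd := repeat first
  [ eassumption
  | lazymatch goal with
    | |- hasD _ _ (fun _ => ?c) _ => apply: hasD_const
    | |- hasD _ _ (fun x => @?f x + @?g x) _ => apply: (@hasD_add _ _ f g)
    | |- hasD _ _ (fun x => - @?f x) _ => apply: (@hasD_opp _ _ f)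
    | |- hasD _ _ (fun x => @?f x * @?g x) _ => apply: (@hasD_mul _ _ f g)
    end ].

(** * Linearity and monotonicity of the sphere integral *)

Section SphereMonotone.
Context {R : realType}.
Variables (r : R) (r0 : 0 < r).

Lemma sphere_intD (f g : space3 R -> R) : continuous f -> continuous g ->
  sphere_int r (fun x => f x + g x) = sphere_int r f + sphere_int r g.
Proof.
move=> cf cg; rewrite /sphere_int -RintegralD.
- by apply: eq_Rintegral => a _; rewrite /sphere_density mulrDr.
- exact: measurable_angles.
- by apply: integrable_angles; exact: sphere_density_continuous.
- by apply: integrable_angles; exact: sphere_density_continuous.
Qed.

Lemma sphere_intZ (c : R) (f : space3 R -> R) : continuous f ->
  sphere_int r (fun x => c * f x) = c * sphere_int r f.
Proof.
move=> cf; rewrite /sphere_int -RintegralZl.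
- by apply: eq_Rintegral => a _; rewrite /sphere_density mulrCA.
- exact: measurable_angles.
- by apply: integrable_angles; exact: sphere_density_continuous.
Qed.

Lemma le_sphere_int (f g : space3 R -> R) : continuous f -> continuous g ->
  (forall x, enorm x = r -> f x <= g x) -> sphere_int r f <= sphere_int r g.
Proof.
move=> cf cg fg; apply: le_Rintegral.
- exact: measurable_angles.
- by apply: integrable_angles; exact: sphere_density_continuous.
- by apply: integrable_angles; exact: sphere_density_continuous.
- move=> a [/=]; rewrite in_itv/= => ap _; rewrite /sphere_density.
  apply: ler_wpM2l; last by apply: fg; exact: sphere_norm.
  by apply: mulr_ge0; [exact: sqr_ge0|exact: sin_ge0_pi].
Qed.

Lemma sphere_int_ge0 (f : space3 R -> R) : (forall x, 0 <= f x) -> 0 <= sphere_int r f.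
Proof.
move=> f0; apply: Rintegral_ge0 => a [/=]; rewrite in_itv/= => ap _.
apply: mulr_ge0 => //.
by apply: mulr_ge0; [exact: sqr_ge0|exact: sin_ge0_pi].
Qed.

End SphereMonotone.

(** * The Carleman weight and its fluxes *)

Section Energy.
Context {R : realType}.
Variables (r : R) (r0 : 0 < r).
Implicit Types (p : spacetime R).

Definition i0 : 'I_3 := Ordinal (isT : (0 < 3)%N).
Definition i1 : 'I_3 := Ordinal (isT : (1 < 3)%N).
Definition i2 : 'I_3 := @ord_max 2.

(** A function with its time derivative, its gradient and the second space derivatives that occur in
    the divergences of the fluxes. The fields are free functions tied together by [jet_ok].
    Derivatives mixing time and space are absent: for [V] and [W] they would have weight five,
    beyond the reach of [C42]. *)
Record jet := Jet { j0 : spacetime R -> R; jt : spacetime R -> R;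
  j1 : spacetime R -> R; j2 : spacetime R -> R; j3 : spacetime R -> R;
  j11 : spacetime R -> R; j22 : spacetime R -> R; j33 : spacetime R -> R;
  j13 : spacetime R -> R; j23 : spacetime R -> R }.

Record jet_ok (u : jet) : Prop := JetOk {
  cj0 : continuous (j0 u); cjt : continuous (jt u);
  cj1 : continuous (j1 u); cj2 : continuous (j2 u); cj3 : continuous (j3 u);
  cj11 : continuous (j11 u); cj22 : continuous (j22 u);
  cj33 : continuous (j33 u); cj13 : continuous (j13 u);
  cj23 : continuous (j23 u);
  dj0t : td r (j0 u) (jt u);
  dj01 : sd r i0 (j0 u) (j1 u); dj02 : sd r i1 (j0 u) (j2 u);
  dj03 : sd r i2 (j0 u) (j3 u);
  dj11 : sd r i0 (j1 u) (j11 u); dj22 : sd r i1 (j2 u) (j22 u);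
  dj33 : sd r i2 (j3 u) (j33 u);
  dj31 : sd r i0 (j3 u) (j13 u); dj32 : sd r i1 (j3 u) (j23 u);
  dj13 : sd r i2 (j1 u) (j13 u); dj23 : sd r i2 (j2 u) (j23 u) }.

Variable lam : R.

Definition hgt p := p.1.2 + (r + 1).
Definition wgt p := expR (lam * (hgt p * hgt p)).
(* First, second and third derivatives of [wgt] in the third space variable. *)
Definition wgt1 p := 2 * lam * hgt p * wgt p.
Definition wgt2 p := (4 * lam * lam * (hgt p * hgt p) + 2 * lam) * wgt p.
Definition wgt3 p := (8 * lam * lam * lam * (hgt p * hgt p * hgt p)
                      + 12 * lam * lam * hgt p) * wgt p.

Lemma hgt_continuous : continuous hgt.
Proof. by rewrite /hgt; cont. Qed.

Lemma wgt_continuous : continuous wgt.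
Proof. by have ch := hgt_continuous; rewrite /wgt; cont. Qed.

Lemma hgt_line p i (u : R) :
  hgt (p + u *: dx i) = hgt p + u * (i == 2%N :> nat)%:R.
Proof. by rewrite /hgt/= addrAC. Qed.

Lemma hgt_derive p i : is_derive p (dx i) hgt (i == 2%N :> nat)%:R.
Proof.
apply: is_derive_ofline; under eq_fun do rewrite hgt_line.
have D := is_derive_add (is_derive_const (0 : R) (1 : R) (hgt p))
  (is_derive_mul (is_derive_id (0 : R) (1 : R))
    (is_derive_const (0 : R) (1 : R) (i == 2%N :> nat)%:R)).
by apply: (is_derive_val D); rewrite mulr0 mul1r addr0 add0r.
Qed.

Lemma wgt_derive p i :
  is_derive p (dx i) wgt (wgt1 p * (i == 2%N :> nat)%:R).
Proof.
have dh := hgt_derive p i.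
have d1 : is_derive p (dx i) (fun q => lam * (hgt q * hgt q))
    (2 * lam * hgt p * (i == 2%N :> nat)%:R).
  by apply: hasD_val; [isd|cbv beta; ring].
apply: (is_derive_val (is_derive_chain d1 (is_derive_expR _))).
by rewrite -/(wgt p) /wgt1; ring.
Qed.

Lemma hgt_d0 p : is_derive p (dx i0) hgt 0. Proof. exact: (hgt_derive p i0). Qed.
Lemma hgt_d1 p : is_derive p (dx i1) hgt 0. Proof. exact: (hgt_derive p i1). Qed.
Lemma hgt_d2 p : is_derive p (dx i2) hgt 1. Proof. exact: (hgt_derive p i2). Qed.
Lemma wgt_d0 p : is_derive p (dx i0) wgt 0.
Proof. by apply: (is_derive_val (wgt_derive p i0)); rewrite mulr0. Qed.
Lemma wgt_d1 p : is_derive p (dx i1) wgt 0.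
Proof. by apply: (is_derive_val (wgt_derive p i1)); rewrite mulr0. Qed.
Lemma wgt_d2 p : is_derive p (dx i2) wgt (2 * lam * hgt p * wgt p).
Proof. by apply: (is_derive_val (wgt_derive p i2)); rewrite mulr1. Qed.

(* With h = lam * hgt, the fluxes of the identity
   - 2 wgt1 u_3 Lap u - wgt2 u Lap u
     = 2 wgt2 (u_3 + h u)^2 + (4 lam^3 hgt^2 - 2 lam^2) wgt u^2 + div F. *)
Definition flux1 u p := - (2 * wgt1 p * j1 u p * j3 u p + wgt2 p * j0 u p * j1 u p).
Definition flux2 u p := - (2 * wgt1 p * j2 u p * j3 u p + wgt2 p * j0 u p * j2 u p).
Definition flux3 u p := - (2 * wgt1 p * j3 u p * j3 u p + wgt2 p * j0 u p * j3 u p)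
  + wgt1 p * (j1 u p * j1 u p + j2 u p * j2 u p + j3 u p * j3 u p)
  + 2^-1 * wgt3 p * (j0 u p * j0 u p)
  - 2 * (wgt2 p * (lam * hgt p)) * (j0 u p * j0 u p).
Definition div1 u p := - (2 * wgt1 p * (j11 u p * j3 u p + j1 u p * j13 u p)
  + wgt2 p * (j1 u p * j1 u p + j0 u p * j11 u p)).
Definition div2 u p := - (2 * wgt1 p * (j22 u p * j3 u p + j2 u p * j23 u p)
  + wgt2 p * (j2 u p * j2 u p + j0 u p * j22 u p)).
(** Obtained by solving the Carleman identity for the third divergence: the identity then holds by
    definition, and its content is that this expression is the derivative of [flux3]. *)
Definition div3 u p := - 2 * wgt1 p * j3 u p * (j11 u p + j22 u p + j33 u p)
  - wgt2 p * j0 u p * (j11 u p + j22 u p + j33 u p)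
  - 2 * wgt2 p * ((j3 u p + lam * hgt p * j0 u p) * (j3 u p + lam * hgt p * j0 u p))
  - (4 * lam * lam * lam * (hgt p * hgt p) - 2 * lam * lam) * wgt p * (j0 u p * j0 u p)
  - div1 u p - div2 u p.

Lemma flux1_derive u : jet_ok u -> sd r i0 (flux1 u) (div1 u).
Proof.
move=> uok p cp.
have := hgt_d0 p; have := wgt_d0 p; have := dj01 uok cp; have := dj11 uok cp.
have := dj31 uok cp => d1 d2 d3 d4 d5.
rewrite /flux1 /wgt1 /wgt2; apply: hasD_val; first by isd.
by cbv beta; rewrite /div1 /wgt1 /wgt2; ring.
Qed.

Lemma flux2_derive u : jet_ok u -> sd r i1 (flux2 u) (div2 u).
Proof.
move=> uok p cp.
have := hgt_d1 p; have := wgt_d1 p; have := dj02 uok cp; have := dj22 uok cp.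
have := dj32 uok cp => d1 d2 d3 d4 d5.
rewrite /flux2 /wgt1 /wgt2; apply: hasD_val; first by isd.
by cbv beta; rewrite /div2 /wgt1 /wgt2; ring.
Qed.

(** The symmetry of mixed derivatives enters here: the [j13] and [j23] that come from
    differentiating [j3] in the first two directions cancel those that come from differentiating
    [j1] and [j2] in the third. *)
Lemma flux3_derive u : jet_ok u -> sd r i2 (flux3 u) (div3 u).
Proof.
move=> uok p cp.
have := hgt_d2 p; have := wgt_d2 p; have := dj03 uok cp; have := dj33 uok cp.
have := dj13 uok cp; have := dj23 uok cp => d1 d2 d3 d4 d5 d6.
rewrite /flux3 /wgt1 /wgt2 /wgt3; apply: hasD_val; first by isd.
by cbv beta; rewrite /div3 /div1 /div2 /wgt1 /wgt2; field.
Qed.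

End Energy.

Definition hgt_max {R : realType} (r : R) := 2 * r + 1.
Definition wgt_max {R : realType} (r lam : R) := expR (lam * (hgt_max r * hgt_max r)).
(** Here [(lam M)^3] times the maximum of the weight is the size of its third derivative; when
    [lam M >= 1] it dominates the lower ones too, so that one constant serves for all the fluxes. *)
Definition flux_const {R : realType} (r lam : R) :=
  let a := lam * hgt_max r in a * a * a * wgt_max r lam.

(** * Bounds of the weight, and of the fluxes by the boundary data *)

Section EnergyInequalities.
Context {R : realType}.
Variables (r : R) (r0 : 0 < r).
Implicit Types (p : spacetime R) (t : R) (u : jet (R := R)).
Variables (lam sg : R) (v w : jet (R := R)) (vok : jet_ok r v) (wok : jet_ok r w).
Hypothesis sg0 : 0 <= sg.
Hypothesis lamsg : 4 * (1 + sg) <= lam.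
Hypothesis vtE : forall p, cyl r p ->
  jt v p = - (j11 w p + j22 w p + j33 w p) - sg * j0 v p.
Hypothesis wtE : forall p, cyl r p -> jt w p = j11 v p + j22 v p + j33 v p.

Local Notation M := (hgt_max r).
Local Notation Z := (wgt_max r lam).
Local Notation kap := (flux_const r lam).
Local Notation hg := (hgt r).
Local Notation wg := (wgt r lam).
Local Notation wg1 := (wgt1 r lam).
Local Notation wg2 := (wgt2 r lam).
Local Notation wg3 := (wgt3 r lam).

Lemma lam_ge4 : 4 <= lam. Proof. by move: lamsg sg0; lra. Qed.
Lemma hgt_max_ge1 : 1 <= M. Proof. by move: r0; rewrite /hgt_max; lra. Qed.

Definition jet_sq u p := j0 u p ^+ 2 + j1 u p ^+ 2 + j2 u p ^+ 2 + j3 u p ^+ 2.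
(** The integrands of the six boundary norms: the two [jet_sq] hold [U_t], [lap U] and their
    gradients, the last two squares are those of [U_tt] and [d_t lap U]. *)
Definition bdry_density p := jet_sq v p + jet_sq w p + jt v p ^+ 2 + jt w p ^+ 2.

Lemma hgt_bounds p : enorm p.1 <= r -> 1 <= hg p <= M.
Proof.
move=> /(closed_ball_cube (ltW r0))[_]; rewrite /= in_itv/= /hgt /hgt_max => /andP[h1 h2].
by apply/andP; split; lra.
Qed.

Lemma wgt_bounds p : enorm p.1 <= r -> expR lam <= wg p <= Z.
Proof.
have l4 := lam_ge4; have m1 := hgt_max_ge1.
move=> /hgt_bounds/andP[h1 h2]; have l0 : 0 <= lam by lra.
rewrite /wgt /wgt_max !ler_expR; apply/andP; split.
  rewrite -[X in X <= _]mulr1; apply: ler_wpM2l => //.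
  by rewrite -[X in X <= _]mulr1 ler_pM.
by apply: ler_wpM2l => //; apply: ler_pM => //; lra.
Qed.

Lemma wgt_gt0 p : 0 < wg p. Proof. exact: expR_gt0. Qed.

Lemma Z_ge1 : 1 <= Z.
Proof.
have l4 := lam_ge4; have m1 := hgt_max_ge1.
by rewrite /wgt_max -expR0 ler_expR
  !mulr_ge0//; lra. Qed.

Lemma kap_geZ : Z <= kap.
Proof.
have l4 := lam_ge4; have m1 := hgt_max_ge1.
have Z0 : 0 <= Z by have := Z_ge1; lra.
have a1 : 1 <= lam * M by rewrite -[X in X <= _]mulr1; apply: ler_pM => //; lra.
rewrite /flux_const -[X in X <= _]mul1r; apply: ler_wpM2r => //.
by rewrite -[X in X <= _]mulr1 -[X in X * _ <= _]mulr1 !ler_pM.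
Qed.

(** With [l = lam * hgt] and [a = lam * M >= 1], the factor in front of the weight is a polynomial
    of degree at most three in [l] and [lam], hence at most [a^3] times the sum of its coefficients:
    [2], [4 + 2], [8 + 12] and [4 + 2]. *)
Lemma weights_le p : enorm p.1 <= r ->
  [/\ 0 <= wg1 p <= 2 * kap, 0 <= wg2 p <= 6 * kap, 0 <= wg3 p <= 20 * kap &
      0 <= wg2 p * (lam * hg p) <= 6 * kap].
Proof.
have l4 := lam_ge4; have m1 := hgt_max_ge1.
move=> pr; have /andP[h1 h2] := hgt_bounds pr; have /andP[_ wZ] := wgt_bounds pr.
have w0 := ltW (wgt_gt0 p); have Z0 : 0 <= Z by exact: le_trans wZ.
have l0 : 0 <= lam by lra.
pose a := lam * M; pose l := lam * hg p.
have l1 : 0 <= l by rewrite mulr_ge0//; lra.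
have la : l <= a by rewrite ler_wpM2l.
have lama : lam <= a by rewrite -[X in X <= _]mulr1 ler_wpM2l.
have a1 : 1 <= a by lra.
have a0 : 0 <= a by lra.
have a2 : a <= a * a by rewrite -[X in X <= _]mulr1 ler_wpM2l.
have a20 : 0 <= a * a by rewrite mulr_ge0.
have a3 : a * a <= a * a * a by rewrite -[X in X <= _]mulr1 ler_wpM2l.
have a30 : 0 <= a * a * a by rewrite mulr_ge0.
have l2 : l * l <= a * a by rewrite ler_pM.
have l20 : 0 <= l * l by rewrite mulr_ge0.
have l3 : l * l * l <= a * a * a by rewrite ler_pM.
have l30 : 0 <= l * l * l by rewrite mulr_ge0.
have ll : lam * l <= a * a by rewrite ler_pM.
have ll0 : 0 <= lam * l by rewrite mulr_ge0.
have B (c k : R) : 0 <= c <= k * (a * a * a) -> 0 <= c * wg p <= k * kap.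
  move=> /andP[c0 ck]; rewrite mulr_ge0//=.
  by rewrite /flux_const -/a [X in _ <= X]mulrA ler_pM.
split.
- rewrite /wgt1; apply: B; rewrite -mulrA -/l; apply/andP; split; lra.
- rewrite /wgt2 (_ : 4 * lam * lam * (hg p * hg p) = 4 * (l * l)); last by rewrite /l; ring.
  by apply: B; apply/andP; split; lra.
- rewrite /wgt3 (_ : 8 * lam * lam * lam * (hg p * hg p * hg p) +
    12 * lam * lam * hg p = 8 * (l * l * l) + 12 * (lam * l)); last by rewrite /l; ring.
  by apply: B; apply/andP; split; lra.
- rewrite /wgt2 (_ : _ * wg p * (lam * hg p) = (4 * (l * l * l) + 2 * (lam * l)) * wg p);
    last by rewrite /l; ring.
  by apply: B; apply/andP; split; lra.
Qed.

Lemma prod_bound (A k x y : R) : 0 <= A <= k ->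
  `|A * (2 * x * y)| <= k * (x ^+ 2 + y ^+ 2).
Proof.
move=> /andP[A0 Ak]; rewrite normrM ger0_norm//.
apply: ler_pM => //; rewrite ler_norml; apply/andP; split.
  by have := sqr_ge0 (x + y); rewrite sqrrD; lra.
by have := sqr_ge0 (x - y); rewrite sqrrB; lra.
Qed.

Lemma kap_ge0 : 0 <= kap.
Proof. by have := kap_geZ; have := Z_ge1; lra. Qed.

Lemma jet_sq_le u p : 0 <= j0 u p ^+ 2 <= jet_sq u p /\ 0 <= j1 u p ^+ 2 <= jet_sq u p /\
  0 <= j2 u p ^+ 2 <= jet_sq u p /\ 0 <= j3 u p ^+ 2 <= jet_sq u p.
Proof.
rewrite /jet_sq; have := sqr_ge0 (j0 u p); have := sqr_ge0 (j1 u p).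
have := sqr_ge0 (j2 u p); have := sqr_ge0 (j3 u p) => a b c d.
by do !split; apply/andP; split; lra.
Qed.

(** The constant is [10 = 4 + 6]: the first product costs [2 * kap] times [2 * q], the second costs
    half of [6 * kap] times [2 * q]. *)
Lemma cross_flux_bound (A1 A2 x y z q : R) : 0 <= A1 <= 2 * kap -> 0 <= A2 <= 6 * kap ->
  x ^+ 2 + y ^+ 2 <= 2 * q -> z ^+ 2 + x ^+ 2 <= 2 * q ->
  `|- (2 * A1 * x * y + A2 * z * x)| <= 10 * kap * q.
Proof.
move=> A1k A2k xy zx.
have -> : - (2 * A1 * x * y + A2 * z * x) = - (A1 * (2 * x * y) + 2^-1 * (A2 * (2 * z *
  x))).
  by field.
rewrite normrN; apply: (le_trans (ler_normD _ _)).
rewrite [X in _ + X]normrM [`|2^-1|]ger0_norm//.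
have h1 := prod_bound x y A1k; have h2 := prod_bound z x A2k.
have h3 := ler_wpM2l kap_ge0 xy; have h4 := ler_wpM2l kap_ge0 zx; lra.
Qed.

(** In the third flux the four terms cost [10], [2], [20 / 2] and [2 * 6], in all [34], rounded up
    to [40]. *)
Lemma flux_bounds u p : enorm p.1 <= r ->
  [/\ `|flux1 r lam u p| <= 10 * kap * jet_sq u p,
      `|flux2 r lam u p| <= 10 * kap * jet_sq u p &
      `|flux3 r lam u p| <= 40 * kap * jet_sq u p].
Proof.
move=> /weights_le[W1 W2 W3 W4].
have [/andP[a0 a1] [/andP[b0 b1] [/andP[c0 c1] /andP[d0 d1]]]] := jet_sq_le u p.
split.
- by rewrite /flux1; apply: cross_flux_bound => //; lra.
- by rewrite /flux2; apply: cross_flux_bound => //; lra.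
- have F1 : `|- (2 * wg1 p * j3 u p * j3 u p + wg2 p * j0 u p * j3 u p)| <=
      10 * kap * jet_sq u p by apply: cross_flux_bound => //; lra.
  have q0 : 0 <= jet_sq u p := le_trans a0 a1.
  have pos (A k x : R) : 0 <= A <= k * kap -> 0 <= k -> 0 <= x <= jet_sq u p ->
      `|A * x| <= k * kap * jet_sq u p.
    by move=> /andP[A0 Ak] k0 /andP[x0 xq]; rewrite ger0_norm ?mulr_ge0// ler_pM.
  have F2 : `|wg1 p * (j1 u p * j1 u p + j2 u p * j2 u p + j3 u p * j3 u p)| <=
      2 * kap * jet_sq u p.
    by apply: pos => //; rewrite /jet_sq; apply/andP; split; lra.
  have F3 : `|wg3 p * (j0 u p * j0 u p)| <= 20 * kap * jet_sq u p.
    by apply: pos => //; apply/andP; split; lra.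
  have F4 : `|wg2 p * (lam * hg p) * (j0 u p * j0 u p)| <= 6 * kap * jet_sq u p.
    by apply: pos => //; apply/andP; split; lra.
  move: F1 F2 F3 F4; rewrite /flux3 !ler_norml => /andP[? ?] /andP[? ?] /andP[? ?]
    /andP[? ?].
  have kq : 0 <= kap * jet_sq u p by rewrite mulr_ge0// kap_ge0.
  by apply/andP; split; lra.
Qed.

Lemma bdry_density_ge u p : (u = v \/ u = w) -> jet_sq u p <= bdry_density p.
Proof.
have [/andP[a0 a1] _] := jet_sq_le v p; have [/andP[b0 b1] _] := jet_sq_le w p.
have := sqr_ge0 (jt v p); have := sqr_ge0 (jt w p).
by rewrite /bdry_density => c d [->|->]; lra.
Qed.

Lemma jet_sq_continuous u : jet_ok r u -> continuous (jet_sq u).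
Proof.
move=> uok; have c0 := cj0 uok; have c1 := cj1 uok; have c2 := cj2 uok.
by have c3 := cj3 uok; rewrite /jet_sq; cont.
Qed.

Lemma bdry_density_continuous : continuous bdry_density.
Proof.
have c1 := jet_sq_continuous vok; have c2 := jet_sq_continuous wok.
by have c3 := cjt vok; have c4 := cjt wok; rewrite /bdry_density; cont.
Qed.

Definition bdry_energy t := sphere_int r (fun x => bdry_density (x, t)).

Lemma bdry_density_ge0 p : 0 <= bdry_density p.
Proof.
have [/andP[a0 a1] _] := jet_sq_le v p.
apply: (@le_trans _ _ (jet_sq v p)); first exact: le_trans a1.
by apply: bdry_density_ge; left.
Qed.

Lemma bdry_energy_ge0 t : 0 <= bdry_energy t.
Proof. by apply: sphere_int_ge0 => x; exact: bdry_density_ge0. Qed.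

Lemma sphere_flux_le (F : spacetime R -> R) (c t : R) : continuous F ->
  (forall p, enorm p.1 <= r -> `|F p| <= c * bdry_density p) ->
  sphere_int r (fun x => `|F (x, t)|) <= c * bdry_energy t.
Proof.
move=> cF FQ; have cQ := bdry_density_continuous.
rewrite /bdry_energy -sphere_intZ; last by cont.
apply: (le_sphere_int r0); [by cont|by cont|move=> x xr; apply: FQ].
by rewrite /= xr.
Qed.

Lemma ball_div_bound (i : 'I_3) (F G : spacetime R -> R) (c t : R) :
  continuous F -> continuous G -> sd r i F G -> 0 < t ->
  (forall p, enorm p.1 <= r -> `|F p| <= c * bdry_density p) ->
  `|ball_int r (fun x => G (x, t))| <= c * bdry_energy t.
Proof.
move=> cF cG FG t0 FQ; apply: le_trans (sphere_flux_le t cF FQ).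
apply: (@integral_derive_le _ r (fun x => F (x, t)) (fun x => G (x, t)) i r0).
- by cont.
- by cont.
- by move=> x Bx; exact: sd_slice FG t0 x Bx.
Qed.

End EnergyInequalities.

(** * Evolution of the energies and of the momentum *)

Section EnergyDerivatives.
Context {R : realType}.
Variables (r : R) (r0 : 0 < r).
Implicit Types (p : spacetime R) (t : R) (u : jet (R := R)).
Variables (lam sg : R) (v w : jet (R := R)) (vok : jet_ok r v) (wok : jet_ok r w).
Hypothesis sg0 : 0 <= sg.
Hypothesis lamsg : 4 * (1 + sg) <= lam.
Hypothesis vtE : forall p, cyl r p ->
  jt v p = - (j11 w p + j22 w p + j33 w p) - sg * j0 v p.
Hypothesis wtE : forall p, cyl r p -> jt w p = j11 v p + j22 v p + j33 v p.
Local Notation M := (hgt_max r).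
Local Notation Z := (wgt_max r lam).
Local Notation kap := (flux_const r lam).
Local Notation hg := (hgt r).
Local Notation wg := (wgt r lam).
Local Notation wg1 := (wgt1 r lam).
Local Notation wg2 := (wgt2 r lam).
Local Notation wg3 := (wgt3 r lam).
Local Notation Q := (bdry_density v w).
Local Notation bd := (bdry_energy r v w).
Local Notation I := (ball_int r).

Definition energy t := I (fun x => j0 v (x, t) ^+ 2 + j0 w (x, t) ^+ 2).
Definition wenergy t := I (fun x => wg (x, t) * (j0 v (x, t) ^+ 2 + j0 w (x, t) ^+ 2)).
(** The [rho] of the overview, kept as a difference of two integrals so that [cross_derive]
    differentiates each. *)
Definition momentum t := I (fun x => wg1 (x, t) * j0 v (x, t) * j3 w (x, t))
  - I (fun x => wg1 (x, t) * j0 w (x, t) * j3 v (x, t)).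

Definition energy' t :=
  I (fun x => 2 * (j0 v (x, t) * jt v (x, t) + j0 w (x, t) * jt w (x, t))).
Definition wenergy' t :=
  I (fun x => wg (x, t) * (2 * (j0 v (x, t) * jt v (x, t) + j0 w (x, t) * jt w (x, t)))).

Let cv0 := cj0 vok. Let cw0 := cj0 wok. Let cvt := cjt vok. Let cwt := cjt wok.
Let cv1 := cj1 vok. Let cw1 := cj1 wok. Let cv2 := cj2 vok. Let cw2 := cj2 wok.
Let cv3 := cj3 vok. Let cw3 := cj3 wok.
Let cv11 := cj11 vok. Let cw11 := cj11 wok. Let cv22 := cj22 vok.
Let cw22 := cj22 wok. Let cv33 := cj33 vok. Let cw33 := cj33 wok.
Let cv13 := cj13 vok. Let cw13 := cj13 wok. Let cv23 := cj23 vok.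
Let cw23 := cj23 wok.

Let chg : continuous hg. Proof. exact: hgt_continuous. Qed.
Let cwg : continuous wg. Proof. exact: wgt_continuous. Qed.

Lemma wgt1_continuous : continuous wg1.
Proof. by rewrite /wgt1; cont. Qed.
Lemma wgt2_continuous : continuous wg2.
Proof. by rewrite /wgt2; cont. Qed.
Lemma wgt3_continuous : continuous wg3.
Proof. by rewrite /wgt3; cont. Qed.

Let cwg1 := wgt1_continuous. Let cwg2 := wgt2_continuous.
Let cwg3 := wgt3_continuous.

Lemma energy_continuous : continuous energy.
Proof.
apply: (@ball_int_continuous _ r r0 (fun p => j0 v p ^+ 2 + j0 w p ^+ 2)).
by cont.
Qed.

Lemma wenergy_continuous : continuous wenergy.
Proof.
apply: (@ball_int_continuous _ r r0 (fun p => wg p * (j0 v p ^+ 2 + j0 w p ^+ 2))).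
by cont.
Qed.

Lemma momentum_continuous : continuous momentum.
Proof.
apply: continuous_sub.
  apply: (@ball_int_continuous _ r r0 (fun p => wg1 p * j0 v p * j3 w p)); cont.
apply: (@ball_int_continuous _ r r0 (fun p => wg1 p * j0 w p * j3 v p)); cont.
Qed.

Lemma bdry_energy_continuous : continuous bd.
Proof.
apply: (@sphere_int_continuous _ r r0 Q); exact: (bdry_density_continuous vok wok).
Qed.

Lemma is_derive_sqr (f : spacetime R -> R) p (d : spacetime R) (a : R) :
  is_derive p d f a -> is_derive p d (fun q => f q ^+ 2) (2 * (f p * a)).
Proof.
move=> df; apply: (is_derive_val (is_derive_mul df df)); ring.
Qed.

Lemma energy_derive t : 0 < t -> is_derive t (1 : R) energy (energy' t).
Proof.
apply: (@ball_int_derive _ r r0 (fun p => j0 v p ^+ 2 + j0 w p ^+ 2)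
  (fun p => 2 * (j0 v p * jt v p + j0 w p * jt w p))); [by cont|by cont|].
move=> p cp; rewrite mulrDr; apply: is_derive_add; apply: is_derive_sqr.
  exact: (dj0t vok).
exact: (dj0t wok).
Qed.

Lemma wgt_time p : is_derive p dt wg 0.
Proof.
apply: is_derive_ofline.
have -> : (fun u : R => wg (p + u *: dt)) = fun=> wg p.
  by apply/funext => u; rewrite /wgt /hgt/= scaler0 addr0.
exact: is_derive_const.
Qed.

Lemma wenergy_derive t : 0 < t -> is_derive t (1 : R) wenergy (wenergy' t).
Proof.
apply: (@ball_int_derive _ r r0 (fun p => wg p * (j0 v p ^+ 2 + j0 w p ^+ 2))
  (fun p => wg p * (2 * (j0 v p * jt v p + j0 w p * jt w p)))); [by cont|by cont|].
move=> p cp; have d1 := is_derive_sqr (dj0t vok cp).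
have d2 := is_derive_sqr (dj0t wok cp).
apply: (is_derive_val (is_derive_mul (wgt_time p) (is_derive_add d1 d2))).
by rewrite mul0r add0r [in RHS]mulrDr.
Qed.

(** The components of Green's vector field [2 (W grad V - V grad W)], whose divergence is
    [2 (W lap V - V lap W)]; the argument [j] selects the component. *)
Definition eflux (j : jet (R := R) -> spacetime R -> R) p :=
  2 * (j0 w p * j v p - j0 v p * j w p).

Lemma eflux_bound j p :
  (forall u, 0 <= j u p ^+ 2 <= jet_sq u p) ->
  (forall u, j0 u p ^+ 2 + j u p ^+ 2 <= jet_sq u p) ->
  `|eflux j p| <= Q p.
Proof.
move=> h1 h2; have := h2 v; have := h2 w => h3 h4.
have h5 := sqr_ge0 (j0 w p - j v p); have h6 := sqr_ge0 (j0 w p + j v p).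
have h7 := sqr_ge0 (j0 v p - j w p); have h8 := sqr_ge0 (j0 v p + j w p).
move: h5 h6 h7 h8; rewrite !sqrrD !sqrrN => h5 h6 h7 h8.
have h9 := sqr_ge0 (jt v p); have h10 := sqr_ge0 (jt w p).
rewrite /eflux /bdry_density ler_norml; apply/andP; split; lra.
Qed.

Lemma eflux_bounds p : [/\ `|eflux (@j1 R) p| <= Q p, `|eflux (@j2 R) p| <= Q p &
  `|eflux (@j3 R) p| <= Q p].
Proof.
have H u := jet_sq_le u p.
split; apply: eflux_bound => u; have [/andP[a0 a1] [/andP[b0 b1] [/andP[c0 c1] /andP[d0
  d1]]]] := H u;
  by rewrite /jet_sq in a1 b1 c1 d1 *; try (apply/andP; split); lra.
Qed.

Lemma sd_eflux (i : 'I_3) (j jj : jet (R := R) -> spacetime R -> R) :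
  (forall u, jet_ok r u -> sd r i (j0 u) (j u)) ->
  (forall u, jet_ok r u -> sd r i (j u) (jj u)) ->
  sd r i (eflux j) (fun p => 2 * (j0 w p * jj v p - j0 v p * jj w p)).
Proof.
move=> d0 d1 p cp; have a1 := d0 _ vok _ cp; have a2 := d0 _ wok _ cp.
have a3 := d1 _ vok _ cp; have a4 := d1 _ wok _ cp.
rewrite /eflux; apply: hasD_val; first by isd.
by cbv beta; ring.
Qed.

Let l0 : 0 <= lam. Proof. by have := lam_ge4 sg0 lamsg; lra. Qed.

Lemma flux_const_ge1 : 1 <= kap.
Proof. by apply: le_trans (kap_geZ r0 sg0 lamsg); exact: Z_ge1 sg0 lamsg. Qed.

Lemma le_ball_div3 (e1 e2 e3 : spacetime R -> R) (G1 G2 G3 : spacetime R -> R) (c t : R) :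
  0 < t -> continuous e1 -> continuous e2 -> continuous e3 ->
  continuous G1 -> continuous G2 -> continuous G3 ->
  sd r i0 e1 G1 -> sd r i1 e2 G2 -> sd r i2 e3 G3 ->
  (forall p, enorm p.1 <= r -> `|e1 p| <= c * Q p) ->
  (forall p, enorm p.1 <= r -> `|e2 p| <= c * Q p) ->
  (forall p, enorm p.1 <= r -> `|e3 p| <= c * Q p) ->
  `|I (fun x => G1 (x, t) + G2 (x, t) + G3 (x, t))| <= 3 * c * bd t.
Proof.
move=> t0 ce1 ce2 ce3 cG1 cG2 cG3 d1 d2 d3 b1 b2 b3.
have := ball_div_bound r0 vok wok ce1 cG1 d1 t0 b1.
have := ball_div_bound r0 vok wok ce2 cG2 d2 t0 b2.
have := ball_div_bound r0 vok wok ce3 cG3 d3 t0 b3.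
rewrite !ball_intD//; [|by cont..].
rewrite !ler_norml => /andP[? ?] /andP[? ?] /andP[? ?].
by apply/andP; split; lra.
Qed.

(** By the system, [2 (V V_t + W W_t)] is the divergence of [eflux] minus [2 sg V^2], and the
    damping has the good sign. The constant [128] is common to the three inequalities and is
    dictated by [momentum'_ge]. *)
Lemma energy'_le t : 0 < t -> energy' t <= 128 * kap * bd t.
Proof.
move=> t0; have k1 := flux_const_ge1.
pose G1 p := 2 * (j0 w p * j11 v p - j0 v p * j11 w p).
pose G2 p := 2 * (j0 w p * j22 v p - j0 v p * j22 w p).
pose G3 p := 2 * (j0 w p * j33 v p - j0 v p * j33 w p).
have cG1 : continuous G1 by rewrite /G1; cont.
have cG2 : continuous G2 by rewrite /G2; cont.
have cG3 : continuous G3 by rewrite /G3; cont.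
have ce1 : continuous (eflux (@j1 R)) by rewrite /eflux; cont.
have ce2 : continuous (eflux (@j2 R)) by rewrite /eflux; cont.
have ce3 : continuous (eflux (@j3 R)) by rewrite /eflux; cont.
have d1 : sd r i0 (eflux (@j1 R)) G1 by apply: sd_eflux => u uok; [exact: dj01|exact: dj11].
have d2 : sd r i1 (eflux (@j2 R)) G2 by apply: sd_eflux => u uok; [exact: dj02|exact: dj22].
have d3 : sd r i2 (eflux (@j3 R)) G3 by apply: sd_eflux => u uok; [exact: dj03|exact: dj33].
have := @le_ball_div3 _ _ _ G1 G2 G3 1 t t0 ce1 ce2 ce3 cG1 cG2 cG3 d1 d2 d3.
have Eb p := eflux_bounds p.
move=> /(_ _ _ _)/(le_trans (ler_norm _)) H.
have {}H : I (fun x => G1 (x, t) + G2 (x, t) + G3 (x, t)) <= 3 * 1 * bd t.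
  by apply: H => p _; have [? ? ?] := Eb p; rewrite mul1r.
apply: (@le_trans _ _ (I (fun x => G1 (x, t) + G2 (x, t) + G3 (x, t)))).
  apply: le_ball_int => //; [by cont|by cont|].
  move=> x Bx; have cp : cyl r (x, t) by split.
  rewrite (vtE cp) (wtE cp) /G1 /G2 /G3.
  have : 0 <= sg * j0 v (x, t) ^+ 2 by rewrite mulr_ge0// sqr_ge0.
  by lra.
apply: (le_trans H); have b0 := bdry_energy_ge0 r v w t.
by apply: ler_wpM2r => //; lra.
Qed.

(** Moving the weight inside the divergence of [eflux] costs [wg1] times the third component, and
    this is minus twice the density of [momentum]; the damping [2 sg wg V^2] is bounded by the
    density of [2 sg wenergy]. *)
Lemma wenergy'_ge t : 0 < t ->
  2 * momentum t - 2 * sg * wenergy t - 128 * kap * bd t <= wenergy' t.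
Proof.
move=> t0; have k1 := flux_const_ge1.
pose G1 p := wg p * (2 * (j0 w p * j11 v p - j0 v p * j11 w p)).
pose G2 p := wg p * (2 * (j0 w p * j22 v p - j0 v p * j22 w p)).
pose G3 p := wg p * (2 * (j0 w p * j33 v p - j0 v p * j33 w p)) +
  2 * lam * hg p * wg p * eflux (@j3 R) p.
have ce1 : continuous (eflux (@j1 R)) by rewrite /eflux; cont.
have ce2 : continuous (eflux (@j2 R)) by rewrite /eflux; cont.
have ce3 : continuous (eflux (@j3 R)) by rewrite /eflux; cont.
have cG1 : continuous G1 by rewrite /G1; cont.
have cG2 : continuous G2 by rewrite /G2; cont.
have cG3 : continuous G3 by rewrite /G3; cont.
pose F1 p := wg p * eflux (@j1 R) p.
pose F2 p := wg p * eflux (@j2 R) p.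
pose F3 p := wg p * eflux (@j3 R) p.
have cF1 : continuous F1 by rewrite /F1; cont.
have cF2 : continuous F2 by rewrite /F2; cont.
have cF3 : continuous F3 by rewrite /F3; cont.
have d1 : sd r i0 F1 G1.
  have E : sd r i0 (eflux (@j1 R)) (fun p => 2 * (j0 w p * j11 v p - j0 v p * j11 w p)).
    by apply: sd_eflux => u uok; [exact: dj01|exact: dj11].
  move=> p cp; have d := E p cp.
  apply: (is_derive_val (is_derive_mul (wgt_d0 r lam p) d)).
  by rewrite mul0r add0r.
have d2 : sd r i1 F2 G2.
  have E : sd r i1 (eflux (@j2 R)) (fun p => 2 * (j0 w p * j22 v p - j0 v p * j22 w p)).
    by apply: sd_eflux => u uok; [exact: dj02|exact: dj22].
  move=> p cp; have d := E p cp.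
  apply: (is_derive_val (is_derive_mul (wgt_d1 r lam p) d)).
  by rewrite mul0r add0r.
have d3 : sd r i2 F3 G3.
  have E : sd r i2 (eflux (@j3 R)) (fun p => 2 * (j0 w p * j33 v p - j0 v p * j33 w p)).
    by apply: sd_eflux => u uok; [exact: dj03|exact: dj33].
  move=> p cp; have d := E p cp.
  apply: (is_derive_val (is_derive_mul (wgt_d2 r lam p) d)).
  by rewrite addrC.
have wb p e : enorm p.1 <= r -> `|e| <= Q p -> `|wg p * e| <= kap * Q p.
  move=> pr eQ; have /andP[_ wZ] := wgt_bounds r0 sg0 lamsg pr.
  rewrite normrM ger0_norm ?(ltW (wgt_gt0 _ _ _))// ler_pM// ?(ltW (wgt_gt0 _ _ _))//.
  by apply: (le_trans wZ); exact: kap_geZ sg0 lamsg.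
have H : `|I (fun x => G1 (x, t) + G2 (x, t) + G3 (x, t))| <= 3 * kap * bd t.
  apply: (@le_ball_div3 F1 F2 F3 G1 G2 G3 kap t) => // p pr;
    have [? ? ?] := eflux_bounds p; exact: wb.
have : I (fun x => G1 (x, t) + G2 (x, t) + G3 (x, t)) +
    (2 * momentum t - 2 * sg * wenergy t) <= wenergy' t.
  rewrite /momentum /wenergy /wenergy' -ball_intB; [|by []|by cont|by cont].
  rewrite -!ball_intZ; [|by []|by cont|by []|by cont].
  rewrite -ball_intB; [|by []|by cont|by cont].
  rewrite -ball_intD; [|by []|by cont|by cont].
  apply: le_ball_int => //; [by cont|by cont|].
  move=> x Bx; have cp : cyl r (x, t) by split.
  rewrite (vtE cp) (wtE cp) /G1 /G2 /G3 /eflux /wgt1.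
  have : 0 <= sg * wg (x, t) * j0 w (x, t) ^+ 2.
    apply: mulr_ge0; last exact: sqr_ge0.
    by apply: mulr_ge0 => //; exact/ltW/wgt_gt0.
  by lra.
move: H; rewrite ler_norml => /andP[H1 H2] H3.
have b0 := mulr_ge0 (le_trans ler01 k1) (bdry_energy_ge0 r v w t).
by lra.
Qed.

Lemma sd_wgt1 : sd r i2 wg1 wg2.
Proof.
move=> p cp; have := hgt_d2 r p; have := wgt_d2 r lam p => d1 d2.
rewrite /wgt1; apply: hasD_val; first by isd.
by cbv beta; rewrite /wgt2; ring.
Qed.

(** Two instances of the derivative in [cross_derive], for the products [V W_3] and [W V_3]. *)
Definition momentum' t :=
  (I (fun x => wg1 (x, t) * jt v (x, t) * j3 w (x, t))
   + bdry3 r (fun x => wg1 (x, t) * j0 v (x, t) * jt w (x, t))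
   - I (fun x => (wg2 (x, t) * j0 v (x, t) + wg1 (x, t) * j3 v (x, t)) * jt w (x, t)))
  - (I (fun x => wg1 (x, t) * jt w (x, t) * j3 v (x, t))
   + bdry3 r (fun x => wg1 (x, t) * j0 w (x, t) * jt v (x, t))
   - I (fun x => (wg2 (x, t) * j0 w (x, t) + wg1 (x, t) * j3 w (x, t)) * jt v (x, t))).

Lemma momentum_derive t : 0 < t -> is_derive t (1 : R) momentum (momentum' t).
Proof.
move=> t0; apply: is_derive_sub.
  apply: (@cross_derive _ r r0 wg1 wg2 (j0 v) (jt v) (j3 v) (j0 w) (jt w) (j3 w)) => //.
  - exact: sd_wgt1.
  - exact: (dj0t vok).
  - exact: (dj03 vok).
  - exact: (dj0t wok).
  - exact: (dj03 wok).
apply: (@cross_derive _ r r0 wg1 wg2 (j0 w) (jt w) (j3 w) (j0 v) (jt v) (j3 v)) => //.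
- exact: sd_wgt1.
- exact: (dj0t wok).
- exact: (dj03 wok).
- exact: (dj0t vok).
- exact: (dj03 vok).
Qed.

(** Inserting the system turns the right side into the Carleman expressions of [V] and of [W] minus
    the damping terms [sg V (2 wg1 W_3 + wg2 W)]. In terms of [gw = W_3 + lam X W] the latter are
    the weight times [4 sg lam X V gw + 2 sg lam V W]: the first summand is absorbed by the square
    of [gw], and what remains by the zero-order term of size [lam^3], because [sg <= lam / 4]. *)
Lemma momentum_density_ge p : cyl r p ->
  lam ^+ 3 * (wg p * (j0 v p ^+ 2 + j0 w p ^+ 2)) +
  ((div1 r lam v p + div1 r lam w p) + (div2 r lam v p + div2 r lam w p)
   + (div3 r lam v p + div3 r lam w p)) <=
  wg1 p * jt v p * j3 w p - (wg2 p * j0 v p + wg1 p * j3 v p) * jt w p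
  - (wg1 p * jt w p * j3 v p - (wg2 p * j0 w p + wg1 p * j3 w p) * jt v p).
Proof.
move=> cp; have [Bp _] := cp; have pr : enorm p.1 <= r by exact: ltW.
have /andP[h1 _] := hgt_bounds r0 pr; have w0 := ltW (wgt_gt0 r lam p).
have l4 := lam_ge4 sg0 lamsg; have sgp := sg0; have lsg := lamsg.
rewrite (vtE cp) (wtE cp).
set V := j0 v p; set W := j0 w p; set X := hg p in h1 *.
set gv := j3 v p + lam * X * V; set gw := j3 w p + lam * X * W.
pose P := wg p.
have E : wg1 p * (- (j11 w p + j22 w p + j33 w p) - sg * V) * j3 w p
   - (wg2 p * V + wg1 p * j3 v p) * (j11 v p + j22 v p + j33 v p)
   - (wg1 p * (j11 v p + j22 v p + j33 v p) * j3 v p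
      - (wg2 p * W + wg1 p * j3 w p) * (- (j11 w p + j22 w p + j33 w p) - sg * V))
   - ((div1 r lam v p + div1 r lam w p) + (div2 r lam v p + div2 r lam w p)
   + (div3 r lam v p + div3 r lam w p)) =
   P * ((8 * lam * lam * (X * X) + 4 * lam) * (gv * gv + gw * gw) +
     (4 * lam * lam * lam * (X * X) - 2 * lam * lam) * (V * V + W * W)
     - 4 * sg * lam * X * V * gw - 2 * sg * lam * V * W).
  rewrite /div3 /wgt1 /wgt2 -/(hgt r p) -/X -/P -/V -/W /gv /gw.
  by ring.
rewrite -lerBrDr E (_ : lam ^+ 3 * _ = P * (lam ^+ 3 * (V * V + W * W))); last first.
  by rewrite /P; ring.
apply: ler_wpM2l => //.
have X2 : 1 <= X * X by rewrite -[X in X <= _]mulr1 ler_pM.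
have VW0 : 0 <= V * V + W * W by rewrite addr_ge0// -expr2 sqr_ge0.
have l2 : 0 <= lam * lam by rewrite mulr_ge0//; lra.
have l3 : 0 <= lam * lam * lam by rewrite mulr_ge0//; lra.
have g0 : 0 <= gv * gv by rewrite -expr2 sqr_ge0.
have g1 : 0 <= gw * gw by rewrite -expr2 sqr_ge0.
(* Half of this bounds [4 sg lam X V gw] by the term [8 (lam X gw)^2] of the identity plus
   [sg^2 V^2 / 2]. *)
have s1 : 0 <= (4 * lam * X * gw - sg * V) ^+ 2 by exact: sqr_ge0.
have s2 : 0 <= sg * lam * (V - W) ^+ 2 by rewrite mulr_ge0 ?sqr_ge0// mulr_ge0//; lra.
have c1 : 0 <= lam * lam * (X * X) * (gv * gv).
  by apply: mulr_ge0 => //; apply: mulr_ge0 => //; lra.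
have c2 : 0 <= lam * (gv * gv) by apply: mulr_ge0 => //; lra.
have c3 : 0 <= lam * (gw * gw) by apply: mulr_ge0 => //; lra.
have c4 : 0 <= lam * lam * lam * (X * X - 1) * (V * V + W * W).
  by apply: mulr_ge0 => //; apply: mulr_ge0 => //; lra.
have V0 : 0 <= V * V by rewrite -expr2 sqr_ge0.
have W0 : 0 <= W * W by rewrite -expr2 sqr_ge0.
have sl : sg <= lam / 4 by lra.
have sg2 : sg * sg <= lam * lam / 16.
  by have := ler_pM sgp sgp sl sl; lra.
have sgl : sg * lam <= lam * lam / 4.
  have l0' : 0 <= lam by lra.
  by have := ler_wpM2r l0' sl; lra.
have ll3 : 4 * (lam * lam) <= lam * lam * lam.
  by have := ler_wpM2l l2 l4; lra.
have c5 : sg * sg * (V * V) <= lam * lam / 16 * (V * V + W * W).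
  by apply: ler_pM => //; [rewrite mulr_ge0|lra].
have c6 : sg * lam * (V * V + W * W) <= lam * lam / 4 * (V * V + W * W).
  by apply: ler_wpM2r.
have c7 : 4 * (lam * lam) * (V * V + W * W) <= lam * lam * lam * (V * V + W * W).
  by apply: ler_wpM2r.
have c8 : 0 <= lam * lam * (V * V + W * W) by apply: mulr_ge0.
have e3 : lam ^+ 3 = lam * lam * lam by rewrite exprS expr2 mulrA.
rewrite e3; move: s1 s2; rewrite !sqrrB; lra.
Qed.

(** The constant [128] covers [3 * 40] for the three Carleman fluxes and [1] for each of the two
    boundary terms of [cross_derive], where [V_t] and [W_t] on the sphere come in. *)
Lemma momentum'_ge t : 0 < t ->
  lam ^+ 3 * wenergy t - 128 * kap * bd t <= momentum' t.
Proof.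
move=> t0; have k1 := flux_const_ge1.
pose G1 p := div1 r lam v p + div1 r lam w p.
pose G2 p := div2 r lam v p + div2 r lam w p.
pose G3 p := div3 r lam v p + div3 r lam w p.
have cG1 : continuous G1 by rewrite /G1 /div1; cont.
have cG2 : continuous G2 by rewrite /G2 /div2; cont.
have cG3 : continuous G3 by rewrite /G3 /div3 /div1 /div2; cont.
pose F1 p := flux1 r lam v p + flux1 r lam w p.
pose F2 p := flux2 r lam v p + flux2 r lam w p.
pose F3 p := flux3 r lam v p + flux3 r lam w p.
have cF1 : continuous F1 by rewrite /F1 /flux1; cont.
have cF2 : continuous F2 by rewrite /F2 /flux2; cont.
have cF3 : continuous F3 by rewrite /F3 /flux3; cont.
have d1 : sd r i0 F1 G1 by move=> p cp; apply: is_derive_add; apply: flux1_derive cp.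
have d2 : sd r i1 F2 G2 by move=> p cp; apply: is_derive_add; apply: flux2_derive cp.
have d3 : sd r i2 F3 G3 by move=> p cp; apply: is_derive_add; apply: flux3_derive cp.
have k0 : 0 <= kap by lra.
have fb (c : R) (f : jet -> spacetime R -> R) p : 0 <= c ->
    (forall u, `|f u p| <= c * kap * jet_sq u p) ->
    `|f v p + f w p| <= c * kap * Q p.
  move=> c0 fu; apply: (le_trans (ler_normD _ _)).
  apply: (@le_trans _ _ (c * kap * (jet_sq v p + jet_sq w p))).
    by rewrite mulrDr lerD.
  apply: ler_wpM2l; first by rewrite mulr_ge0.
  by rewrite /bdry_density; have := sqr_ge0 (jt v p); have := sqr_ge0 (jt w p); lra.
have H : `|I (fun x => G1 (x, t) + G2 (x, t) + G3 (x, t))| <= 3 * (40 * kap) * bd t.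
  have q0 u p : 0 <= kap * jet_sq u p.
    have [/andP[a0 a1] _] := jet_sq_le u p.
    by rewrite mulr_ge0//; apply: le_trans a1.
  apply: (@le_ball_div3 F1 F2 F3 G1 G2 G3 (40 * kap) t) => // p pr; apply: fb => // u;
    have [b1 b2 b3] := flux_bounds r0 sg0 lamsg u pr; have := q0 u p; lra.
have bb (a b : spacetime R -> R) : continuous a -> continuous b ->
    (forall p, a p ^+ 2 + b p ^+ 2 <= Q p) ->
    `|bdry3 r (fun x => wg1 (x, t) * a (x, t) * b (x, t))| <= kap * bd t.
  move=> ca cb abQ.
  have cab : continuous (fun p => wg1 p * a p * b p) by cont.
  apply: le_trans (sphere_flux_le r0 vok wok t cab _).
    by apply: (bdry3_sphere r0); cont.
  move=> p pr; have [W1 _ _ _] := weights_le r0 sg0 lamsg pr.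
  have := prod_bound (a p) (b p) W1.
  rewrite (_ : wg1 p * (2 * a p * b p) = 2 * (wg1 p * a p * b p)); last by ring.
  rewrite normrM ger0_norm// => H1.
  have := ler_wpM2l k0 (abQ p); lra.
have qd p : j0 v p ^+ 2 + jt w p ^+ 2 <= Q p /\ j0 w p ^+ 2 + jt v p ^+ 2 <= Q p.
  have := sqr_ge0 (jt v p); have := sqr_ge0 (jt w p).
  have [/andP[a0 a1] _] := jet_sq_le v p; have [/andP[b0 b1] _] := jet_sq_le w p.
  by rewrite /bdry_density => c d; split; lra.
have := bb _ _ cv0 cwt (fun p => proj1 (qd p)).
have := bb _ _ cw0 cvt (fun p => proj2 (qd p)).
move: H; rewrite !ler_norml => /andP[H1 H2] /andP[B1 B2] /andP[B3 B4].
have : lam ^+ 3 * wenergy t + I (fun x => G1 (x, t) + G2 (x, t) + G3 (x, t)) <=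
   I (fun x => wg1 (x, t) * jt v (x, t) * j3 w (x, t))
   - I (fun x => (wg2 (x, t) * j0 v (x, t) + wg1 (x, t) * j3 v (x, t)) * jt w (x, t))
   - (I (fun x => wg1 (x, t) * jt w (x, t) * j3 v (x, t))
   - I (fun x => (wg2 (x, t) * j0 w (x, t) + wg1 (x, t) * j3 w (x, t)) * jt v (x, t))).
  rewrite /wenergy -ball_intZ; [|by []|by cont].
  rewrite -ball_intD; [|by []|by cont|by cont].
  rewrite -!ball_intB; [|by []|by cont|by cont|by []|by cont|by cont|by []|by cont|by cont].
  apply: le_ball_int => //; [by cont|by cont|].
  by move=> x Bx; apply: momentum_density_ge; split.
rewrite /momentum' => H3.
have b0 := mulr_ge0 k0 (bdry_energy_ge0 r v w t).
by lra.
Qed.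

End EnergyDerivatives.

(** * Interior regularity and traces *)

Section Schwarz.
Context {R : realType} {V : normedModType R}.
Implicit Types (h : V -> R) (x a b v : V) (O : set V).

Lemma line_MVT h h' x v (s : R) : 0 < s ->
  (forall u, 0 <= u <= s -> is_derive (x + u *: v) v h (h' (x + u *: v))) ->
  exists2 c, 0 <= c <= s & h (x + s *: v) - h x = h' (x + c *: v) * s.
Proof.
move=> s0 dh.
have dl u : 0 <= u <= s ->
    is_derive u (1 : R) (fun u => h (x + u *: v)) (h' (x + u *: v)).
  by move=> us; apply: is_derive_line; exact: dh.
have [||c + E] := @MVT _ (fun u => h (x + u *: v)) (fun u => h' (x + u *: v)) 0 s s0.
- by move=> u; rewrite in_itv/= => /andP[u0 us]; apply: dl; rewrite !ltW.
- apply: derivable_within_continuous => u; rewrite in_itv/= => us.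
  exact: (@ex_derive _ _ _ _ _ _ _ (dl u us)).
- rewrite in_itv/= => /andP[c0 cs]; exists c; first by rewrite !ltW.
  by move: E; rewrite /= scale0r addr0 subr0.
Qed.

Lemma is_derive_shift h x v c d :
  is_derive (x + c) v h d -> is_derive x v (fun q => h (q + c)) d.
Proof.
move=> dh; apply: is_derive_ofline.
have E : (fun u : R => h (x + u *: v + c)) = (fun u => h (x + c + u *: v)).
  by apply/funext => u; rewrite addrAC.
by rewrite E; apply: is_derive_line; rewrite scale0r addr0.
Qed.

(** The mean value theorem twice: in direction [a] for [h (q + s b) - h q], then in direction [b]
    for [ha]. *)
Lemma second_difference O h ha hba x a b (s : R) : 0 < s ->
  (forall q, O q -> is_derive q a h (ha q)) ->
  (forall q, O q -> is_derive q b ha (hba q)) ->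
  (forall u v : R, 0 <= u <= s -> 0 <= v <= s -> O (x + u *: a + v *: b)) ->
  exists u v : R, [/\ 0 <= u <= s, 0 <= v <= s &
    h (x + s *: a + s *: b) - h (x + s *: a) - h (x + s *: b) + h x =
    hba (x + u *: a + v *: b) * s * s].
Proof.
move=> s0 da dba Os.
have z0 : 0 <= (0 : R) <= s by rewrite lexx ltW.
have ss : 0 <= s <= s by rewrite lexx ltW.
have [|u us Eu] := @line_MVT (fun q => h (q + s *: b) - h q)
    (fun q => ha (q + s *: b) - ha q) x a s s0.
  move=> u us; apply: is_derive_sub.
    by apply: is_derive_shift; apply: da; exact: Os.
  by apply: da; have := Os u 0 us z0; rewrite scale0r addr0.
have [|v vs Ev] := @line_MVT ha hba (x + u *: a) b s s0.
  by move=> v vs; apply: dba; exact: Os.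
exists u, v; split=> //.
by rewrite -Ev -Eu; ring.
Qed.

(** The second difference is symmetric in [a] and [b], so each mixed derivative takes its value
    divided by [s^2] at some point as close to [p] as desired, and continuity at [p] concludes. It
    is needed because [C42] treats every word of directions separately and does not identify the
    different orders. *)
Lemma schwarz O h ha hb hab hba p a b : open O -> O p ->
  (forall q, O q -> is_derive q a h (ha q)) ->
  (forall q, O q -> is_derive q b h (hb q)) ->
  (forall q, O q -> is_derive q b ha (hba q)) ->
  (forall q, O q -> is_derive q a hb (hab q)) ->
  {for p, continuous hab} -> {for p, continuous hba} -> hab p = hba p.
Proof.
move=> oO Op da db dba dab cab cba.
apply/eqP; rewrite -subr_eq0 -normr_le0; apply/ler_addgt0Pl => e e0.
rewrite addr0.
have e20 : 0 < e / 2 by rewrite divr_gt0.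
have /cvgrPdist_le/(_ _ e20) nab := cab.
have /cvgrPdist_le/(_ _ e20) nba := cba.
pose m (w : R * R) : V := p + w.1 *: a + w.2 *: b.
have m0 : m (0, 0) = p by rewrite /m/= !scale0r !addr0.
have : m @ nbhs ((0, 0) : R * R) --> m (0, 0).
  apply: cvgD; [apply: cvgD; first exact: cvg_cst|].
    by apply: cvgZr_tmp; exact: cvg_fst.
  by apply: cvgZr_tmp; exact: cvg_snd.
rewrite m0 => cm.
have nO := open_nbhs_nbhs (conj oO Op).
have /cm : nbhs p [set q | [/\ O q, `|hab p - hab q| <= e / 2 & `|hba p - hba q| <= e / 2]].
  by near=> q; split; near: q.
move=> /nbhs_ballP[d /= d0 md].
pose s := d / 2.
have s0 : 0 < s by rewrite divr_gt0.
have Hm (u v : R) : 0 <= u <= s -> 0 <= v <= s ->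
    [/\ O (p + u *: a + v *: b), `|hab p - hab (p + u *: a + v *: b)| <= e / 2 &
      `|hba p - hba (p + u *: a + v *: b)| <= e / 2].
  move=> /andP[u0 us] /andP[v0 vs]; apply: (md (u, v)).
  by split; rewrite /ball/= sub0r normrN ger0_norm//; rewrite /s in us vs; lra.
have [|u [v [us vs E1]]] := second_difference s0 da dba (x := p).
  by move=> u v us vs; have [] := Hm u v us vs.
have [|v' [u' [vs' us' E2]]] := second_difference s0 db dab (x := p).
  by move=> v' u' vs' us'; rewrite addrAC; have [] := Hm u' v' us' vs'.
have [_ _ n1] := Hm _ _ us vs; have [_ n2 _] := Hm _ _ us' vs'.
have E : hba (p + u *: a + v *: b) = hab (p + u' *: a + v' *: b).
  have s0' : s != 0 by rewrite gt_eqF.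
  apply: (mulIf s0'); apply: (mulIf s0'); rewrite -E1 (addrAC p (u' *: a)) -E2.
  by rewrite (addrAC p (s *: b)); ring.
move: n1 n2; rewrite E !ler_norml => /andP[? ?] /andP[? ?].
by apply/andP; split; lra.
Unshelve. all: by end_near. Qed.

End Schwarz.

(** * Continuous extensions of the derivatives, and traces *)

Section Regularity.
Context {R : realType}.
Variables (r : R) (r0 : 0 < r).
Implicit Types (p : spacetime R) (s : seq (option 'I_3)).

Lemma open_cyl : open (@cyl R r).
Proof.
have -> : @cyl R r = (fun p => enorm p.1) @^-1` [set y | y < r] `&`
    (fun p => p.2) @^-1` [set y | 0 < y].
  by apply/seteqP; split => p.
have c1 : continuous (fun p : spacetime R => enorm p.1).
  by have ce := @enorm_continuous R; cont.
have c2 : continuous (fun p : spacetime R => p.2) by cont.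
apply: openI.
  by apply: open_comp; [move=> p _; exact: c1|exact: open_lt].
by apply: open_comp; [move=> p _; exact: c2|exact: open_gt].
Qed.

Lemma cyl_near p : cyl r p -> \forall q \near p, cyl r q.
Proof. by move=> cp; apply: open_nbhs_nbhs; split => //; exact: open_cyl. Qed.

(** A retraction onto the closed cylinder: radial projection on the ball and truncation of time at
    zero. Composing with it extends a function continuous on the closed cylinder to the whole
    space-time. *)
Definition clip p : spacetime R :=
  ((r / Num.max r (enorm p.1)) *: p.1, Num.max p.2 0).

Lemma clip_id p : ccyl r p -> clip p = p.
Proof.
case: p => x t [/= xr t0]; rewrite /clip/=.
by rewrite (max_idPl xr) (max_idPl t0) divff ?gt_eqF// scale1r.
Qed.

Let max_gt0 (x : space3 R) : 0 < Num.max r (enorm x).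
Proof. by rewrite lt_max r0. Qed.

Lemma clip_ccyl p : ccyl r (clip p).
Proof.
split => /=; last by rewrite le_max lexx orbT.
have m0 := max_gt0 p.1.
rewrite enorm_scale; last by rewrite divr_ge0// ltW.
by rewrite mulrAC ler_pdivrMr// ler_pM2l// le_max lexx orbT.
Qed.

Lemma clip_continuous : continuous clip.
Proof.
have cm : continuous (fun p : spacetime R => r / Num.max r (enorm p.1)).
  apply: continuous_mul; first by cont.
  apply: continuous_inv => [p|]; first by rewrite gt_eqF.
  apply: continuous_max; first by cont.
  by have ce := @enorm_continuous R; cont.
apply: continuous_pair.
  by move=> p; apply: cvgZ; [exact: cm|exact: cvg_fst].
by cont.
Qed.

Lemma clip_comp_continuous (g : spacetime R -> R) :
  {within ccyl r, continuous g} -> continuous (g \o clip).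
Proof.
move=> /subspace_continuousP cg p.
have cp := cg _ (clip_ccyl p).
apply: cvg_comp cp => A /= wA.
have := clip_continuous wA; rewrite /fmap/nbhs/=.
by apply: filterS => q; apply; exact: clip_ccyl.
Qed.

Lemma closure_cyl p : ccyl r p -> closure (cyl r) p.
Proof.
move=> [pr p0] B /= nB.
(* Inner points that approach [p]: the space part shrinks by the factor [1 - u] and time advances by
   [u]. *)
pose m (u : R) : spacetime R := ((1 - u) *: p.1, p.2 + u).
have m0 : m 0 = p by rewrite /m subr0 scale1r addr0; case: (p).
have cm : continuous m.
  apply: (@continuous_pair _ _ _ (fun u : R => (1 - u) *: p.1) (fun u => p.2 + u));
    last by cont.
  move=> u; apply: cvgZr_tmp.
  by have : continuous (fun u : R => 1 - u); [cont|exact].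
have : nbhs (0 : R) (m @^-1` B) by apply: (cm 0); rewrite m0.
move=> /nbhs_ballP[d /= d0 md].
pose u := Num.min (d / 2) (1 / 2).
have u0 : 0 < u by rewrite lt_min !divr_gt0.
have ud : u < d by rewrite gt_min ltr_pdivrMr// ltr_pMr// ltrDl ltr01.
have u1 : u < 1 by rewrite gt_min (_ : 1 / 2 < 1 :> R) ?orbT//; lra.
exists (m u); split; last first.
  by apply: md; rewrite /ball/= sub0r normrN gtr0_norm.
split => /=; last by rewrite ltr_wpDl.
rewrite /Ball/= enorm_scale; last by rewrite subr_ge0 ltW.
apply: (@le_lt_trans _ _ ((1 - u) * r)); first by rewrite ler_pM2l// subr_gt0.
by rewrite gtr_pMl// gtrBl.
Qed.

(** The filter of the trace is proper because [p] is adherent to the open cylinder, so the limit is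
    unique and is that of [g]. *)
Lemma traceE (g h : spacetime R -> R) p : continuous g ->
  (forall q, cyl r q -> h q = g q) -> ccyl r p -> trace r h p = g p.
Proof.
move=> cg hg cp; have := closure_cyl cp => clp.
have PF : ProperFilter (within (cyl r) (nbhs p)) by exact: within_nbhs_proper.
rewrite /trace; apply/cvg_lim => //.
apply: (@cvg_trans _ (g @ within (cyl r) (nbhs p))).
  apply: near_eq_cvg; rewrite near_withinE.
  by near=> q => cq; rewrite hg.
by apply: cvg_within_filter; exact: cg.
Unshelve. all: by end_near. Qed.

(** From here on the derivatives of [U] are represented by continuous functions [E s] on the whole
    space-time, one for each word: they agree with the derivatives in the open cylinder and give
    their traces on its boundary. *)
Lemma C42_extension (U : spacetime R -> R) : C42 r U ->
  exists E : seq (option 'I_3) -> spacetime R -> R,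
  [/\ forall s, (weight s <= 4)%N -> continuous (E s),
      forall s p, (weight s <= 4)%N -> cyl r p -> E s p = pderivs (map (@dir R) s) U p &
      forall d s p, (weight (d :: s) <= 4)%N -> cyl r p ->
        is_derive p (dir d) (E s) (E (d :: s) p)].
Proof.
move=> hU.
have H s : exists g : spacetime R -> R, (weight s <= 4)%N -> continuous g /\
    forall p, cyl r p -> g p = pderivs (map (@dir R) s) U p.
  (* Words of weight above four get the zero function. *)
  have [ws|] := boolP (weight s <= 4)%N; last by exists (fun=> 0).
  have [_ [g cg gE]] := hU s ws.
  exists (g \o clip) => _; split; first exact: clip_comp_continuous.
  move=> p cp; have [Bp p0] := cp.
  by rewrite /= clip_id ?gE//; split; exact: ltW.
have [E HE] := choice H; exists E; split.
- by move=> s /HE[].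
- by move=> s p /HE[_]; exact.
- move=> d s p w cp.
  have ws : (weight s <= 4)%N.
    by apply: leq_trans w; rewrite /weight big_cons leq_addl.
  have [_ Es] := HE s ws; have [_ Eds] := HE (d :: s) w.
  have [+ _] := hU _ w => /(_ d s erefl p cp) dU.
  apply: (@near_eq_is_derive _ _ _ (pderivs (map (@dir R) s) U)).
    by near=> q; rewrite Es//; near: q; exact: cyl_near.
  by rewrite Eds//; exact: DeriveDef.
Unshelve. all: by end_near. Qed.

End Regularity.

Ltac weigh := by rewrite /weight ?big_cons big_nil.

(** * The jets of [U_t] and of [lap U] *)

Section Jets.
Context {R : realType}.
Variables (r : R) (r0 : 0 < r) (E : seq (option 'I_3) -> spacetime R -> R).
Implicit Types (p : spacetime R) (s : seq (option 'I_3)) (d : option 'I_3).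
Hypothesis Ec : forall s, (weight s <= 4)%N -> continuous (E s).
Hypothesis Ed : forall d s p, (weight (d :: s) <= 4)%N -> cyl r p ->
  is_derive p (dir d) (E s) (E (d :: s) p).

Lemma words_swap d d' s : (weight (d :: d' :: s) <= 4)%N ->
  forall p, cyl r p -> E (d :: d' :: s) p = E (d' :: d :: s) p.
Proof.
move=> w p cp.
have w' : (weight (d' :: d :: s) <= 4)%N.
  by move: w; rewrite /weight !big_cons addnCA.
have w1 : (weight (d :: s) <= 4)%N.
  by apply: leq_trans w'; rewrite [in leqRHS]/weight big_cons leq_addl.
have w2 : (weight (d' :: s) <= 4)%N.
  by apply: leq_trans w; rewrite [in leqRHS]/weight big_cons leq_addl.
apply: (@schwarz _ _ (cyl r) (E s) (E (d :: s)) (E (d' :: s)) _ _ p (dir d) (dir d')).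
- exact: open_cyl.
- exact: cp.
- by move=> q; exact: Ed.
- by move=> q; exact: Ed.
- by move=> q; exact: Ed.
- by move=> q; exact: Ed.
- exact: Ec.
- exact: Ec.
Qed.

(** Functions equal in the open cylinder have equal derivatives there; this carries an exchange of
    letters under an outer letter. *)
Lemma words_cons d s s' : (weight (d :: s) <= 4)%N -> (weight (d :: s') <= 4)%N ->
  (forall p, cyl r p -> E s p = E s' p) ->
  forall p, cyl r p -> E (d :: s) p = E (d :: s') p.
Proof.
move=> w w' ss p cp; have D := Ed w cp; have D' := Ed w' cp.
have : is_derive p (dir d) (E s') (E (d :: s) p).
  apply: near_eq_is_derive D.
  by near=> q; apply: ss; near: q; exact: cyl_near.
by move=> D2; rewrite -(@derive_val _ _ _ _ _ _ _ D2) (@derive_val _ _ _ _ _ _ _ D').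
Unshelve. all: by end_near. Qed.

Local Notation N := (@None 'I_3).
Local Notation a := (Some i0).
Local Notation b := (Some i1).
Local Notation c := (Some i2).

(** The word [s] applied to [lap U]: letters act from right to left, so the two letters of the
    Laplacian stand at the end. *)
Definition lapE s p := E (s ++ [:: a; a]) p + E (s ++ [:: b; b]) p + E (s ++ [:: c; c]) p.

Definition vjet := Jet (E [:: N]) (E [:: N; N]) (E [:: a; N]) (E [:: b; N]) (E [:: c; N])
  (E [:: a; a; N]) (E [:: b; b; N]) (E [:: c; c; N]) (E [:: a; c; N]) (E [:: b; c; N]).

Definition wjet := Jet (lapE [::]) (lapE [:: N]) (lapE [:: a]) (lapE [:: b]) (lapE [:: c])
  (lapE [:: a; a]) (lapE [:: b; b]) (lapE [:: c; c]) (lapE [:: a; c]) (lapE [:: b; c]).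

Lemma lapE_continuous s : (weight s <= 2)%N -> continuous (lapE s).
Proof.
move=> w; have H (d : 'I_3) : (weight (s ++ [:: Some d; Some d]) <= 4)%N.
  by rewrite /weight big_cat/= -/(weight s) !big_cons big_nil/= (leq_add w).
have ca := Ec (H i0); have cb := Ec (H i1); have cc := Ec (H i2).
by rewrite /lapE; cont.
Qed.

Lemma lapE_derive d s p : (weight (d :: s) <= 2)%N -> cyl r p ->
  is_derive p (dir d) (lapE s) (lapE (d :: s) p).
Proof.
move=> w cp; have H (e : 'I_3) : (weight (d :: s ++ [:: Some e; Some e]) <= 4)%N.
  rewrite -cat_cons /weight big_cat/= -/(weight (d :: s)) !big_cons big_nil/=.
  by rewrite (leq_add w).
by rewrite /lapE; apply: is_derive_add; [apply: is_derive_add|]; apply: Ed => //; exact: H.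
Qed.

Lemma vjet_ok : jet_ok r vjet.
Proof.
split=> /=; try (by [apply: Ec; weigh]);
  try (by [move=> p cp; apply: (@Ed None) => //; weigh]);
  try (by [move=> p cp; apply: (@Ed (Some _)) => //; weigh]).
(* The derivative of [j1] in the third direction has the letter [c] outermost, whereas [j13] is
   stored with [a] outermost. *)
- move=> p cp; rewrite (@words_swap a c) => [|//|]; [|weigh|exact: cp].
  by apply: (@Ed c) => //; weigh.
- move=> p cp; rewrite (@words_swap b c) => [|//|]; [|weigh|exact: cp].
  by apply: (@Ed c) => //; weigh.
Qed.

Lemma wjet_ok : jet_ok r wjet.
Proof.
split=> /=; try (by [apply: lapE_continuous; weigh]);
  try (by [move=> p cp; apply: (@lapE_derive None) => //; weigh]);
  try (by [move=> p cp; apply: (@lapE_derive (Some _)) => //; weigh]).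
- move=> p cp; have -> : lapE [:: a; c] p = lapE [:: c; a] p.
    by rewrite /lapE /= !(@words_swap a c)//; weigh.
  by apply: (@lapE_derive c) => //; weigh.
- move=> p cp; have -> : lapE [:: b; c] p = lapE [:: c; b] p.
    by rewrite /lapE /= !(@words_swap b c)//; weigh.
  by apply: (@lapE_derive c) => //; weigh.
Qed.

(** Moves the time letter inside both space letters; summed over [e] it says that
    [d_t lap U = lap U_t], the second equation of the system. *)
Lemma words_time_last e p : cyl r p ->
  E [:: N; Some e; Some e] p = E [:: Some e; Some e; N] p.
Proof.
move=> cp; rewrite words_swap//; last by weigh.
apply: words_cons cp; [weigh|weigh|].
by apply: words_swap; weigh.
Qed.

Lemma wjet_time p : cyl r p -> jt wjet p = j11 vjet p + j22 vjet p + j33 vjet p.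
Proof. by move=> cp; rewrite /= /lapE /= !words_time_last. Qed.

End Jets.

(** * Values at time zero *)

Section InitialValues.
Context {R : realType}.
Variables (r : R) (r0 : 0 < r).

(** The derivative relation holds for positive times only, so the vanishing of [g] on the slice
    cannot be differentiated directly. If [c = g' (x, 0)] were nonzero, [c g'] would exceed
    [c^2 / 2] near [(x, 0)]; the mean value theorem at small times [t > 0] would make [c g] increase
    by at least [c^2 s / 2] over a step [s], and this survives as [t] tends to zero. *)
Lemma zero_initial_slice i (g g' : spacetime R -> R) : continuous g -> continuous g' ->
  sd r i g g' -> (forall x, Ball r x -> g (x, 0) = 0) ->
  forall x, Ball r x -> g' (x, 0) = 0.
Proof.
move=> cg cg' dg g0 x Bx; apply/eqP/negPn/negP => c0.
pose c := g' (x, 0).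
have c20 : 0 < c * c by rewrite -expr2 exprn_even_gt0.
have e0 : 0 < c * c / 2 by rewrite divr_gt0.
pose m (w : R * R) : spacetime R := (x + w.1 *: basis3 i, w.2).
have mE w : m w = (x, w.2) + w.1 *: dx i.
  by rewrite /m /dx; congr (_, _); rewrite /= scaler0 addr0.
have m0 : m (0, 0) = (x, 0) by rewrite /m/= scale0r addr0.
have cm1 : continuous (fun w : R * R => x + w.1 *: basis3 i).
  move=> w; apply: cvgD; first exact: cvg_cst.
  by apply: cvgZr_tmp; exact: cvg_fst.
have cm : continuous m.
  by apply: (@continuous_pair _ _ _ (fun w : R * R => x + w.1 *: basis3 i) (fun w => w.2));
    cont.
have cce : continuous (fun w : R * R => enorm (x + w.1 *: basis3 i)).
  by have ce := @enorm_continuous R; cont.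
have n1 : \forall w \near ((0, 0) : R * R), enorm (x + w.1 *: basis3 i) < r.
  have := cce (0, 0); rewrite /continuous_at /= scale0r addr0 => cx.
  exact: (cvgr_lt _ cx _ Bx).
have ch : continuous (fun w : R * R => c * g' (m w)) by cont.
have n2 : \forall w \near ((0, 0) : R * R), c * c / 2 < c * g' (m w).
  have := ch (0, 0); rewrite /continuous_at m0 => cx.
  by apply: (cvgr_gt _ cx); rewrite -/c; lra.
have : \forall w \near ((0, 0) : R * R),
    enorm (x + w.1 *: basis3 i) < r /\ c * c / 2 < c * g' (m w).
  by near=> w; split; near: w.
move=> /nbhs_ballP[d /= d0 md].
pose s := d / 2; have s0 : 0 < s by rewrite divr_gt0.
have Hm (u v : R) : 0 <= u <= s -> 0 <= v <= s ->
    enorm (x + u *: basis3 i) < r /\ c * c / 2 < c * g' (m (u, v)).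
  move=> /andP[u0 us] /andP[v0 vs]; apply: (md (u, v)).
  by split; rewrite /ball/= sub0r normrN ger0_norm//; rewrite /s in us vs; lra.
have ss : 0 <= s <= s by rewrite lexx ltW.
have z0 : 0 <= (0 : R) <= s by rewrite lexx ltW.
have B1 : Ball r (x + s *: basis3 i) by have [] := Hm s 0 ss z0.
have H t : 0 < t -> t <= s ->
    c * c / 2 * s <= c * (g (x + s *: basis3 i, t) - g (x, t)).
  move=> t0 ts; have tt : 0 <= t <= s by rewrite (ltW t0).
  have [|u us] := @line_MVT _ _ g g' (x, t) (dx i) s s0.
    move=> u us; apply: dg; rewrite -(mE (u, t)); split => //=.
    by have [] := Hm u t us tt.
  rewrite -(mE (s, t)) -(mE (u, t)) /m/= => ->.
  have [_] := Hm u t us tt; rewrite /m/= mulrA => h.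
  by rewrite ler_pM2r// ltW.
pose phi t := c * (g (x + s *: basis3 i, t) - g (x, t)).
have cphi : continuous phi by rewrite /phi; cont.
have : c * c / 2 * s <= phi 0.
  apply: (@cvgr_to_ge _ ((0 : R)^'+) _ _ phi (phi 0)).
    by apply: cvg_at_right_filter; exact: cphi.
  by near=> t; apply: H => //; near: t; exact: nbhs_right_le.
rewrite /phi !g0// subrr mulr0; apply/negP; rewrite -ltNge.
by rewrite mulr_gt0.
Unshelve. all: by end_near. Qed.

Lemma ball_int_zero (f : space3 R -> R) : (forall x, Ball r x -> f x = 0) -> ball_int r
  f = 0.
Proof.
move=> f0; rewrite (@eq_ball_int _ r f (fun=> 0 * 0)) => [|x /f0]; last by rewrite mul0r.
by rewrite ball_intZ ?mul0r//; cont.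
Qed.

Lemma momentum_initial (lam : R) (v w : jet (R := R)) : jet_ok r w ->
  (forall x, Ball r x -> j0 w (x, 0) = 0) -> momentum r lam v w 0 = 0.
Proof.
move=> wok w0; rewrite /momentum !ball_int_zero ?subrr//.
  by move=> x Bx; rewrite w0// mulr0 mul0r.
move=> x Bx; rewrite (zero_initial_slice (cj0 wok) (cj3 wok) (dj03 wok))// mulr0//.
Qed.

End InitialValues.

(** * The first-order system satisfied by the jets of a solution *)

Section PlateJets.
Context {R : realType}.
Variables (r : R) (r0 : 0 < r) (U : spacetime R -> R) (E : seq (option 'I_3) ->
  spacetime R -> R).
Hypothesis Ec : forall s, (weight s <= 4)%N -> continuous (E s).
Hypothesis EU : forall s p, (weight s <= 4)%N -> cyl r p ->
  E s p = pderivs (map (@dir R) s) U p.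
Hypothesis Ed : forall d s p, (weight (d :: s) <= 4)%N -> cyl r p ->
  is_derive p (dir d) (E s) (E (d :: s) p).
Local Notation N := (@None 'I_3).

Lemma sum_I3 (F : 'I_3 -> R) : \sum_(i < 3) F i = F i0 + F i1 + F i2.
Proof.
rewrite !big_ord_recr big_ord0/= add0r.
by congr (F _ + F _ + F _); exact: val_inj.
Qed.

Lemma esum_I3 (F : 'I_3 -> \bar R) : (\sum_(i < 3) F i = F i0 + F i1 + F i2)%E.
Proof.
rewrite !big_ord_recr big_ord0/= add0e.
by congr (F _ + F _ + F _)%E; exact: val_inj.
Qed.

Lemma lap_wjet p : cyl r p -> lap U p = lapE E [::] p.
Proof.
move=> cp.
have H (i : 'I_3) : 'D_(dx i) ('D_(dx i) U) p = E [:: Some i; Some i] p.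
  by apply/esym/(EU _ cp); weigh.
rewrite /lap sum_I3; congr (_ + _ + _); exact: H.
Qed.

Lemma derive_lap d p : (weight [:: d] <= 2)%N -> cyl r p ->
  'D_(dir d) (lap U) p = lapE E [:: d] p.
Proof.
move=> w cp; rewrite (@near_eq_derive _ _ _ _ (lapE E [::])).
  exact: (@derive_val _ _ _ _ _ _ _ (lapE_derive Ed w cp)).
by near=> q; apply: lap_wjet; near: q; exact: cyl_near.
Unshelve. all: by end_near. Qed.

Lemma derive2_lap (i : 'I_3) p : cyl r p ->
  'D_(dx i) ('D_(dx i) (lap U)) p = lapE E [:: Some i; Some i] p.
Proof.
move=> cp; rewrite (@near_eq_derive _ _ _ _ (lapE E [:: Some i])).
  have w : (weight [:: Some i; Some i] <= 2)%N by weigh.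
  exact: (@derive_val _ _ _ _ _ _ _ (lapE_derive Ed w cp)).
by near=> q; apply: (@derive_lap (Some i)); [weigh|near: q; exact: cyl_near].
Unshelve. all: by end_near. Qed.

(** The plate equation itself, once [lap (lap U)] is recognized as the Laplacian of [wjet E]. *)
Lemma vjet_time (sg : R) p : cyl r p ->
  'D_dt ('D_dt U) p + lap (lap U) p + sg * 'D_dt U p = 0 ->
  jt (vjet E) p =
  - (j11 (wjet E) p + j22 (wjet E) p + j33 (wjet E) p) - sg * j0 (vjet E) p.
Proof.
move=> cp.
have -> : lap (lap U) p = j11 (wjet E) p + j22 (wjet E) p + j33 (wjet E) p.
  rewrite {1}/lap sum_I3; congr (_ + _ + _); exact: (derive2_lap _ cp).
have -> : 'D_dt ('D_dt U) p = jt (vjet E) p.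
  by apply: esym; apply: (EU (s := [:: N; N]) _ cp); weigh.
have -> : 'D_dt U p = j0 (vjet E) p.
  by apply: esym; apply: (EU (s := [:: N]) _ cp); weigh.
by move=> H; apply/eqP; rewrite -subr_eq0 -H; apply/eqP; ring.
Qed.

(** Since [U] vanishes on the initial slice, [zero_initial_slice] applies to it and then to its
    first space derivatives. *)
Lemma wjet_initial : (forall x, Ball r x -> trace r U (x, 0) = 0) ->
  forall x, Ball r x -> j0 (wjet E) (x, 0) = 0.
Proof.
move=> U0; have E0 x : Ball r x -> E [::] (x, 0) = 0.
  move=> Bx; apply: etrans (U0 x Bx); apply: esym; apply: (traceE r0) => //.
  - by apply: Ec; weigh.
  - by move=> q cq; apply: esym; apply: (EU (s := [::]) _ cq); weigh.
  - by split => //=; exact: ltW.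
have H (i : 'I_3) x : Ball r x -> E [:: Some i; Some i] (x, 0) = 0.
  apply: (@zero_initial_slice _ r i (E [:: Some i])); try (by [apply: Ec; weigh]).
    by move=> p cp; apply: (@Ed (Some i)) => //; weigh.
  apply: (@zero_initial_slice _ r i (E [::])) E0; try (by [apply: Ec; weigh]).
  by move=> p cp; apply: (@Ed (Some i)) => //; weigh.
by move=> x Bx; rewrite /= /lapE /= !H// !addr0.
Qed.

Lemma vjet_initial (x : space3 R) : Ball r x -> trace r ('D_dt U) (x, 0) = j0 (vjet E)
  (x, 0).
Proof.
move=> Bx; apply: (traceE r0) => //=.
- by apply: Ec; weigh.
- by move=> q cq; apply: esym; apply: (EU (s := [:: N]) _ cq); weigh.
- by split => //=; exact: ltW.
Qed.

(** The boundary norm is that of [d_t grad U], whereas [vjet] stores [grad d_t U]. *)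
Lemma time_gradient (i : 'I_3) p : cyl r p -> 'D_dt ('D_(dx i) U) p = E [:: Some i; N] p.
Proof.
move=> cp; rewrite -(@words_swap _ r E Ec Ed N (Some i) [::] _ p cp); last by weigh.
by apply: esym; apply: (EU (s := [:: N; Some i]) _ cp); weigh.
Qed.

End PlateJets.

(** * Boundary norms and the final estimate *)

Section BoundaryNorms.
Context {R : realType}.
Local Notation mR := (measurableTypeR R).
Local Notation mu := (@lebesgue_measure R).
Variables (r : R) (r0 : 0 < r) (T : R).
Implicit Types (g h q : spacetime R -> R).

Definition lateral_int q := primitive (fun t => sphere_int r (fun x => q (x, t))) T.

Lemma integral_lateral (k : space3 R -> R) : continuous k ->
  (forall a, (angles `*` `]0%R, T[) a -> 0 <= k a) ->
  (\int[leb3]_(a in angles `*` `]0%R, T[) (k a)%:E =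
   \int[mu]_(t in `]0%R, T[) \int[leb2]_(a in angles) (k (a, t))%:E)%E.
Proof.
move=> ck k0; pose D : set (mR * mR * mR) := angles `*` `]0%R, T[.
have mD : measurable D.
  by apply: measurableX; [exact: measurable_angles|exact: measurable_itv].
have mk : measurable_fun [set: mR * mR * mR] (EFin \o k).
  by apply/measurable_EFinP; exact: continuous_measurable3.
have mkD : measurable_fun setT ((EFin \o k) \_ D).
  by apply/(measurable_restrictT _ mD); apply: measurable_funS mk.
rewrite integral_mkcond.
apply: (etrans (@fubini_tonelli2 _ _ _ _ _ leb2 mu ((EFin \o k) \_ D) mkD _)).
  by move=> q; apply: erestrict_ge0 => x Dx; rewrite lee_fin k0.
rewrite [RHS]integral_mkcond; apply: eq_integral => t _.
rewrite [RHS]/patch; case: ifPn => [/set_mem It|/negP It].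
  rewrite [RHS]integral_mkcond; apply: eq_integral => a _; rewrite /patch.
  congr (if _ then _ else _); apply/idP/idP; rewrite !inE; first by case.
  by move=> Aa; split.
rewrite /fubini_G integral0_eq// => a _; rewrite /patch ifF//.
by apply/negP => /set_mem[_ It']; apply: It; rewrite inE.
Qed.

(** Tonelli with time outermost; the norm is taken on the open time interval and [primitive] on the
    closed one. *)
Lemma lateral_int_EFin q : continuous q -> (forall p, 0 <= q p) ->
  ((lateral_int q)%:E = \int[leb3]_(a in angles `*` `]0%R, T[)
     (r ^+ 2 * sin a.1.1 * q (sphere r a.1, a.2))%:E)%E.
Proof.
move=> cq q0; pose b t := sphere_int r (fun x => q (x, t)).
have cb : continuous b by exact: sphere_int_continuous.
have ib : mu.-integrable `[0, T] (EFin \o b).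
  apply: continuous_compact_integrable; first exact: segment_compact.
  exact: continuous_subspaceT.
have cs : continuous (fun a : space3 R => sphere r a.1).
  by rewrite /sphere; cont.
rewrite integral_lateral.
- rewrite /lateral_int /primitive /Rintegral fineK; last first.
    exact: integrable_fin_num.
  rewrite (@integral_itv_bndoo _ 0 T _ true false); last first.
    by apply/measurable_EFinP; apply: measurable_continuous_itv.
  apply: eq_integral => t _; rewrite sphere_intE//.
  by cont.
- by cont.
- move=> a [[/=]]; rewrite in_itv/= => ap _ _; apply: mulr_ge0 => //.
  by apply: mulr_ge0; [exact: sqr_ge0|exact: sin_ge0_pi].
Qed.

Lemma sqnormL2_bdry_trace g h : continuous g -> (forall p, cyl r p -> h p = g p) ->
  sqnormL2_bdry r T (trace r h) = (lateral_int (fun p => g p ^+ 2))%:E.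
Proof.
move=> cg hg; rewrite lateral_int_EFin; [|by cont|by move=> p; exact: sqr_ge0].
apply: eq_integral => a; rewrite inE => -[_]; rewrite /= in_itv/= => /andP[t0 _].
rewrite (traceE r0 cg hg)//; split => /=; last exact: ltW.
by rewrite sphere_norm.
Qed.

Lemma lateral_intD q1 q2 : continuous q1 -> continuous q2 ->
  lateral_int q1 + lateral_int q2 = lateral_int (fun p => q1 p + q2 p).
Proof.
move=> c1 c2; have I q : continuous q ->
    mu.-integrable `[0, T] (EFin \o (fun t => sphere_int r (fun x => q (x, t)))).
  move=> cq; apply: continuous_compact_integrable; first exact: segment_compact.
  by apply: continuous_subspaceT; exact: sphere_int_continuous.
rewrite /lateral_int /primitive -RintegralD//; [|exact: I|exact: I].
by apply: eq_Rintegral => t _; rewrite sphere_intD//; cont.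
Qed.

End BoundaryNorms.

(** * The choice of the parameters *)

Section CarlemanConstants.
Context {R : realType}.

(** For [q = sqrt sigma], [s = 2 M (1 + q)] and [lam = s^2] this is the requirement
    [4 (1 + sigma) <= lam]. *)
Lemma damping_root_le (M q : R) : 1 <= M -> 0 <= q ->
  4 * (1 + q ^+ 2) <= (2 * M * (1 + q)) ^+ 2.
Proof.
move=> M1 q0; have M2 : 1 <= M * M by rewrite -[leLHS]mulr1 ler_pM.
have h : 0 <= (1 + q) * (1 + q) by rewrite mulr_ge0// addr_ge0.
have h2 := ler_wpM2r h M2.
rewrite (_ : (2 * M * (1 + q)) ^+ 2 = 4 * (M * M * ((1 + q) * (1 + q)))); last by ring.
by lra.
Qed.

(** The exponents that arise are of size [s^3], that is [sigma^(3/2)] for large [sigma]; this is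
    where they are weakened to [1 + sigma^2], as [q^4 = sigma^2]. *)
Lemma cube_root_le (q : R) : 0 <= q -> (1 + q) ^+ 3 <= 8 * (1 + q ^+ 4).
Proof.
move=> q0; have [q1|q1] := leP q 1.
  have : (1 + q) ^+ 3 <= 2 ^+ 3 by rewrite lerXn2r ?nnegrE//; lra.
  by have := exprn_ge0 4 q0; lra.
have h : (1 + q) ^+ 3 <= (2 * q) ^+ 3 by rewrite lerXn2r ?nnegrE//; lra.
have h2 : q ^+ 3 <= q ^+ 4 by rewrite ler_eXn2l.
by move: h; rewrite exprMn => h; lra.
Qed.

(** Absorbs into the exponential the polynomial factor [lam^3 = s^6] of [flux_const]. *)
Lemma sixth_power_le_exp (s : R) : 2 <= s -> s ^+ 6 <= expR (2 * s ^+ 3).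
Proof.
move=> s2; have s0 : 0 <= s by lra.
have h : s <= expR s by apply: le_trans (expR_ge1Dx s); lra.
have h6 : s ^+ 6 <= expR s ^+ 6 by rewrite lerXn2r ?nnegrE// ltW// expR_gt0.
apply: (le_trans h6); rewrite -expRM_natl ler_expR -mulr_natl.
have : 4 * s <= s ^+ 3.
  have ss : 2 * 2 <= s * s by apply: ler_pM.
  by have := ler_wpM2r s0 ss; rewrite (_ : s ^+ 3 = s * s * s); [lra|ring].
by lra.
Qed.

(** With [y = exp (k T / 4)] and [k = s^3 / 2], the left side is at most [32 y^2] and the right side
    at least [y^8 - 1]. The weight is bounded by [y] because [s >= 2 M] and [T >= 4 M] give
    [s^2 M^2 <= k M <= k T / 4]. *)
Lemma observation_condition (s M T sg : R) :
  1 <= M -> 2 * M <= s -> 4 * M <= T -> 0 <= sg -> sg <= s ^+ 3 / 2 ->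
  2 * expR (s ^+ 2 * (M * M)) * (1 + 2 * (s ^+ 3 / 2 + sg) * T) <=
  (expR (2 * (s ^+ 3 / 2) * T) - 1) * expR (s ^+ 2).
Proof.
move=> M1 sM TM sg0 sgs.
have s2 : 2 <= s by lra.
set k := s ^+ 3 / 2 in sgs *.
have s38 : 8 <= s ^+ 3.
  have : 2 ^+ 3 <= s ^+ 3 by rewrite lerXn2r ?nnegrE//; lra.
  by lra.
have k4 : 4 <= k by rewrite /k; lra.
have kT : k * (4 * M) <= k * T by apply: ler_wpM2l => //; lra.
have kM : k * 1 <= k * M by apply: ler_wpM2l => //; lra.
pose x := k * T / 4.
have x4 : 4 <= x by rewrite /x; lra.
have Zx : s ^+ 2 * (M * M) <= x.
  have : s ^+ 2 * M * (2 * M) <= s ^+ 2 * M * s.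
    by apply: ler_wpM2l => //; apply: mulr_ge0; [exact: sqr_ge0|lra].
  have -> : s ^+ 2 * M * s = 2 * (k * M) by rewrite /k; field.
  by rewrite /x; lra.
have e1 : expR (s ^+ 2 * (M * M)) <= expR x by rewrite ler_expR.
have sT : sg * T <= k * T by apply: ler_wpM2r => //; lra.
have x1 : 1 + x <= expR x := expR_ge1Dx x.
have q16 : 1 + 2 * (k + sg) * T <= 16 * expR x.
  by rewrite /x in x1 *; lra.
set y := expR x in e1 x1 q16.
have q0 : 0 <= 1 + 2 * (k + sg) * T.
  by rewrite addr_ge0// mulr_ge0//; lra.
have h1 : expR (s ^+ 2 * (M * M)) * (1 + 2 * (k + sg) * T) <= y * (16 * y).
  by apply: ler_pM => //; exact: expR_ge0.
have -> : 2 * k * T = 8%:R * x by rewrite /x; field.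
rewrite expRM_natl -/y.
have y5 : 5 <= y by lra.
have yy : 25 <= y * y by have := ler_pM (ler0n _ 5) (ler0n _ 5) y5 y5; lra.
have y4 : 625 <= y * y * (y * y).
  by have := ler_pM (ler0n _ 25) (ler0n _ 25) yy yy; lra.
have y6 : 625 * (y * y) <= y * y * (y * y) * (y * y).
  by apply: ler_wpM2r => //; lra.
have y8 : 25 * (y * y * (y * y) * (y * y)) <= y * y * (y * y * (y * y) * (y * y)).
  by apply: ler_wpM2r => //; lra.
have c1 : 1 <= expR (s ^+ 2) by rewrite -expR0 ler_expR sqr_ge0.
have -> : y ^+ 8 = y * y * (y * y * (y * y) * (y * y)) by ring.
set Y := y * y * (y * y * (y * y) * (y * y)) in y8 *.
have Y1 : 0 <= Y - 1 by lra.
apply: (@le_trans _ _ (Y - 1)); first by lra.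
by rewrite -[leLHS]mulr1; apply: ler_wpM2l.
Qed.

End CarlemanConstants.

(** * The observability estimate for the system *)

Section Observability.
Context {R : realType}.
Variables (r : R) (r0 : 0 < r) (sg : R) (sg0 : 0 <= sg).
Variables (v w : jet (R := R)) (vok : jet_ok r v) (wok : jet_ok r w).
Hypothesis vtE : forall p, cyl r p ->
  jt v p = - (j11 w p + j22 w p + j33 w p) - sg * j0 v p.
Hypothesis wtE : forall p, cyl r p -> jt w p = j11 v p + j22 v p + j33 v p.
Hypothesis w0 : forall x, Ball r x -> j0 w (x, 0) = 0.
Local Notation M := (hgt_max r).

Let M1 : 1 <= M := hgt_max_ge1 r0.

Lemma wenergy_bounds (lam t : R) : 4 * (1 + sg) <= lam ->
  [/\ 0 <= wenergy r lam v w t, wenergy r lam v w t <= wgt_max r lam * energy r v w t &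
    expR lam * energy r v w t <= wenergy r lam v w t].
Proof.
move=> lamsg; have cv0 := cj0 vok; have cw0 := cj0 wok.
have cwg := @wgt_continuous R r lam.
have d0 x : 0 <= j0 v (x, t) ^+ 2 + j0 w (x, t) ^+ 2 by rewrite addr_ge0// sqr_ge0.
have wb (x : space3 R) : Ball r x -> expR lam <= wgt r lam (x, t) <= wgt_max r lam.
  by move=> Bx; apply: (wgt_bounds r0 sg0 lamsg) => /=; exact: ltW.
rewrite /wenergy /energy; split.
- rewrite -(@ball_int_zero _ r r0 (fun=> 0))//.
  apply: (le_ball_int r0); [by cont|by cont|] => x Bx.
  by apply: mulr_ge0 => //; exact/ltW/wgt_gt0.
- rewrite -(ball_intZ r0); last by cont.
  apply: (le_ball_int r0); [by cont|by cont|] => x Bx.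
  by apply: ler_wpM2r => //; have /andP[] := wb x Bx.
- rewrite -(ball_intZ r0); last by cont.
  apply: (le_ball_int r0); [by cont|by cont|] => x Bx.
  by apply: ler_wpM2r => //; have /andP[] := wb x Bx.
Qed.

(** The parameter [s] is the square root of [lam], so that the rate [k = lam^(3/2) / 2] becomes the
    polynomial [s^3 / 2]. *)
Lemma energy_observability (s T : R) : 2 * M <= s -> 4 * M <= T ->
  4 * (1 + sg) <= s ^+ 2 ->
  energy r v w 0 <= 2 * expR (s ^+ 3 * T) *
    (128 * flux_const r (s ^+ 2) * primitive (bdry_energy r v w) T).
Proof.
move=> sM TM lamsg; set lam := s ^+ 2 in lamsg *.
have m1 := M1; have s2 : 2 <= s by lra.
have sgp := sg0.
have sgs : sg <= s ^+ 3 / 2.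
  have : 2 * s ^+ 2 <= s * s ^+ 2 by apply: ler_wpM2r => //; exact: sqr_ge0.
  by rewrite -exprS -/lam; lra.
have wb t := wenergy_bounds t lamsg.
have T0 : 0 < T by lra.
have -> : s ^+ 3 * T = 2 * (s ^+ 3 / 2) * T by field.
have K0 : 0 <= flux_const r lam.
  by apply: le_trans (kap_geZ r0 sg0 lamsg); apply: le_trans (Z_ge1 r0 sg0 lamsg).
apply: (@observability_ode _ T sg (128 * flux_const r lam) (wgt_max r lam) (s ^+ 3 / 2)
  (expR lam) (lam ^+ 3) (energy r v w) (energy' r v w) (wenergy r lam v w)
  (wenergy' r lam v w) (momentum r lam v w) (momentum' r lam v w)) => //.
- by rewrite mulr_ge0.
- exact: Z_ge1 sg0 lamsg.
- have : 2 ^+ 3 <= s ^+ 3 by rewrite lerXn2r ?nnegrE//; lra.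
  by lra.
- by rewrite -expR0 ler_expR; lra.
(* With [k = s^3 / 2], [lam^3 = s^6 = 4 k^2]: half of it is left for [2 k sg], as [sg <= k]. *)
- have h : 2 * (s ^+ 3 / 2) * sg <= 2 * (s ^+ 3 / 2) * (s ^+ 3 / 2).
    by apply: ler_wpM2l => //; lra.
  have -> : lam ^+ 3 = 2 * (s ^+ 3 / 2) ^+ 2 + 2 * (s ^+ 3 / 2) * (s ^+ 3 / 2).
    by rewrite /lam; field.
  by lra.
- exact: energy_continuous.
- exact: wenergy_continuous.
- exact: momentum_continuous.
- exact: bdry_energy_continuous.
- by move=> t; exact: bdry_energy_ge0.
- by move=> t; have [] := wb t.
- by move=> t _; have [] := wb t.
- by have [] := wb 0.
- exact: momentum_initial.
- exact: energy_derive.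
- exact: wenergy_derive.
- exact: momentum_derive.
- by move=> t; exact: (energy'_le r0 vok wok sg0 lamsg vtE wtE).
- by move=> t; exact: (wenergy'_ge r0 vok wok sg0 lamsg vtE wtE).
- by move=> t; exact: (momentum'_ge r0 vok wok sg0 lamsg vtE wtE).
- exact: observation_condition.
Qed.

Lemma energy_estimate (T : R) : 4 * M <= T -> T <= 5 * M ->
  energy r v w 0 <= 256 * M ^+ 3 * expR (512 * M ^+ 4 * (1 + sg ^+ 2)) *
    primitive (bdry_energy r v w) T.
Proof.
move=> TM TM'; pose q := Num.sqrt sg.
have q0 : 0 <= q := sqrtr_ge0 sg.
have qq : q ^+ 2 = sg by rewrite sqr_sqrtr.
pose s := 2 * M * (1 + q); have m1 := M1.
have sM : 2 * M <= s.
  by rewrite /s -[leLHS]mulr1; apply: ler_wpM2l; lra.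
have lamsg : 4 * (1 + sg) <= s ^+ 2 by rewrite -qq; exact: damping_root_le.
apply: (le_trans (energy_observability sM TM lamsg)).
have T0 : 0 <= T by lra.
have P0 : 0 <= primitive (bdry_energy r v w) T.
  have TT : 0 <= T <= T by rewrite T0 lexx.
  by have /andP[] := primitive_le (bdry_energy_continuous r0 vok wok)
    (bdry_energy_ge0 r v w) TT.
rewrite [in leLHS]mulrA; apply: ler_wpM2r => //.
have s2 : 2 <= s by lra.
have M0 : 0 <= M by lra.
have s30 : 0 <= s ^+ 3 by rewrite exprn_ge0//; lra.
have M30 : 0 <= M ^+ 3 by rewrite exprn_ge0.
have s6 := sixth_power_le_exp s2.
(* Here [256 = 2 * 128], and [s^6] is the factor [lam^3] of [flux_const]. *)
rewrite /flux_const /wgt_max (_ : 2 * _ * _ = 256 * M ^+ 3 *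
    (expR (s ^+ 3 * T) * s ^+ 6 * expR (s ^+ 2 * (M * M)))); last by ring.
apply: ler_wpM2l; first by apply: mulr_ge0; [exact: ler0n|exact: M30].
apply: (@le_trans _ _ (expR (s ^+ 3 * T) * expR (2 * s ^+ 3) * expR (s ^+ 2 * (M * M)))).
  apply: ler_wpM2r; first exact: expR_ge0.
  by apply: ler_wpM2l; first exact: expR_ge0.
rewrite -!expRD ler_expR.
(* The exponent [s^3 T + 2 s^3 + s^2 M^2] is at most [(5 + 2 + 1/2) s^3 M], hence below
   [8 s^3 M = 64 M^4 (1 + q)^3], which [cube_root_le] bounds by [512 M^4 (1 + q^4)]. *)
have h1 : s ^+ 3 * T <= s ^+ 3 * (5 * M) by exact: ler_wpM2l.
have h2 : s ^+ 3 * 1 <= s ^+ 3 * M by exact: ler_wpM2l.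
have h3 : s ^+ 2 * M * (2 * M) <= s ^+ 2 * M * s.
  by apply: ler_wpM2l => //; apply: mulr_ge0 => //; exact: sqr_ge0.
have e3 : s ^+ 2 * M * s = s ^+ 3 * M by ring.
have h4 : s ^+ 3 * M = 8 * M ^+ 4 * (1 + q) ^+ 3 by rewrite /s; ring.
have h5 : 8 * M ^+ 4 * (1 + q) ^+ 3 <= 8 * M ^+ 4 * (8 * (1 + q ^+ 4)).
  by apply: ler_wpM2l (cube_root_le q0); apply: mulr_ge0 => //; exact: exprn_ge0.
rewrite -qq -exprM; lra.
Qed.

End Observability.

(** * The norm of the data and the assembly of the boundary terms *)

Section DataNorm.
Context {R : realType}.
Local Notation mR := (measurableTypeR R).
Variables (r : R) (r0 : 0 < r).

(** The initial trace agrees with [f] almost everywhere only, while the energy at time zero is the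
    integral of a continuous representative. *)
Lemma sqnormL2_ae (f g : space3 R -> R) : continuous g ->
  measurable_fun (Ball r : set (mR * mR * mR)) f ->
  {ae leb3, forall x, Ball r x -> g x = f x} ->
  sqnormL2 (Ball r) f = (ball_int r (fun x => g x ^+ 2))%:E.
Proof.
move=> cg mf gf; have cg2 : continuous (fun x => g x ^+ 2) by cont.
rewrite /ball_int /Rintegral fineK; last first.
  by apply: integrable_fin_num; [exact: measurable_Ball|exact: integrable_Ball].
apply: ae_eq_integral.
- exact: measurable_Ball.
- by apply/measurable_EFinP; exact: measurable_funX.
- by apply/measurable_EFinP; exact: measurable_fun_Ball.
- by apply: negligibleS gf => x; apply: contra_not => gfx Bx; rewrite /= gfx.
Qed.

(** Passes from real numbers to extended reals in one step, once every boundary norm is identified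
    with a real number. *)
Lemma le_boundary_terms (e c a1 a2 a3 a4 : R) (x1 x2 x3 x4 : \bar R)
    (f g : 'I_3 -> R) (F G : 'I_3 -> \bar R) :
  x1 = a1%:E -> x2 = a2%:E -> (forall i, F i = (f i)%:E) ->
  x3 = a3%:E -> x4 = a4%:E -> (forall i, G i = (g i)%:E) ->
  e <= c * (a1 + a2 + (f i0 + f i1 + f i2) + a3 + a4 + (g i0 + g i1 + g i2)) ->
  (e%:E <= c%:E * (x1 + x2 + \sum_(i < 3) F i + x3 + x4 + \sum_(i < 3) G i))%E.
Proof. by move=> -> -> Ff -> -> Gg H; rewrite !esum_I3 !Ff !Gg lee_fin. Qed.

(** The terms are grouped as in the final estimate, so that its right side is recognized as it
    stands. *)
Lemma lateral_bdry_energy (v w : jet (R := R)) (T : R) : jet_ok r v -> jet_ok r w ->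
  let q g := lateral_int r T (fun p : spacetime R => g p ^+ 2) in
  q (jt v) + q (j0 v) + (q (j1 v) + q (j2 v) + q (j3 v)) + q (jt w) + q (j0 w)
    + (q (j1 w) + q (j2 w) + q (j3 w)) = primitive (bdry_energy r v w) T.
Proof.
move=> vok wok /=.
have c0 := cj0 vok; have ct := cjt vok; have c1 := cj1 vok; have c2 := cj2 vok.
have c3 := cj3 vok; have d0 := cj0 wok; have dt := cjt wok; have d1 := cj1 wok.
have d2 := cj2 wok; have d3 := cj3 wok.
have LD := @lateral_intD R r r0 T; set L := lateral_int r T in LD *.
have -> : primitive (bdry_energy r v w) T = L (bdry_density v w) by [].
move: L LD => L LD; rewrite !LD; try (by cont).
congr (L _); apply/funext => p.
by rewrite /bdry_density /jet_sq; ring.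
Qed.

Lemma energy_initial (v w : jet (R := R)) : (forall x, Ball r x -> j0 w (x, 0) = 0) ->
  energy r v w 0 = ball_int r (fun x => j0 v (x, 0) ^+ 2).
Proof.
by move=> w0; apply: eq_ball_int => x Bx; rewrite w0// expr0n/= addr0.
Qed.

End DataNorm.

Theorem theoremA1 (R : realType) (r : R) (r_gt0 : 0 < r) :
  exists C : R, 0 < C /\
  forall (sigma T : R) (n : nat) (f : space3 R -> R) (U : spacetime R -> R),
    0 < sigma ->
    4 * (2 * r + 1) < T -> T < 5 * (2 * r + 1) ->
    (4 <= n)%N -> sobolevH n (Ball r) f ->
    compact (supp f) -> supp f `<=` Ball r ->
    C42 r U ->
    (forall p, cyl r p ->
       'D_dt ('D_dt U) p + lap (lap U) p + sigma * 'D_dt U p = 0) ->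
    (forall x, Ball r x -> trace r U (x, 0) = 0) ->
    {ae leb3, forall x, Ball r x -> trace r ('D_dt U) (x, 0) = f x} ->
    (sqnormL2 (Ball r) f <=
     (C * expR (C * sigma ^+ 2))%:E *
     (sqnormL2_bdry r T (trace r ('D_dt ('D_dt U)))
      + sqnormL2_bdry r T (trace r ('D_dt U))
      + \sum_(i < 3) sqnormL2_bdry r T (trace r ('D_dt ('D_(dx i) U)))
      + sqnormL2_bdry r T (trace r ('D_dt (lap U)))
      + sqnormL2_bdry r T (trace r (lap U))
      + \sum_(i < 3) sqnormL2_bdry r T (trace r ('D_(dx i) (lap U)))))%E.
Proof.
have M1 := hgt_max_ge1 r_gt0; set M := hgt_max r in M1.
have M0 : 0 <= M by lra.
(* The factor [exp (b (1 + sigma^2))] splits into [exp b], which goes into [a], and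
   [exp (b sigma^2)]. *)
pose a := 256 * M ^+ 3 * expR (512 * M ^+ 4); pose b := 512 * M ^+ 4.
have a0 : 0 < a.
  apply: mulr_gt0 (expR_gt0 _); apply: mulr_gt0; first exact: ltr0n.
  by apply: exprn_gt0; lra.
have b0 : 0 <= b by apply: mulr_ge0; [exact: ler0n|exact: exprn_ge0].
(* A single constant is both the prefactor and the coefficient in the exponent, so it has to
   dominate [a] and [b]. *)
exists (a + b); split; first by rewrite ltr_wpDr.
move=> sigma T n f U sg0 T4 T5 n4 [[mf _] _] _ _ hU pde U0 U1.
have [E [Ec EU Ed]] := C42_extension r_gt0 hU.
pose v := vjet E; pose w := wjet E.
have vok : jet_ok r v := vjet_ok Ec Ed.
have wok : jet_ok r w := wjet_ok Ec Ed.
have w0 := wjet_initial r_gt0 Ec EU Ed U0.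
have T0 : 0 < T by lra.
have cv := cj0 vok.
(* At time zero [W] vanishes and [V] is [f] almost everywhere, so the energy is the squared norm of
   [f]. *)
have -> : sqnormL2 (Ball r) f = (energy r v w 0)%:E.
  rewrite energy_initial//.
  apply: (sqnormL2_ae r_gt0 (g := fun x => j0 v (x, 0))) => //; first by cont.
  apply: negligibleS U1 => x; apply: contra_not => H Bx.
  by rewrite -H// (vjet_initial r_gt0 Ec EU).
have sE := @sqnormL2_bdry_trace R r r_gt0 T.
apply: (@le_boundary_terms _ _ _ (lateral_int r T (fun p => jt v p ^+ 2))
  (lateral_int r T (fun p => j0 v p ^+ 2)) (lateral_int r T (fun p => jt w p ^+ 2))
  (lateral_int r T (fun p => j0 w p ^+ 2)) _ _ _ _
  (fun i => lateral_int r T (fun p => E [:: Some i; None] p ^+ 2))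
  (fun i => lateral_int r T (fun p => lapE E [:: Some i] p ^+ 2))).
- apply: sE; first exact: (cjt vok).
  by move=> p cp; apply: esym; apply: (EU [:: None; None] _ _ cp); weigh.
- apply: sE; first exact: (cj0 vok).
  by move=> p cp; apply: esym; apply: (EU [:: None] _ _ cp); weigh.
- move=> i; apply: sE; first by apply: Ec; weigh.
  by move=> p cp; exact: (time_gradient Ec EU Ed i cp).
- apply: sE; first exact: (cjt wok).
  by move=> p cp; apply: (derive_lap EU Ed (d := None) _ cp); weigh.
- by apply: sE; [exact: (cj0 wok)|move=> p cp; exact: lap_wjet EU _ cp].
- move=> i; apply: sE; first by apply: (lapE_continuous Ec); weigh.
  by move=> p cp; apply: (derive_lap EU Ed (d := Some i) _ cp); weigh.
have P := lateral_bdry_energy r_gt0 T vok wok.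
set X := (X in _ <= _ * X).
have -> : X = primitive (bdry_energy r v w) T by exact: P.
have TM : 4 * M <= T by exact: ltW.
have TM' : T <= 5 * M by exact: ltW.
have vtE p : cyl r p -> jt v p =
    - (j11 w p + j22 w p + j33 w p) - sigma * j0 v p.
  by move=> cp; exact: (vjet_time EU Ed cp (pde p cp)).
have wtE p : cyl r p -> jt w p = j11 v p + j22 v p + j33 v p.
  by move=> cp; exact: (wjet_time Ec Ed cp).
apply: (le_trans (energy_estimate r_gt0 (ltW sg0) vok wok vtE wtE w0 TM TM')).
apply: ler_wpM2r.
  have TT : 0 <= T <= T by rewrite lexx ltW.
  by have /andP[] := primitive_le (bdry_energy_continuous r_gt0 vok wok)
    (bdry_energy_ge0 r v w) TT.
rewrite mulrDr mulr1 expRD mulrA -/M -/a -/b.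
apply: ler_pM; [exact: ltW|exact: expR_ge0|by rewrite lerDl|].
by rewrite ler_expR; apply: ler_wpM2r; [exact: sqr_ge0|rewrite lerDr ltW].
Qed.
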